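(* Let $G$ be a finite abelian group. The assignment $\mathsf{Stab}(\hat\Delta^{\mathcal M}_G):\mathbf{k}\mapsto\mathsf{Stab}(\hat\Delta^{\mathcal M}_G)(\mathbf{k})$ (from commutative $\mathbb{Q}$-algebras to groups) is an affine $\mathbb{Q}$-group scheme, and $\mathbf{Lie}(\mathsf{Stab}(\hat\Delta^{\mathcal M}_G))=\mathfrak{stab}(\hat\Delta^{\mathcal M}_G)$.
   Context: An affine $\mathbb{Q}$-group scheme is a functor $\mathsf{G}$ from commutative $\mathbb{Q}$-algebras to groups representable by a Hopf $\mathbb{Q}$-algebra; its Lie algebra is $\mathbf{Lie}(\mathsf{G})=\ker(\mathsf{G}(\mathbb{Q}[\epsilon]/(\epsilon^2))\to\mathsf{G}(\mathbb{Q}))$. Let $X=\{x_0\}\sqcup\{x_g\mid g\in G\}$ ($G$ written multiplicatively). For a commutative $\mathbb{Q}$-algebra $\mathbf{k}$, $\mathbf{k}\langle\langle X\rangle\rangle$ is the algebra of noncommutative formal power series in $X$ (complete graded, letters of degree 1); $(v|w)$ is the coefficient of the word $w$ in $v$. $\hat\Delta$ is the continuous algebra morphism $\mathbf{k}\langle\langle X\rangle\rangle\to\mathbf{k}\langle\langle X\rangle\rangle^{\hat\otimes 2}$ with $x_g\mapsto x_g\otimes1+1\otimes x_g$ for $g\in G\sqcup\{0\}$, and $\mathcal{G}(\mathbf{k}\langle\langle X\rangle\rangle)=\{\Psi\in\mathbf{k}\langle\langle X\rangle\rangle^\times\mid\hat\Delta(\Psi)=\Psi\otimes\Psi\}$.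 For $g\in G$, $t_g$ is the continuous algebra automorphism $x_0\mapsto x_0$, $x_h\mapsto x_{gh}$. $\mathrm{aut}_\Psi$ is the continuous algebra automorphism $x_0\mapsto x_0$, $x_g\mapsto t_g(\Psi^{-1})x_gt_g(\Psi)$; the group law is $\Psi\circledast\Phi:=\Psi\,\mathrm{aut}_\Psi(\Phi)$. $\Gamma_\Psi(x):=\exp\big(\sum_{n\ge2}\frac{(-1)^{n-1}}{n}(\Psi|x_0^{n-1}x_1)x^n\big)$, $x_1$ being $x_g$ with $g=1$. $\ell_a$ is left multiplication by $a$. $\hat{\mathcal V}_G=\hat{\mathcal V}_G^{\mathbf{k}}$ is the complete graded topological $\mathbf{k}$-algebra generated by $\{e_0,e_1\}\sqcup G$ ($e_0,e_1$ of degree 1, elements of $G$ of degree 0) with relations: the product of $g,h\in G$ is $gh$; $1=1_G$; $ge_0=e_0g$. $\hat{\mathcal W}_G:=\mathbf{k}\oplus\hat{\mathcal V}_Ge_1$, $\hat{\mathcal M}_G:=\hat{\mathcal V}_G/(\hat{\mathcal V}_Ge_0+\sum_{g\ne1}\hat{\mathcal V}_G(g-1))$, $1_{\mathcal M}$ the class of $1$; a superscript $\mathbb{Q}$ denotes the case $\mathbf{k}=\mathbb{Q}$. The crossed product $\mathbf{k}\langle\langle X\rangle\rangle\rtimes G$ is $\mathbf{k}\langle\langle X\rangle\rangle\otimes\mathbf{k}G$ with product $(a\otimes g)\ast(b\otimes h)=a\,t_g(b)\otimes gh$; $\beta:\mathbf{k}\langle\langle X\rangle\rangle\rtimes G\to\hat{\mathcal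 V}_G$ is the algebra isomorphism with $x_0\otimes1\mapsto e_0$, $x_g\otimes1\mapsto-ge_1g^{-1}$, $1\otimes g\mapsto g$. $\hat{\mathcal W}_G$ is topologically freely generated by $z_{n,g}:=-e_0^{n-1}ge_1$ ($(n,g)\in\mathbb{N}^*\times G$); $\hat\Delta^{\mathcal W}_G:\hat{\mathcal W}_G\to\hat{\mathcal W}_G^{\hat\otimes2}$ is the topological algebra morphism with $z_{n,g}\mapsto z_{n,g}\otimes1+1\otimes z_{n,g}+\sum_{k=1}^{n-1}\sum_{h\in G}z_{k,h}\otimes z_{n-k,gh^{-1}}$. The map $w\mapsto w\cdot1_{\mathcal M}$ is a module isomorphism $\hat{\mathcal W}_G\to\hat{\mathcal M}_G$, and $\hat\Delta^{\mathcal M}_G:\hat{\mathcal M}_G\to\hat{\mathcal M}_G^{\hat\otimes2}$ is determined by $\hat\Delta^{\mathcal M}_G(w\cdot1_{\mathcal M})=\hat\Delta^{\mathcal W}_G(w)\cdot1_{\mathcal M}^{\otimes2}$. Group: $\mathrm{aut}^{\mathcal V,(0)}_\Psi$ is the topological algebra automorphism of $\hat{\mathcal V}_G$ with $e_0\mapsto e_0$, $e_1\mapsto\beta(\Psi^{-1}\otimes1)e_1\beta(\Psi\otimes1)$, $g\mapsto g$; $\ell_{\beta(\Psi\otimes1)}\circ\mathrm{aut}^{\mathcal V,(0)}_\Psi$ induces an automorphism $\mathrm{aut}^{\mathcal M,(10)}_\Psi$ of $\hat{\mathcal M}_G$; ${}^\Gamma\mathrm{aut}^{\mathcal M,(10)}_\Psi:=\ell_{\Gamma_\Psi^{-1}(-e_1)}\circ\mathrm{aut}^{\mathcal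 M,(10)}_\Psi$. $\mathsf{Stab}(\hat\Delta^{\mathcal M}_G)(\mathbf{k})$ is the subgroup of $(\mathcal{G}(\mathbf{k}\langle\langle X\rangle\rangle),\circledast)$ of all $\Psi$ with $({}^\Gamma\mathrm{aut}^{\mathcal M,(10)}_\Psi)^{\otimes2}\circ\hat\Delta^{\mathcal M}_G=\hat\Delta^{\mathcal M}_G\circ{}^\Gamma\mathrm{aut}^{\mathcal M,(10)}_\Psi$. Lie algebra: $\widehat{\mathfrak{Lib}}(X)$ is the free complete graded $\mathbb{Q}$-Lie algebra on $X$, identified with $\{\psi\in\mathbb{Q}\langle\langle X\rangle\rangle\mid\hat\Delta(\psi)=\psi\otimes1+1\otimes\psi\}$. For $\psi\in\widehat{\mathfrak{Lib}}(X)$, $d_\psi$ is the continuous derivation of $\mathbb{Q}\langle\langle X\rangle\rangle$ with $x_0\mapsto0$, $x_g\mapsto[x_g,t_g(\psi)]$; $s_\psi:=\ell_\psi+d_\psi$; $\langle\psi_1,\psi_2\rangle:=s_{\psi_1}(\psi_2)-s_{\psi_2}(\psi_1)$ is a Lie bracket, and $\mathbf{Lie}(\mathbf{k}\mapsto(\mathcal{G}(\mathbf{k}\langle\langle X\rangle\rangle),\circledast))=(\widehat{\mathfrak{Lib}}(X),\langle\cdot,\cdot\rangle)$ via $1+\epsilon\psi\leftrightarrow\psi$; Lie algebras of subgroup schemes are viewed as Lie subalgebras of it. $\gamma_\psi(x):=\sum_{n\ge1}\frac{(-1)^{n+1}}{n}(\psi|x_0^{n-1}x_1)x^n$. $\mathrm{der}^{\mathcal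 V,(0)}_\psi$ is the continuous derivation of $\hat{\mathcal V}_G^{\mathbb{Q}}$ with $e_0\mapsto0$, $e_1\mapsto[e_1,\beta(\psi\otimes1)]$, $g\mapsto0$; $\ell_{\beta(\psi\otimes1)}+\mathrm{der}^{\mathcal V,(0)}_\psi$ induces an endomorphism $\mathrm{end}^{\mathcal M,(10)}_\psi$ of $\hat{\mathcal M}_G^{\mathbb{Q}}$; ${}^\gamma\mathrm{end}^{\mathcal M,(10)}_\psi:=\ell_{-\gamma_\psi(-e_1)}+\mathrm{end}^{\mathcal M,(10)}_\psi$. $\mathfrak{stab}(\hat\Delta^{\mathcal M}_G)$ is the Lie subalgebra of all $\psi\in\widehat{\mathfrak{Lib}}(X)$ with $({}^\gamma\mathrm{end}^{\mathcal M,(10)}_\psi\otimes\mathrm{id}+\mathrm{id}\otimes{}^\gamma\mathrm{end}^{\mathcal M,(10)}_\psi)\circ\hat\Delta^{\mathcal M}_G=\hat\Delta^{\mathcal M}_G\circ{}^\gamma\mathrm{end}^{\mathcal M,(10)}_\psi$. *)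

(* Defs.v *)
From HB Require Import structures.
From mathcomp Require Import all_boot all_order all_algebra all_fingroup qpoly.
From mathcomp Require Import boolp classical_sets.
Set Implicit Arguments. Unset Strict Implicit. Unset Printing Implicit Defensive.
Import GRing.Theory.
Local Open Scope ring_scope.

(* Graded monoids with finitely many elements in every degree; glow n lists those
   of degree <= n. *)
Record gmonoid := GMonoid {
  gcar :> eqType;
  gmul : gcar -> gcar -> gcar;
  gone : gcar;
  gdeg : gcar -> nat;
  glow : nat -> seq gcar;
  gmulA : associative gmul;
  gmul1m : left_id gone gmul;
  gmulm1 : right_id gone gmul;
  gdegM : forall a b, gdeg (gmul a b) = (gdeg a + gdeg b)%N;
  glow_uniq : forall n, uniq (glow n);
  mem_glow : forall n a, (a \in glow n) = (gdeg a <= n)%N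
}.
Arguments gone {g}.

Lemma gdeg1 (M : gmonoid) : gdeg (gone : M) = 0%N.
Proof.
have := gdegM (gone : M) gone; rewrite gmul1m => /eqP.
by rewrite -{1}[gdeg _]addn0 eqn_add2l eq_sym => /eqP.
Qed.

Section BigLow.
Variables (k : comPzRingType) (M : gmonoid).
Implicit Types F : M -> k.

Lemma big_glow_widen m n F : (m <= n)%N ->
    (forall b, (m < gdeg b)%N -> F b = 0) ->
  \sum_(b <- glow M m) F b = \sum_(b <- glow M n) F b.
Proof.
move=> mn F0; rewrite [RHS](bigID (fun b => gdeg b <= m)%N) /=.
rewrite [X in _ + X]big1 ?addr0 => [|b]; last by rewrite -ltnNge; apply: F0.
rewrite -[RHS]big_filter; apply/perm_big/uniq_perm.
- exact: glow_uniq.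
- exact/filter_uniq/glow_uniq.
move=> b; rewrite mem_filter !mem_glow.
by case: leqP => //= bm; rewrite (leq_trans bm mn).
Qed.

Lemma big_glow_pick n F c :
    ((n < gdeg c)%N -> F c = 0) ->
  \sum_(a <- glow M n) (c == a)%:R * F a = F c.
Proof.
case: (leqP (gdeg c) n) => [cn _|nc /(_ isT) ->].
  rewrite (bigD1_seq c) ?mem_glow ?glow_uniq //= eqxx mul1r big1 ?addr0 //.
  by move=> a /negPf ac; rewrite eq_sym ac mul0r.
rewrite big_seq big1 // => a; rewrite mem_glow => an.
by case: eqP => [ca|_]; [rewrite ca ltnNge an in nc | rewrite mul0r].
Qed.
End BigLow.

(* The completed monoid algebra k[[M]]. All the complete graded algebras below
   (k<<X>>, V^, W^, one-variable series, completed tensor products) are of this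
   form, a series being given by the family of its coefficients. *)
Definition hser (k : comPzRingType) (M : gmonoid) : Type := M -> k.

Section Hser.
Variables (k : comPzRingType) (M : gmonoid).
HB.instance Definition _ := gen_eqMixin (hser k M).
HB.instance Definition _ := gen_choiceMixin (hser k M).
Implicit Types f g h : hser k M.

Let hadd f g : hser k M := fun b => f b + g b.
Let hopp f : hser k M := fun b => - f b.
Let hzero : hser k M := fun=> 0.

Fact haddA : associative hadd.
Proof. by move=> f g h; apply/funext => b; apply: addrA. Qed.
Fact haddC : commutative hadd.
Proof. by move=> f g; apply/funext => b; apply: addrC. Qed.
Fact hadd0 : left_id hzero hadd.
Proof. by move=> f; apply/funext => b; apply: add0r. Qed.
Fact haddN : left_inverse hzero hopp hadd.
Proof. by move=> f; apply/funext => b; apply: addNr. Qed.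

HB.instance Definition _ := GRing.isZmodule.Build (hser k M)
  haddA haddC hadd0 haddN.

Definition hscale (c : k) f : hser k M := fun b => c * f b.

Lemma hserDE f g b : (f + g) b = f b + g b. Proof. by []. Qed.

Definition hmono (b : M) : hser k M := fun c => (b == c)%:R.

Definition hmul f g : hser k M := fun b =>
  \sum_(x <- glow M (gdeg b)) \sum_(y <- glow M (gdeg b))
     (gmul x y == b)%:R * (f x * g y).

Lemma hmul_bound n f g b : (gdeg b <= n)%N ->
  hmul f g b = \sum_(x <- glow M n) \sum_(y <- glow M n)
     (gmul x y == b)%:R * (f x * g y).
Proof.
move=> bn; rewrite /hmul.
transitivity (\sum_(x <- glow M (gdeg b)) \sum_(y <- glow M n)
     (gmul x y == b)%:R * (f x * g y)).
  apply: eq_bigr => x _; apply: big_glow_widen => // y yb.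
  case: eqP => [bE|_]; last by rewrite mul0r.
  by move: yb; rewrite -bE gdegM ltnNge leq_addl.
apply: big_glow_widen => // x xb; apply: big1 => y _.
case: eqP => [bE|_]; last by rewrite mul0r.
by move: xb; rewrite -bE gdegM ltnNge leq_addr.
Qed.

Lemma hmul_monol a f b : hmul (hmono a) f b =
  \sum_(y <- glow M (gdeg b)) (gmul a y == b)%:R * f y.
Proof.
rewrite /hmul /hmono.
under eq_bigr => x _ do (under eq_bigr => y _ do rewrite mulrCA;
  rewrite -big_distrr /=).
apply: (big_glow_pick (F := fun x =>
  \sum_(y <- glow M (gdeg b)) (gmul x y == b)%:R * f y)) => ab.
apply: big1 => y _; case: eqP => [bE|_]; last by rewrite mul0r.
by move: ab; rewrite -bE gdegM ltnNge leq_addr.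
Qed.

Lemma hmul_monor a f b : hmul f (hmono a) b =
  \sum_(x <- glow M (gdeg b)) (gmul x a == b)%:R * f x.
Proof.
rewrite /hmul /hmono; apply: eq_bigr => x _.
under eq_bigr => y _ do rewrite [f x * _]mulrC mulrCA.
apply: (big_glow_pick (F := fun y => (gmul x y == b)%:R * f x)) => ab.
case: eqP => [bE|_]; last by rewrite mul0r.
by move: ab; rewrite -bE gdegM ltnNge leq_addl.
Qed.

Lemma hmulAl f g h b n : (gdeg b <= n)%N ->
  hmul f (hmul g h) b =
  \sum_(x <- glow M n) \sum_(y <- glow M n) \sum_(z <- glow M n)
    (gmul x (gmul y z) == b)%:R * (f x * g y * h z).
Proof.
move=> bn; rewrite (hmul_bound _ _ bn); apply: eq_bigr => x _.
transitivity (\sum_(a <- glow M n) \sum_(y <- glow M n) \sum_(z <- glow M n)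
     (gmul y z == a)%:R * ((gmul x a == b)%:R * (f x * g y * h z))).
  rewrite big_seq [RHS]big_seq; apply: eq_bigr => a; rewrite mem_glow => an.
  rewrite (hmul_bound _ _ an) !mulr_sumr; apply: eq_bigr => y _.
  rewrite !mulr_sumr; apply: eq_bigr => z _.
  by rewrite [X in _ * X]mulrCA [LHS]mulrCA [X in _ * (_ * X)]mulrA.
rewrite exchange_big; apply: eq_bigr => y _.
rewrite exchange_big; apply: eq_bigr => z _ /=.
rewrite (big_glow_pick (F := fun a => (gmul x a == b)%:R * _)) //.
case: eqP => [bE|_ _]; last by rewrite mul0r.
by rewrite ltnNge (leq_trans _ bn) // -bE [leqRHS]gdegM leq_addl.
Qed.

Lemma hmulAr f g h b n : (gdeg b <= n)%N ->
  hmul (hmul f g) h b =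
  \sum_(x <- glow M n) \sum_(y <- glow M n) \sum_(z <- glow M n)
    (gmul (gmul x y) z == b)%:R * (f x * g y * h z).
Proof.
move=> bn; rewrite (hmul_bound _ _ bn).
transitivity (\sum_(a <- glow M n) \sum_(x <- glow M n) \sum_(y <- glow M n)
   \sum_(z <- glow M n)
     (gmul x y == a)%:R * ((gmul a z == b)%:R * (f x * g y * h z))).
  rewrite big_seq [RHS]big_seq; apply: eq_bigr => a; rewrite mem_glow => an.
  under eq_bigr => z _ do rewrite (hmul_bound _ _ an) mulr_suml mulr_sumr.
  rewrite exchange_big; apply: eq_bigr => x _.
  under eq_bigr => z _ do rewrite mulr_suml mulr_sumr.
  rewrite exchange_big; apply: eq_bigr => y _; apply: eq_bigr => z _.
  by rewrite -[X in _ * X]mulrA [LHS]mulrCA.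
rewrite exchange_big; apply: eq_bigr => x _.
rewrite exchange_big; apply: eq_bigr => y _.
rewrite exchange_big; apply: eq_bigr => z _ /=.
rewrite (big_glow_pick (F := fun a => (gmul a z == b)%:R * _)) //.
case: eqP => [bE|_ _]; last by rewrite mul0r.
by rewrite ltnNge (leq_trans _ bn) // -bE [leqRHS]gdegM leq_addr.
Qed.

Fact hmulA : associative hmul.
Proof.
move=> f g h; apply/funext => b.
rewrite (hmulAl _ _ _ (leqnn _)) (hmulAr _ _ _ (leqnn _)).
by do 3!(apply: eq_bigr => ? _); rewrite gmulA.
Qed.

Fact hmul1l : left_id (hmono gone) hmul.
Proof.
move=> f; apply/funext => b; rewrite hmul_monol.
under eq_bigr => y _ do rewrite gmul1m eq_sym.
by apply: big_glow_pick; rewrite ltnn.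
Qed.

Fact hmul1r : right_id (hmono gone) hmul.
Proof.
move=> f; apply/funext => b; rewrite hmul_monor.
under eq_bigr => y _ do rewrite gmulm1 eq_sym.
by apply: big_glow_pick; rewrite ltnn.
Qed.

Fact hmulDl : left_distributive hmul +%R.
Proof.
move=> f g h; apply/funext => b; rewrite hserDE /hmul -big_split /=.
apply: eq_bigr => x _; rewrite -big_split; apply: eq_bigr => y _ /=.
by rewrite -mulrDr -mulrDl.
Qed.

Fact hmulDr : right_distributive hmul +%R.
Proof.
move=> f g h; apply/funext => b; rewrite hserDE /hmul -big_split /=.
apply: eq_bigr => x _; rewrite -big_split; apply: eq_bigr => y _ /=.
by rewrite -mulrDr -mulrDr.
Qed.

HB.instance Definition _ := GRing.Zmodule_isPzRing.Build (hser k M)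
  hmulA hmul1l hmul1r hmulDl hmulDr.

Lemma hmul_monor_at f (a x : M) : injective (fun y : M => gmul y a) ->
  (f * hmono a) (gmul x a) = f x.
Proof.
move=> a_inj; rewrite [LHS]hmul_monor.
have E y : (gmul y a == gmul x a) = (x == y).
  by apply/eqP/eqP => [/a_inj|->].
under eq_bigr => y _ do rewrite E.
by apply: big_glow_pick; rewrite gdegM ltnNge leq_addr.
Qed.

Lemma hmul_monor_out f (a b : M) : (forall x, gmul x a <> b) -> (f * hmono a) b = 0.
Proof.
move=> bP; rewrite [LHS]hmul_monor; apply: big1 => x _.
by case: eqP => [/bP|_] //; rewrite mul0r.
Qed.

Lemma hmonoM a b : hmono (gmul a b) = hmono a * hmono b.
Proof.
apply/funext => c; rewrite [RHS]hmul_monol /hmono.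
under eq_bigr => y _ do rewrite mulrC.
rewrite (big_glow_pick (F := fun y => (gmul a y == c)%:R)) //.
case: eqP => // <-; rewrite [X in (X < _)%N]gdegM.
by rewrite ltnNge leq_addl.
Qed.
End Hser.

(* Continuous linear maps out of k[[M]] are given by the images of the monomials.
   The sum is truncated to the monomials of degree <= deg c, which is correct
   for maps that do not lower degrees. *)
Section Extension.
Variables (k : comPzRingType) (M N : gmonoid).

Definition hext (phi : M -> hser k N) (f : hser k M) : hser k N := fun c =>
  \sum_(b <- glow M (gdeg c)) f b * phi b c.

Definition filtered (phi : M -> hser k N) :=
  forall b c, (gdeg c < gdeg b)%N -> phi b c = 0.

Lemma hextD phi f g : hext phi (f + g) = hext phi f + hext phi g.
Proof.
apply/funext => c; rewrite hserDE /hext -big_split.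
by apply: eq_bigr => b _; apply: mulrDl.
Qed.

Lemma hext_mono phi b : filtered phi -> hext phi (hmono k b) = phi b.
Proof.
move=> phiF; apply/funext => c; rewrite /hext /hmono.
exact/(big_glow_pick (F := fun b => phi b c))/phiF.
Qed.

Lemma hext_bound phi f c n : filtered phi -> (gdeg c <= n)%N ->
  hext phi f c = \sum_(b <- glow M n) f b * phi b c.
Proof.
by move=> phiF cn; apply: big_glow_widen => // b /phiF ->; rewrite mulr0.
Qed.

Lemma hextM phi : filtered phi ->
    (forall x y, phi (gmul x y) = phi x * phi y) ->
  forall f g, hext phi (f * g) = hext phi f * hext phi g.
Proof.
move=> phiF phiM f g; apply/funext => c; set n := gdeg c.
transitivity (\sum_(x <- glow M n) \sum_(y <- glow M n)
    f x * g y * phi (gmul x y) c).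
  transitivity (\sum_(b <- glow M n) \sum_(x <- glow M n) \sum_(y <- glow M n)
      (gmul x y == b)%:R * (f x * g y * phi b c)).
    rewrite /hext big_seq [RHS]big_seq; apply: eq_bigr => b; rewrite mem_glow.
    move=> bn; rewrite [(f * g) b](hmul_bound _ _ bn) mulr_suml.
    apply: eq_bigr => x _; rewrite mulr_suml; apply: eq_bigr => y _.
    by rewrite -mulrA.
  rewrite exchange_big; apply: eq_bigr => x _.
  rewrite exchange_big; apply: eq_bigr => y _ /=.
  rewrite (big_glow_pick (F := fun b => f x * g y * phi b c)) //.
  by move=> /phiF ->; rewrite mulr0.
rewrite [RHS]/GRing.mul /= /hmul -/n.
transitivity (\sum_(c1 <- glow N n) \sum_(c2 <- glow N n)
    \sum_(x <- glow M n) \sum_(y <- glow M n)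
    f x * g y * ((gmul c1 c2 == c)%:R * (phi x c1 * phi y c2))); last first.
  rewrite big_seq [RHS]big_seq; apply: eq_bigr => c1; rewrite mem_glow => c1n.
  rewrite big_seq [RHS]big_seq; apply: eq_bigr => c2; rewrite mem_glow => c2n.
  rewrite !(hext_bound _ phiF (n := n)) // mulr_suml mulr_sumr.
  apply: eq_bigr => x _; rewrite !mulr_sumr; apply: eq_bigr => y _.
  by rewrite mulrCA mulrACA.
under [RHS]eq_bigr => c1 _ do rewrite exchange_big.
rewrite [RHS]exchange_big; apply: eq_bigr => x _ /=.
under [RHS]eq_bigr => c1 _ do rewrite exchange_big.
rewrite [RHS]exchange_big; apply: eq_bigr => y _ /=.
rewrite phiM [X in _ * X]/GRing.mul /= /hmul -/n mulr_sumr.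
by apply: eq_bigr => c1 _; rewrite mulr_sumr.
Qed.
End Extension.

Section Order.
Variables (k : comPzRingType) (M : gmonoid).

Definition order_ge n (f : hser k M) := forall c, (gdeg c < n)%N -> f c = 0.

Lemma order_ge0 (f : hser k M) : order_ge 0 f. Proof. by []. Qed.

Lemma order_geM m n f g : order_ge m f -> order_ge n g -> order_ge (m + n) (f * g).
Proof.
move=> fm gn c cmn; apply: big1 => x _; apply: big1 => y _.
case: eqP => [cE|_]; last by rewrite mul0r.
move: cmn; rewrite -cE gdegM mul1r => xy.
case: (ltnP (gdeg x) m) => [/fm ->|mx]; first by rewrite mul0r.
by rewrite [g y]gn ?mulr0 // -(ltn_add2l m) (leq_ltn_trans _ xy) ?leq_add2r.
Qed.
End Order.

Record alphabet := Alphabet {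
  letter :> eqType;
  weight : letter -> nat;
  lowletters : nat -> seq letter;
  weight_gt0 : forall a, (0 < weight a)%N;
  mem_lowletters : forall n a, (a \in lowletters n) = (weight a <= n)%N
}.

Section Words.
Variable A : alphabet.

Definition wdeg (w : seq A) := sumn (map (@weight A) w).

Fixpoint lowwords_rec (fuel n : nat) : seq (seq A) :=
  if fuel is fuel'.+1 then
    [::] :: flatten [seq map (cons a) (lowwords_rec fuel' (n - weight a))
                    | a <- lowletters A n]
  else [:: [::]].

Definition lowwords n := undup (lowwords_rec n n).

Fact mem_lowwords n w : (w \in lowwords n) = (wdeg w <= n)%N.
Proof.
rewrite mem_undup.
suff H fuel m : (m <= fuel)%N -> (w \in lowwords_rec fuel m) = (wdeg w <= m)%N.
  exact: H.
elim: fuel m w => [|fuel IH] m [|a w] //= mf.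
  rewrite inE; move: mf; rewrite leqn0 => /eqP->; rewrite leqn0 addn_eq0.
  by have := weight_gt0 a; rewrite lt0n => /negPf ->.
rewrite inE /=; apply/flattenP/idP => [[s /mapP[b]]|].
  rewrite mem_lowletters => bm -> /mapP[v vin [-> ->]]; move: vin.
  rewrite IH; last by rewrite leq_subLR (leq_trans mf) // -add1n leq_add2r weight_gt0.
  by rewrite /wdeg /= -leq_subRL.
rewrite /wdeg /= => awm; have am := leq_trans (leq_addr _ _) awm.
exists (map (cons a) (lowwords_rec fuel (m - weight a))).
  by apply/mapP; exists a; rewrite ?mem_lowletters.
apply: map_f; rewrite IH ?leq_subRL //.
by rewrite leq_subLR (leq_trans mf) // -add1n leq_add2r weight_gt0.
Qed.

Definition wordm : gmonoid.
Proof.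
refine (@GMonoid (seq A) cat [::] wdeg lowwords (@catA A) (@cat0s A) (@cats0 A)
          _ _ mem_lowwords).
- by move=> v w; rewrite /wdeg map_cat sumn_cat.
- by move=> n; apply: undup_uniq.
Defined.
End Words.

Section Products.
Variables M N : gmonoid.
Let mul (p q : M * N) := (gmul p.1 q.1, gmul p.2 q.2).
Let deg (p : M * N) := (gdeg p.1 + gdeg p.2)%N.
Let low n := [seq p <- [seq (a, b) | a <- glow M n, b <- glow N n] | deg p <= n]%N.

Definition prodm : gmonoid.
Proof.
refine (@GMonoid (M * N)%type mul (gone, gone) deg low _ _ _ _ _ _).
- by move=> p q r; rewrite /mul /= !gmulA.
- by case=> a b; rewrite /mul /= !gmul1m.
- by case=> a b; rewrite /mul /= !gmulm1.
- by move=> p q; rewrite /deg !gdegM addnACA.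
- move=> n; apply/filter_uniq/allpairs_uniq => [||[a b] [c d]] //=;
  exact: glow_uniq.
- move=> n [a b]; rewrite mem_filter andb_idr // => abn.
  apply/allpairsP; exists (a, b); rewrite !mem_glow; split=> //=;
  by rewrite (leq_trans _ abn) ?leq_addl ?leq_addr.
Defined.

Variable k : comPzRingType.
Definition tens (f : hser k M) (g : hser k N) : hser k prodm :=
  fun p => f p.1 * g p.2.
End Products.

(* F (x) F', for continuous linear F and F' that do not lower degrees. *)
Definition tens_map (k : comPzRingType) (M M' N N' : gmonoid)
    (F : hser k M -> hser k N) (F' : hser k M' -> hser k N') :
    hser k (prodm M M') -> hser k (prodm N N') :=
  hext (fun p : prodm M M' => tens (F (hmono k p.1)) (F' (hmono k p.2))).

Definition natm : gmonoid.
Proof.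
refine (@GMonoid nat addn 0%N id (fun n => iota 0 n.+1) addnA add0n addn0 _ _ _).
- by [].
- by move=> n; apply: iota_uniq.
- by move=> n a; rewrite mem_iota /= ltnS.
Defined.

Section Series.
Variables (k : comPzRingType) (M : gmonoid).

(* The inverse of a series with constant term 1, as a geometric series; used
   when the identity is the only monomial of degree 0. *)
Definition hinv (f : hser k M) : hser k M := fun b =>
  \sum_(j < (gdeg b).+1) ((1 - f) ^+ j) b.

Definition heval (c : hser k natm) (v : hser k M) : hser k M :=
  hext (fun n : natm => v ^+ n) c.
End Series.

Section FreeSeries.
Variables (k : comPzRingType) (A : alphabet) (N : gmonoid).

Definition lmono (a : A) : hser k (wordm A) := hmono k ([:: a] : wordm A).

(* The continuous algebra morphism with a |-> L a for every letter a. *)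
Definition alg_ext (L : A -> hser k N) : hser k (wordm A) -> hser k N :=
  hext (fun w : wordm A => \prod_(a <- (w : seq A)) L a).

Fact alg_ext_filtered (L : A -> hser k N) :
    (forall a, order_ge (weight a) (L a)) ->
  filtered (fun w : wordm A => \prod_(a <- (w : seq A)) L a).
Proof.
move=> LF; elim=> [|a w IH] c //; rewrite big_cons.
by apply: order_geM => //; apply: IH.
Qed.

Lemma alg_extM (L : A -> hser k N) :
    (forall a, order_ge (weight a) (L a)) ->
  forall f g, alg_ext L (f * g) = alg_ext L f * alg_ext L g.
Proof.
move=> LF; apply: hextM => [|v w]; first exact: alg_ext_filtered.
by rewrite big_cat.
Qed.

Lemma alg_ext1 (L : A -> hser k N) :
  (forall a, order_ge (weight a) (L a)) -> alg_ext L 1 = 1.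
Proof.
by move=> LF; rewrite /alg_ext hext_mono ?big_nil //; apply: alg_ext_filtered.
Qed.

Lemma alg_ext_letter (L : A -> hser k N) a :
  (forall a, order_ge (weight a) (L a)) -> alg_ext L (lmono a) = L a.
Proof.
move=> LF; rewrite /alg_ext hext_mono; last exact: alg_ext_filtered.
by rewrite big_seq1.
Qed.
End FreeSeries.

Section Alphabets.
Variable gT : finGroupType.

(* None is x_0 and Some g is x_g. *)
Definition Xalph : alphabet.
Proof.
refine (@Alphabet (option gT) (fun _ => 1%N)
          (fun n => if n is 0 then [::] else enum {: option gT}) _ _) => //.
by case=> [|n] a //; rewrite mem_enum.
Defined.

(* (m, g) is z_{m+1,g}. *)
Definition Zalph : alphabet.
Proof.
refine (@Alphabet (nat * gT)%type (fun z => z.1.+1)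
          (fun n => [seq (m, g) | m <- iota 0 n, g <- enum gT]) _ _) => //.
move=> n [m g]; apply/allpairsP/idP => [[[m' g'] [/=]]|/= mn].
  by rewrite mem_iota => m'n _ [-> _].
by exists (m, g); rewrite mem_iota mem_enum.
Defined.

Definition Xm := wordm Xalph.
Definition Zm := wordm Zalph.

Definition xact (g : gT) (x : option gT) : option gT := omap (mulg g) x.

Lemma xact1 x : xact 1%g x = x.
Proof. by case: x => //= g; rewrite mul1g. Qed.
Lemma xactM g h x : xact (g * h)%g x = xact g (xact h x).
Proof. by case: x => //= l; rewrite mulgA. Qed.

Let mul (p q : seq (option gT) * gT) := (p.1 ++ map (xact p.2) q.1, (p.2 * q.2)%g).

Definition Vm : gmonoid.
Proof.
refine (@GMonoid (seq (option gT) * gT)%type mul ([::], 1%g)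
  (fun p => gdeg (p.1 : Xm)) (fun n => [seq (w, g) | w <- glow Xm n, g <- enum gT])
  _ _ _ _ _ _).
- move=> [u g] [v h] [w l]; rewrite /mul /= map_cat catA mulgA -map_comp.
  by congr (_ ++ _, _); apply: eq_map => x; rewrite xactM.
- case=> [w g]; rewrite /mul /= mul1g; congr (_, _); rewrite -[RHS]map_id.
  by apply: eq_map; apply: xact1.
- by case=> [w g]; rewrite /mul /= cats0 mulg1.
- case=> [w g] [v h]; rewrite [LHS](gdegM (w : Xm)); congr (_ + _)%N.
  by rewrite /= /wdeg -map_comp.
- move=> n; apply: allpairs_uniq => [||[? ?] [? ?]] //;
  [exact: (@glow_uniq Xm) | exact: enum_uniq].
- move=> n [w g]; apply/allpairsP/idP => [[[v h] [/=]]|wn].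
    by rewrite (@mem_glow Xm) => vn _ [-> _].
  by exists (w, g); rewrite (@mem_glow Xm) mem_enum.
Defined.
End Alphabets.

Section Vhat.
Variables (k : comPzRingType) (gT : finGroupType).
Implicit Types g h : gT.

(* The algebra V^ is presented by relations between words in the generators e_0,
   e_1 and G; it is the completed algebra of the monoid with this presentation.
   Vm is that monoid (Vcong_nf, Vnf_surj): (w, g) stands for the product of
   the letters of w and of g, where x_0 is e_0 and x_h is h e_1 h^-1. *)
Definition Vhat := hser k (Vm gT).

Definition vgrp g : Vhat := hmono k (([::], g) : Vm gT).
Definition ve0 : Vhat := hmono k (([:: None], 1%g) : Vm gT).
Definition ve1 : Vhat := hmono k (([:: Some 1%g], 1%g) : Vm gT).
End Vhat.
Arguments vgrp k {gT} g.
Arguments ve0 {k gT}.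
Arguments ve1 {k gT}.

Lemma Vm_mul1l (gT : finGroupType) (v w : seq (option gT)) g :
  gmul ((v, 1%g) : Vm gT) (w, g) = (v ++ w, g).
Proof.
rewrite /= mul1g; congr (_ ++ _, _); rewrite -[RHS]map_id.
by apply: eq_map; apply: xact1.
Qed.

Section VhatPresentation.
Variable gT : finGroupType.

Inductive Vgen := Ve0 | Ve1 | Vgrp of gT.

Inductive Vcong : seq Vgen -> seq Vgen -> Prop :=
| Vcong_refl u : Vcong u u
| Vcong_sym u v : Vcong u v -> Vcong v u
| Vcong_trans u v w : Vcong u v -> Vcong v w -> Vcong u w
| Vcong_cat u u' v v' : Vcong u u' -> Vcong v v' -> Vcong (u ++ v) (u' ++ v')
| Vcong_mul g h : Vcong [:: Vgrp g; Vgrp h] [:: Vgrp (g * h)%g]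
| Vcong_one : Vcong [:: Vgrp 1%g] [::]
| Vcong_comm g : Vcong [:: Vgrp g; Ve0] [:: Ve0; Vgrp g].

Definition Vgen_nf (x : Vgen) : Vm gT :=
  match x with
  | Ve0 => ([:: None], 1%g)
  | Ve1 => ([:: Some 1%g], 1%g)
  | Vgrp g => ([::], g)
  end.

Definition Vnf (u : seq Vgen) : Vm gT := foldr (fun x => gmul (Vgen_nf x)) gone u.

Lemma Vnf_cat u v : Vnf (u ++ v) = gmul (Vnf u) (Vnf v).
Proof.
elim: u => [|x u IH]; first by rewrite gmul1m.
by rewrite -[LHS]/(gmul (Vgen_nf x) (Vnf (u ++ v))) IH gmulA.
Qed.

Let unnf_letter (x : option gT) : seq Vgen :=
  if x is Some g then [:: Vgrp g; Ve1; Vgrp g^-1%g] else [:: Ve0].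
Let unnf (p : Vm gT) : seq Vgen := flatten (map unnf_letter p.1) ++ [:: Vgrp p.2].

Let Vcong_catl u v v' : Vcong v v' -> Vcong (u ++ v) (u ++ v').
Proof. by apply: Vcong_cat; apply: Vcong_refl. Qed.

Let Vcong_catr u u' v : Vcong u u' -> Vcong (u ++ v) (u' ++ v).
Proof. by move=> uu; apply: Vcong_cat => //; apply: Vcong_refl. Qed.

Let unnf_letterJ g x :
  Vcong (Vgrp g :: unnf_letter x) (unnf_letter (xact g x) ++ [:: Vgrp g]).
Proof.
case: x => [h|] /=; last exact: Vcong_comm.
apply: (@Vcong_trans _ ([:: Vgrp (g * h)] ++ [:: Ve1; Vgrp h^-1])%g).
  exact: (Vcong_catr [:: Ve1; Vgrp h^-1%g] (Vcong_mul g h)).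
have hE : (h^-1 = (g * h)^-1 * g)%g by rewrite invMg mulgKV.
rewrite hE; apply: (Vcong_catl [:: Vgrp (g * h); Ve1]%g (Vcong_sym _)).
exact: Vcong_mul.
Qed.

Let unnfJ g w : Vcong (Vgrp g :: flatten (map unnf_letter w))
  (flatten (map unnf_letter (map (xact g) w)) ++ [:: Vgrp g]).
Proof.
elim: w => [|x w IH] /=; first exact: Vcong_refl.
apply: Vcong_trans (Vcong_catr _ (unnf_letterJ g x)) _.
by rewrite -!catA; apply: (Vcong_catl (unnf_letter (xact g x)) IH).
Qed.

Let unnfM p q : Vcong (unnf p ++ unnf q) (unnf (gmul p q)).
Proof.
case: p q => [v g] [w h]; rewrite /unnf /= map_cat flatten_cat -!catA.
apply: Vcong_catl.
apply: Vcong_trans (Vcong_catr [:: Vgrp h] (unnfJ g w)) _.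
by rewrite -catA; apply: Vcong_catl (Vcong_mul g h).
Qed.

Let unnfK u : Vcong u (unnf (Vnf u)).
Proof.
elim: u => [|x u IH]; first by apply: Vcong_sym; apply: Vcong_one.
apply: Vcong_trans (Vcong_catl [:: x] IH) _.
apply: (@Vcong_trans _ (unnf (Vgen_nf x) ++ unnf (Vnf u))); last exact: unnfM.
apply: Vcong_catr; case: x => [||g]; rewrite /unnf /=.
- exact/Vcong_sym/(Vcong_catl [:: Ve0])/Vcong_one.
- have V1 : Vcong [:: Vgrp 1%g; Vgrp 1%g] [::].
    by apply: Vcong_trans (Vcong_mul _ _) _; rewrite mulg1; apply: Vcong_one.
  apply: Vcong_sym; rewrite invg1.
  apply: Vcong_trans (Vcong_catl [:: Vgrp 1%g; Ve1] V1) _.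
  exact: (Vcong_catr [:: Ve1] Vcong_one).
- exact: Vcong_refl.
Qed.

Lemma Vcong_nf u v : Vcong u v <-> Vnf u = Vnf v.
Proof.
split=> [|uv].
  elim=> {u v} // [u v w _ -> _ ->|u u' v v' _ uE _ vE|g h||g] //.
  - by rewrite !Vnf_cat uE vE.
  - by rewrite /Vnf /= !mulg1.
  - by rewrite /Vnf /= mulg1.
  - by rewrite /Vnf /= !mulg1 !mul1g.
by apply: Vcong_trans (unnfK u) _; rewrite uv; exact/Vcong_sym/unnfK.
Qed.

Lemma Vnf_surj p : exists u, Vnf u = p.
Proof.
exists (unnf p); case: p => w g; rewrite /unnf Vnf_cat.
have -> : Vnf (flatten (map unnf_letter w)) = (w, 1%g) :> Vm gT.
  elim: w => [|x w IH] //; rewrite /= Vnf_cat IH.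
  suff -> : Vnf (unnf_letter x) = ([:: x], 1%g) :> Vm gT by exact: Vm_mul1l.
  case: x => [h|] /=; last by rewrite /Vnf /= mulg1.
  by rewrite /Vnf /= !mul1g !mulg1 mulgV.
by apply: (congr2 pair); [exact: cats0 | exact: etrans (mul1g _) (mulg1 g)].
Qed.
End VhatPresentation.

Section VhatExt.
Variables (k : comPzRingType) (gT : finGroupType) (N : gmonoid).
Variables (E0 E1 : hser k N) (Gr : gT -> hser k N).

Definition vletter (x : option gT) : hser k N :=
  if x is Some h then Gr h * E1 * Gr h^-1%g else E0.

Definition vmonomial (p : Vm gT) : hser k N :=
  (\prod_(x <- p.1) vletter x) * Gr p.2.

(* The continuous algebra morphism e_0 |-> E0, e_1 |-> E1, g |-> Gr g. *)
Definition valg_ext : Vhat k gT -> hser k N := hext vmonomial.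

Hypotheses (E0_order : order_ge 1 E0) (E1_order : order_ge 1 E1).
Hypotheses (Gr1 : Gr 1%g = 1) (GrM : forall g h, Gr (g * h)%g = Gr g * Gr h).
Hypothesis GrE0 : forall g, Gr g * E0 = E0 * Gr g.

Fact vmonomial_filtered : filtered vmonomial.
Proof.
have LF x : order_ge 1 (vletter x).
  case: x => [h|] //=; rewrite -[1%N]/(0 + 1 + 0)%N.
  by do 2!apply: order_geM => //; apply: order_ge0.
case=> w g; rewrite -[gdeg _]addn0; apply: order_geM; last exact: order_ge0.
by elim: w => [|x w IH] c //; rewrite big_cons; apply: order_geM.
Qed.

Fact vmonomialM p q : vmonomial (gmul p q) = vmonomial p * vmonomial q.
Proof.
have letterJ g x : Gr g * vletter x = vletter (xact g x) * Gr g.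
  case: x => [h|] //=; rewrite GrM invMg GrM -!mulrA; congr (_ * (_ * (_ * _))).
  by rewrite -GrM mulVg Gr1 mulr1.
have wordJ g w : Gr g * (\prod_(x <- w) vletter x)
    = (\prod_(x <- map (xact g) w) vletter x) * Gr g.
  elim: w => [|x w IH]; first by rewrite !big_nil mul1r mulr1.
  by rewrite /= !big_cons mulrA letterJ -!mulrA IH.
case: p q => [v g] [w h]; rewrite /vmonomial /= big_cat /= GrM -!mulrA.
by congr (_ * _); rewrite mulrA -wordJ -mulrA.
Qed.

Lemma valg_extM f g : valg_ext (f * g) = valg_ext f * valg_ext g.
Proof. exact/hextM/vmonomialM/vmonomial_filtered. Qed.

Lemma valg_ext1 : valg_ext 1 = 1.
Proof.
rewrite /valg_ext hext_mono; last exact: vmonomial_filtered.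
by rewrite /vmonomial /= big_nil mul1r.
Qed.

Lemma valg_ext_e0 : valg_ext ve0 = E0.
Proof.
rewrite /valg_ext hext_mono; last exact: vmonomial_filtered.
by rewrite /vmonomial /= big_seq1 Gr1 mulr1.
Qed.

Lemma valg_ext_e1 : valg_ext ve1 = E1.
Proof.
rewrite /valg_ext hext_mono; last exact: vmonomial_filtered.
by rewrite /vmonomial /= big_seq1 /= invg1 Gr1 mul1r !mulr1.
Qed.

Lemma valg_ext_grp g : valg_ext (vgrp k g) = Gr g.
Proof.
rewrite /valg_ext hext_mono; last exact: vmonomial_filtered.
by rewrite /vmonomial /= big_nil mul1r.
Qed.
End VhatExt.

Section WM.
Variables (k : comPzRingType) (gT : finGroupType).
Implicit Types g h : gT.

Definition What := hser k (Zm gT).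

(* The inclusion of W^ = k + V^ e_1 in V^ (iotaW_image, w1M_id). *)
Definition iotaW : What -> Vhat k gT :=
  alg_ext (fun z : Zalph gT => - (ve0 ^+ z.1 * vgrp k z.2 * ve1)).

(* The classes of the products of the z_{n,g} form a topological basis of M^,
   so that M^ is k[[Zm]], with projM : V^ -> M^ the class map (projM_eq0,
   w1M_id). Every z_{n1,g1} ... z_{nr,gr} is, up to sign, the element
   (xword 1 u, g1 ... gr) of Vm. *)
Definition Mhat := hser k (Zm gT).

Fixpoint xword g (u : seq (nat * gT)) : seq (option gT) :=
  if u is (m, h) :: u' then
    nseq m None ++ Some (g * h)%g :: xword (g * h)%g u'
  else [::].

Definition projM (f : Vhat k gT) : Mhat := fun u =>
  (-1) ^+ size (u : seq (nat * gT)) * \sum_(g : gT) f (xword 1%g u, g).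

(* w |-> w . 1_M *)
Definition w1M (w : What) : Mhat := projM (iotaW w).

Definition zgrp (u : seq (nat * gT)) : gT := (\prod_(z <- u) z.2)%g.

Let xword_size g u : size (xword g u) = gdeg (u : Zm gT).
Proof.
elim: u g => [|[m h] u IH] g //=.
by rewrite size_cat size_nseq /= IH addnS.
Qed.

Let xact_xword h g u : map (xact h) (xword g u) = xword (h * g)%g u.
Proof.
elim: u g => [|[m l] u IH] g //=.
by rewrite map_cat map_nseq /= IH mulgA.
Qed.

Let nseq_None_inj m n x y (v w : seq (option gT)) :
  nseq m None ++ Some x :: v = nseq n None ++ Some y :: w ->
  [/\ m = n, x = y & v = w].
Proof.
elim: m n => [|m IH] [|n] //=; first by case.
by case=> /IH [-> -> ->].
Qed.

Let xword_inj g : injective (xword g).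
Proof.
move=> u; elim: u g => [|[m h] u IH] g [|[n l] v] //=.
- by case: n.
- by case: m.
by case/nseq_None_inj => -> /mulgI -> /IH ->.
Qed.

Let wdegX (w : seq (option gT)) : wdeg (A := Xalph gT) w = size w.
Proof. by rewrite /wdeg; elim: w => //= x w ->. Qed.

Let iotaW_order (z : Zalph gT) :
  order_ge (weight z) (- (ve0 ^+ z.1 * vgrp k z.2 * ve1)).
Proof.
have mono_order (b : Vm gT) : order_ge (gdeg b) (hmono k b).
  by move=> c; rewrite /hmono; case: eqP => // ->; rewrite ltnn.
have e0X n : order_ge n (ve0 ^+ n : Vhat k gT).
  elim: n => [|n IH]; first exact: order_ge0.
  by rewrite exprS -add1n; apply: order_geM => //; exact: (mono_order ([:: None], 1%g)).
have := order_geM (order_geM (e0X z.1) (@order_ge0 _ _ (vgrp k z.2)))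
  (mono_order ([:: Some 1%g], 1%g)).
rewrite addn0 addn1 => zO c cz.
by rewrite -[LHS]/(- ((ve0 ^+ z.1 * vgrp k z.2 * ve1) c)) zO ?oppr0.
Qed.

Let ve0X n : ve0 ^+ n = hmono k ((nseq n None, 1%g) : Vm gT).
Proof.
elim: n => [|n IH] //; rewrite exprS IH -hmonoM; congr hmono.
exact: Vm_mul1l.
Qed.

Let iotaW_word (u : seq (nat * gT)) :
  \prod_(z <- (u : seq (Zalph gT))) - (ve0 ^+ z.1 * vgrp k z.2 * ve1) =
  (-1) ^+ size u * hmono k ((xword 1%g u, zgrp u) : Vm gT).
Proof.
elim: u => [|[m h] u IH]; first by rewrite big_nil /zgrp big_nil mul1r.
rewrite big_cons IH /= ve0X /vgrp /ve1 -!hmonoM mulNr -[in LHS]mulN1r.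
rewrite exprS -!mulrA; congr (_ * _).
have commN (n : nat) (a : Vhat k gT) : (-1) ^+ n * a = a * (-1) ^+ n.
  by rewrite -signr_odd; case: odd; rewrite ?expr1 ?mulN1r ?mulrN1 ?mul1r ?mulr1.
rewrite mulrA -commN -mulrA; congr (_ * _); rewrite -hmonoM; congr hmono.
rewrite /= !mulg1 !mul1g /zgrp big_cons /=; congr (_, _).
by rewrite cats0 xact_xword !mulg1 -catA.
Qed.

Let iotaWE (w : What) p : iotaW w p =
  \sum_(u <- glow (Zm gT) (gdeg p))
     ((xword 1%g u, zgrp u) == p)%:R * ((-1) ^+ size (u : seq (nat * gT)) * w u).
Proof.
rewrite /iotaW /alg_ext /hext; apply: eq_bigr => u _; rewrite iotaW_word.
have -> : (-1) ^+ size (u : seq (nat * gT)) * hmono k ((xword 1%g u, zgrp u) : Vm gT)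
   = (fun p => (-1) ^+ size (u : seq (nat * gT)) * ((xword 1%g u, zgrp u) == p)%:R).
  apply/funext => q; rewrite -signr_odd -[in RHS]signr_odd.
  by case: odd; rewrite ?expr1 ?expr0 ?mulN1r ?mul1r.
by rewrite mulrCA mulrC -mulrA [_ * w u]mulrC mulrCA mulrC.
Qed.

Let wdeg_xword u : gdeg ((xword 1%g u, zgrp u) : Vm gT) = gdeg (u : Zm gT).
Proof. exact: etrans (wdegX _) (xword_size _ _). Qed.

Let iotaW_nf (w : What) u : iotaW w (xword 1%g u, zgrp u) =
  (-1) ^+ size (u : seq (nat * gT)) * w u.
Proof.
rewrite iotaWE wdeg_xword.
have E v : ((xword 1%g v, zgrp v) == (xword 1%g u, zgrp u) :> Vm gT) = (u == v).
  by apply/eqP/eqP => [[/xword_inj ->] //|-> //].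
under eq_bigr => v _ do rewrite E.
apply: (big_glow_pick (F := fun v : Zm gT =>
  (-1) ^+ size (v : seq (nat * gT)) * w v)).
by rewrite ltnn.
Qed.

Let iotaW_out (w : What) p : (forall u, p != (xword 1%g u, zgrp u)) ->
  iotaW w p = 0.
Proof.
move=> pP; rewrite iotaWE; apply: big1 => u _.
by rewrite eq_sym (negPf (pP u)) mul0r.
Qed.

Lemma w1M_id w : w1M w = w.
Proof.
apply/funext => u; rewrite /w1M /projM (bigD1 (zgrp u)) //= iotaW_nf.
rewrite big1 ?addr0 => [|g gu].
  by rewrite mulrA -expr2 -exprM mulnC exprM sqrrN expr1n expr1n mul1r.
apply: iotaW_out => v; apply: contra_neq gu => -[/xword_inj <- ->] //.
Qed.

Let xword_last g u x : (0 < size u)%N -> last x (xword g u) = Some (g * zgrp u)%g.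
Proof.
elim: u g x => [|[m h] u IH] g x //= _; rewrite last_cat /= /zgrp big_cons /=.
case: u IH => [|z u] IH; first by rewrite big_nil mulg1.
by rewrite IH // mulgA.
Qed.

Let xword_ex g w : last (Some 1%g) w != None -> exists u, xword g u = w.
Proof.
have [n] := ubnP (size w); elim: n w g => // n IH [|x w] g /=.
  by exists [::].
rewrite ltnS => wn wl.
have [m [h [v [vm xw vl]]]] : exists m h v, [/\ (size v <= size w)%N,
    x :: w = nseq m None ++ Some h :: v & last (Some h) v != None].
  elim: w x wl {wn} => [|y w IHw] [h|] //= wl.
  - by exists 0%N, h, [::].
  - by exists 0%N, h, (y :: w).
  have [m [h [v [vw -> vl]]]] := IHw y wl.
  by exists m.+1, h, v; split=> //; apply: leqW.
have [||u uE] := IH v h; first exact: leq_ltn_trans vm wn.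
  by case: v vl {vm xw}.
by exists ((m, (g^-1 * h)%g) :: u); rewrite /= mulKVg uE.
Qed.

Let scaleE (c : k) p : (hscale c 1 : Vhat k gT) p = c * (gone == p)%:R.
Proof. by []. Qed.

Let a1 : Vm gT := ([:: Some 1%g], 1%g).
Let a0 : Vm gT := ([:: None], 1%g).

Let mul_a1 w g : gmul ((w, g) : Vm gT) a1 = (rcons w (Some g), g).
Proof. by rewrite /= mulg1 cats1. Qed.
Let mul_a0 w g : gmul ((w, g) : Vm gT) a0 = (rcons w None, g).
Proof. by rewrite /= mulg1 cats1. Qed.
Let mul_grp w g h : gmul ((w, g) : Vm gT) ([::], h) = (w, (g * h)%g).
Proof. by rewrite /= cats0. Qed.

Let ve1_rcons (v : Vhat k gT) w g : (v * ve1) (rcons w (Some g), g) = v (w, g).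
Proof.
rewrite -mul_a1 hmul_monor_at // => -[x l] [y m].
by rewrite !mul_a1 => -[/rcons_inj[-> _] ->].
Qed.

Let ve1_out (v : Vhat k gT) p :
  (forall w g, p <> (rcons w (Some g), g)) -> (v * ve1) p = 0.
Proof.
by move=> pP; apply: hmul_monor_out => -[w g]; rewrite mul_a1; apply/nesym/pP.
Qed.

Let ve0_rcons (v : Vhat k gT) w g : (v * ve0) (rcons w None, g) = v (w, g).
Proof.
rewrite -mul_a0 hmul_monor_at // => -[x l] [y m].
by rewrite !mul_a0 => -[/rcons_inj[-> ] ->].
Qed.

Let ve0_out (v : Vhat k gT) w g : last (Some 1%g) w != None -> (v * ve0) (w, g) = 0.
Proof.
move=> wl; apply: hmul_monor_out => -[x l]; rewrite mul_a0 => -[xw _].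
by rewrite -xw last_rcons in wl.
Qed.

Let vgrpE (v : Vhat k gT) w g h : (v * vgrp k h) (w, g) = v (w, g * h^-1)%g.
Proof.
rewrite -{1}[g](mulgKV h) -(mul_grp w (g * h^-1)%g) /vgrp hmul_monor_at // => -[x l] [y m].
by rewrite !mul_grp => -[-> /mulIg ->].
Qed.

(* W^ = k + V^ e_1 as a subset of V^. *)
Lemma iotaW_image (f : Vhat k gT) :
  (exists w, f = iotaW w) <->
  (exists (c : k) (v : Vhat k gT), f = hscale c 1 + v * ve1).
Proof.
have goneE p : (gone == p :> Vm gT) -> p = (xword 1%g [::], zgrp [::]).
  by move=> /eqP <-; rewrite /zgrp big_nil.
have gone_out v : (v * ve1 : Vhat k gT) (gone : Vm gT) = 0.
  by apply: ve1_out => w g [/(congr1 size)]; rewrite size_rcons.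
have xlast u w g : (xword 1%g u, zgrp u) = (w, g) -> u != [::] ->
    exists w', w = rcons w' (Some g).
  move=> [uw ug] u0; have := @xword_last 1%g u None.
  rewrite lt0n size_eq0 u0 uw ug mul1g => /(_ isT).
  case/lastP: w uw => // w' x _; rewrite last_rcons => ->; by exists w'.
split=> [[w ->]|[c [v ->]]].
  exists (w [::]), (fun q : Vm gT => iotaW w (rcons q.1 (Some q.2), q.2)).
  apply/funext => p; rewrite hserDE scaleE.
  have [pE|pN] := eqVneq (gone : Vm gT) p.
    rewrite -pE gone_out mulr1 addr0.
    by rewrite (goneE gone) ?eqxx // iotaW_nf mul1r.
  rewrite mulr0 add0r; case: p pN => w' g pN.
  have [[v vg]|nv] := pselect (exists v, w' = rcons v (Some g)).
    by rewrite vg ve1_rcons.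
  rewrite ve1_out => [|v h [vE hE]]; last by apply: nv; exists v; rewrite hE.
  apply: iotaW_out => u; apply/eqP => pE; apply: nv.
  apply: (xlast u); first by rewrite pE.
  by apply: contra_neqN pN => /eqP u0; rewrite pE u0 /zgrp big_nil.
exists (fun u : Zm gT => (-1) ^+ size (u : seq (nat * gT)) *
  (hscale c 1 + v * ve1 : Vhat k gT) (xword 1%g u, zgrp u)).
set F := _ + _; apply/funext => p.
have [[u ->]|pN] := pselect (exists u, p = (xword 1%g u, zgrp u)).
  by rewrite iotaW_nf mulrA -expr2 -exprM mulnC exprM sqrrN !expr1n mul1r.
rewrite iotaW_out => [|u]; last by apply/eqP => pE; apply: pN; exists u.
rewrite /F hserDE scaleE; case: eqP => [/eqP/goneE pE|_].
  by case: pN; exists [::].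
rewrite mulr0 add0r; apply: ve1_out => w g pE; apply: pN.
have [|u uE] := @xword_ex 1%g (rcons w (Some g)); first by rewrite last_rcons.
have u0 : (0 < size u)%N.
  by case: u uE => //= /(congr1 size); rewrite size_rcons.
have := @xword_last 1%g u None u0; rewrite uE last_rcons mul1g => -[gE].
by exists u; rewrite pE uE gE.
Qed.

(* M^ = V^ / (V^ e_0 + sum_(g <> 1) V^ (g - 1)). *)
Lemma projM_eq0 (f : Vhat k gT) :
  projM f = 0 <->
  exists (a : Vhat k gT) (b : gT -> Vhat k gT),
    f = a * ve0 + \sum_(g | g != 1%g) b g * (vgrp k g - 1).
Proof.
have sumE (b : gT -> Vhat k gT) w g :
    (\sum_(h | h != 1%g) b h * (vgrp k h - 1) : Vhat k gT) (w, g) =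
    \sum_(h | h != 1%g) (b h (w, g * h^-1)%g - b h (w, g)).
  elim/big_rec2: _ => [//|h x y _ <-]; rewrite hserDE mulrBr mulr1 hserDE.
  by rewrite vgrpE.
have xlast u : last (Some 1%g) (xword 1%g u) != None.
  by case: u => // z u; rewrite xword_last.
split=> [f0|[a [b ->]]].
  pose ok w : bool := last (Some (1%g : gT)) w != None.
  exists (fun p : Vm gT => f (rcons p.1 None, p.2)).
  exists (fun g (p : Vm gT) => if (p.2 == 1%g) && ok p.1 then f (p.1, g) else 0).
  apply/funext => -[w g]; rewrite hserDE sumE /=.
  have [wok|] := boolP (ok w); last first.
    rewrite negbK => wl; rewrite big1 ?addr0 => [|h _]; last first.
      by rewrite !andbF subr0.
    by case/lastP: w wl => // w x; rewrite last_rcons => /eqP ->; rewrite ve0_rcons.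
  rewrite ve0_out // add0r.
  have [->|g1] := eqVneq g 1%g.
    have [u uw] := xword_ex 1%g wok.
    have /eqP : projM f u = 0 by rewrite f0.
    rewrite /projM uw -signr_odd; case: odd; rewrite ?expr1 ?mulN1r ?mul1r ?oppr_eq0 => /eqP;
    rewrite (bigD1 1%g) //= => /eqP; rewrite addr_eq0 => /eqP ->;
    rewrite -sumrN; apply: eq_bigr => h h1;
    by rewrite mul1g invg_eq1 (negPf h1) sub0r.
  rewrite (bigD1 g) //= mulgV eqxx big1 ?addr0 ?subr0 // => h /andP[_ hg].
  by rewrite -eq_mulgV1 [g == h]eq_sym (negPf hg) subr0.
apply/funext => u; rewrite -[RHS]/(0 : k) /projM.
under eq_bigr => g _ do rewrite hserDE ve0_out // add0r sumE.
rewrite exchange_big /= big1 ?mulr0 // => h _; rewrite sumrB.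
rewrite (reindex_inj (mulIg h)) /=.
by under eq_bigr => g _ do rewrite mulgK; rewrite subrr.
Qed.
End WM.

(* Commutative Q-algebras. The zero ring is allowed, which comAlgType excludes;
   Q-algebra morphisms are just ring morphisms (qstr_morph). *)
Record comQAlg := ComQAlg {
  qring :> comPzRingType;
  qstr : {rmorphism rat -> qring}
}.
Arguments qstr {_}.

Lemma qstr_morph (A B : comQAlg) (f : {rmorphism A -> B}) q : f (qstr q) = qstr q.
Proof.
have [d d0 dq] : exists2 d : int, d != 0 & exists n : int, d%:~R * q = n%:~R.
  exists (denq q); rewrite ?denq_neq0 //; exists (numq q).
  by rewrite -{2}(divq_num_den q) mulrC divfK // intr_eq0 denq_neq0.
case: dq => n dq; have dU : d%:~R^-1 * d%:~R = 1 :> rat.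
  by rewrite mulVf // intr_eq0.
have E (C : comQAlg) (g : {rmorphism rat -> C}) :
    g q = (qstr d%:~R^-1) * n%:~R.
  rewrite -(rmorph_int g n) -dq rmorphM rmorph_int -(rmorph_int (@qstr C) d).
  by rewrite mulrA -rmorphM dU rmorph1 mul1r.
exact: etrans (E B (f \o qstr : {rmorphism rat -> B})%FUN) (esym (E B qstr)).
Qed.

Definition ratQ : comQAlg := ComQAlg (idfun : {rmorphism rat -> rat}).

(* Q[eps]/(eps^2) *)
Definition dualQ : comQAlg :=
  @ComQAlg {poly %/ ('X^2 : {poly rat})} (qpolyC ('X^2 : {poly rat})).
Definition eps : dualQ := qpolyX ('X^2 : {poly rat}).

(* The augmentation eps |-> 0. *)
Definition dual_aug (p : dualQ) : ratQ :=
  ((p : {poly %/ ('X^2 : {poly rat})}) : {poly rat}).[0].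

Fact dual_aug_zmod : zmod_morphism dual_aug.
Proof. by move=> p q; rewrite /dual_aug hornerD hornerN. Qed.

Fact dual_aug_monoid : monoid_morphism dual_aug.
Proof.
split=> [|p q]; first by rewrite /dual_aug hornerC.
rewrite /dual_aug -hornerM.
have X0 : (mk_monic ('X^2 : {poly rat})).[0] = 0 by rewrite mk_monic_Xn hornerXn.
have E := Pdiv.RingMonic.rdivp_eq (monic_mk_monic ('X^2 : {poly rat}))
  ((p : {poly rat}) * q).
by rewrite poly_of_qpolyM [in RHS]E hornerD hornerM X0 mulr0 add0r.
Qed.

HB.instance Definition _ := GRing.isZmodMorphism.Build dualQ ratQ dual_aug
  dual_aug_zmod.
HB.instance Definition _ := GRing.isMonoidMorphism.Build dualQ ratQ dual_aug
  dual_aug_monoid.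

(* Elements of H (x) H and H (x) H (x) H are represented by finite sums of pure
   tensors, two of which are equal if no bilinear (trilinear) map into a
   Q-vector space separates them. *)
Section TensorEq.
Variable H : comQAlg.

Definition qlinear (V : lmodType rat) (f : H -> V) :=
  forall (q : rat) x y, f (qstr q * x + y) = q *: f x + f y.

Definition tens2_eq (s t : seq (H * H)) := forall (V : lmodType rat) (B : H -> H -> V),
  (forall y, qlinear (B^~ y)) -> (forall x, qlinear (B x)) ->
  \sum_(p <- s) B p.1 p.2 = \sum_(p <- t) B p.1 p.2.

Definition tens3_eq (s t : seq (H * H * H)) :=
  forall (V : lmodType rat) (T : H -> H -> H -> V),
  (forall y z, qlinear (fun x => T x y z)) ->
  (forall x z, qlinear (fun y => T x y z)) -> (forall x y, qlinear (T x y)) ->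
  \sum_(p <- s) T p.1.1 p.1.2 p.2 = \sum_(p <- t) T p.1.1 p.1.2 p.2.
End TensorEq.

Record hopfQ := HopfQ {
  hopf_alg :> comQAlg;
  comul : hopf_alg -> seq (hopf_alg * hopf_alg);
  counit : {rmorphism hopf_alg -> ratQ};
  antipode : hopf_alg -> hopf_alg;
  comul_linear : forall (q : rat) x y, tens2_eq (comul (qstr q * x + y))
    ([seq (qstr q * p.1, p.2) | p <- comul x] ++ comul y);
  comul_one : tens2_eq (comul 1) [:: (1, 1)];
  comul_mul : forall x y, tens2_eq (comul (x * y))
    [seq (p.1 * r.1, p.2 * r.2) | p <- comul x, r <- comul y];
  comul_assoc : forall x, tens3_eq
    [seq (r.1, r.2, p.2) | p <- comul x, r <- comul p.1]
    [seq (p.1, r.1, r.2) | p <- comul x, r <- comul p.2];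
  counitl : forall x, \sum_(p <- comul x) qstr (counit p.1) * p.2 = x;
  counitr : forall x, \sum_(p <- comul x) p.1 * qstr (counit p.2) = x;
  antipode_linear : forall (q : rat) x y,
    antipode (qstr q * x + y) = qstr q * antipode x + antipode y;
  antipodel : forall x,
    \sum_(p <- comul x) antipode p.1 * p.2 = qstr (counit x);
  antipoder : forall x,
    \sum_(p <- comul x) p.1 * antipode p.2 = qstr (counit x)
}.

(* The product of phi and psi in the group Hom(H, A). *)
Definition convol (H : hopfQ) (A : comQAlg) (phi psi : H -> A) : H -> A :=
  fun x => \sum_(p <- comul x) phi p.1 * psi p.2.

Local Open Scope classical_set_scope.

Definition is_group (T : Type) (S : set T) (mul : T -> T -> T) (e : T) :=
  [/\ S e,
      forall x y, S x -> S y -> S (mul x y),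
      forall x y z, S x -> S y -> S z -> mul x (mul y z) = mul (mul x y) z,
      forall x, S x -> mul e x = x /\ mul x e = x &
      forall x, S x -> exists y, [/\ S y, mul x y = e & mul y x = e]].

Section GroupScheme.
Variables (U : comQAlg -> Type).
Variable Umap : forall A B : comQAlg, {rmorphism A -> B} -> U A -> U B.
Variables (S : forall A, set (U A)) (mul : forall A, U A -> U A -> U A).
Variable one : forall A, U A.

Definition is_group_functor :=
  [/\ forall A, is_group (@S A) (@mul A) (one A),
      forall (A B : comQAlg) (f : {rmorphism A -> B}) x, S x -> S (Umap f x),
      forall (A B : comQAlg) (f : {rmorphism A -> B}) x y, S x -> S y ->
        Umap f (mul x y) = mul (Umap f x) (Umap f y),
      forall (A : comQAlg) x, S x -> Umap (idfun : {rmorphism A -> A}) x = x &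
      forall (A B C : comQAlg) (g : {rmorphism B -> C}) (f : {rmorphism A -> B}) x,
        S x -> Umap (g \o f : {rmorphism A -> C})%FUN x = Umap g (Umap f x)].

(* theta is a natural isomorphism of groups Hom(H, A) -> S A. *)
Definition represents (H : hopfQ)
    (theta : forall A : comQAlg, {rmorphism H -> A} -> U A) :=
  [/\ forall (A : comQAlg) (phi : {rmorphism H -> A}), S (theta A phi),
      forall (A : comQAlg) (phi psi : {rmorphism H -> A}),
        theta A phi = theta A psi -> phi =1 psi,
      forall (A : comQAlg) x, S x -> exists phi, theta A phi = x,
      forall (A B : comQAlg) (f : {rmorphism A -> B}) (phi : {rmorphism H -> A}),
        theta B (f \o phi : {rmorphism H -> B})%FUN = Umap f (theta A phi) &
      forall (A : comQAlg) (phi psi : {rmorphism H -> A}),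
        exists2 chi : {rmorphism H -> A}, chi =1 convol phi psi &
          theta A chi = mul (theta A phi) (theta A psi)].

Definition is_affine_group_scheme : Prop :=
  is_group_functor /\ exists H theta, represents (H := H) theta.
End GroupScheme.

Definition hmap (A B : comPzRingType) (M : gmonoid) (f : A -> B) (a : hser A M) :
  hser B M := fun b => f (a b).

Section Stabilizers.
Variable gT : finGroupType.

Section OverRing.
Variable k : comPzRingType.

Definition Xser := hser k (Xm gT).
Definition xlet (x : option gT) : Xser := lmono k (x : Xalph gT).

Definition hatDelta : Xser -> hser k (prodm (Xm gT) (Xm gT)) :=
  alg_ext (fun x : Xalph gT => tens (xlet x) 1 + tens 1 (xlet x)).

Definition grouplike (Psi : Xser) :=
  (exists Phi : Xser, Psi * Phi = 1 /\ Phi * Psi = 1) /\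
  hatDelta Psi = tens Psi Psi.

Definition Lib (psi : Xser) := hatDelta psi = tens psi 1 + tens 1 psi.

Definition taut (g : gT) : Xser -> Xser :=
  alg_ext (fun x : Xalph gT => xlet (xact g x)).

Definition autX (Psi : Xser) : Xser -> Xser :=
  alg_ext (fun x : Xalph gT =>
    if x is Some g then taut g (hinv Psi) * xlet (Some g) * taut g Psi
    else xlet None).

Definition circ (Psi Phi : Xser) : Xser := Psi * autX Psi Phi.

(* The continuous derivation of k<<X>> with x |-> D x. *)
Fixpoint derX_word (D : option gT -> Xser) (w : seq (option gT)) : Xser :=
  if w is x :: w' then
    D x * hmono k (w' : Xm gT) + xlet x * derX_word D w'
  else 0.
Definition derX_ext (D : option gT -> Xser) : Xser -> Xser :=
  hext (fun w : Xm gT => derX_word D w).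

Definition derX (psi : Xser) : Xser -> Xser :=
  derX_ext (fun x =>
    if x is Some g then xlet (Some g) * taut g psi - taut g psi * xlet (Some g)
    else 0).

Definition sX (psi : Xser) (a : Xser) : Xser := psi * a + derX psi a.
Definition ihara (psi1 psi2 : Xser) : Xser := sX psi1 psi2 - sX psi2 psi1.

Local Notation V := (Vhat k gT).
Local Notation W := (What k gT).
Local Notation Mh := (Mhat k gT).

(* a |-> beta (a (x) 1) *)
Definition beta1 : Xser -> V :=
  alg_ext (fun x : Xalph gT =>
    if x is Some g then - (vgrp k g * ve1 * vgrp k g^-1%g) else ve0).

Definition zlet (z : nat * gT) : W := lmono k (z : Zalph gT).

(* As (m, g) is z_{m+1,g}, the last sum runs over the pairs (z_k, z_{n-k}) with
   n = z.1 + 1 and k = i + 1. *)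
Definition DeltaW : W -> hser k (prodm (Zm gT) (Zm gT)) :=
  alg_ext (fun z : Zalph gT => tens (zlet z) 1 + tens 1 (zlet z) +
    \sum_(i < z.1) \sum_(h : gT)
      tens (zlet (i : nat, h)) (zlet ((z.1 - i.+1)%N, (z.2 * h^-1)%g))).

(* w |-> w . 1_M is the identity of the underlying series (w1M_id), so that
   Delta^M is Delta^W; DeltaM_w1M is the defining property. *)
Definition DeltaM : Mh -> hser k (prodm (Zm gT) (Zm gT)) := DeltaW.

Lemma DeltaM_w1M (w : W) :
  DeltaM (w1M w) = tens_map (@w1M k gT) (@w1M k gT) (DeltaW w).
Proof.
rewrite w1M_id; apply/funext => p; rewrite /tens_map /hext.
have E q : DeltaW w q * tens (w1M (hmono k q.1)) (w1M (hmono k q.2)) p =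
    (p == q)%:R * DeltaW w q.
  rewrite !w1M_id mulrC; congr (_ * _); case: p q => [u v] [a b].
  by rewrite /tens /hmono /= -natrM mulnb -xpair_eqE eq_sym.
under eq_bigr => q _ do rewrite E.
by rewrite (big_glow_pick (F := DeltaW w)) // ltnn.
Qed.

(* Left multiplication by v on M^; iotaW is a section of V^ -> M^ (w1M_id), and
   the kernel of V^ -> M^ is a left ideal (projM_eq0). *)
Definition lmulM (v : V) (m : Mh) : Mh := projM (v * iotaW m).

Definition autV (Psi : Xser) : V -> V :=
  valg_ext ve0 (beta1 (hinv Psi) * ve1 * beta1 Psi) (vgrp k).

Definition autM (Psi : Xser) (m : Mh) : Mh :=
  projM (beta1 Psi * autV Psi (iotaW m)).

(* The continuous derivation of V^ with e_0 |-> 0, e_1 |-> D1, g |-> 0. *)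
Fixpoint derV_word (D1 : V) (w : seq (option gT)) : V :=
  if w is x :: w' then
    (if x is Some h then vgrp k h * D1 * vgrp k h^-1%g else 0)
      * hmono k ((w', 1%g) : Vm gT)
    + hmono k (([:: x], 1%g) : Vm gT) * derV_word D1 w'
  else 0.
Definition derV_ext (D1 : V) : V -> V :=
  hext (fun p : Vm gT => derV_word D1 p.1 * vgrp k p.2).

Definition derV (psi : Xser) : V -> V :=
  derV_ext (ve1 * beta1 psi - beta1 psi * ve1).

Definition endM (psi : Xser) (m : Mh) : Mh :=
  projM (beta1 psi * iotaW m + derV psi (iotaW m)).

(* x_0^(n-1) x_1 *)
Definition x0x1 (n : nat) : Xm gT := rcons (nseq n.-1 None) (Some 1%g).
End OverRing.

Section OverQ.
Variable k : comQAlg.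

Definition hexp (s : hser k natm) : hser k natm := fun n =>
  \sum_(j < n.+1) qstr (j`!%:R^-1) * (s ^+ j) n.

Definition Gamma (Psi : Xser k) : hser k natm :=
  hexp (fun n => if (2 <= n)%N
    then qstr ((-1) ^+ n.-1 / n%:R) * Psi (x0x1 n) else 0).

Definition gamma (psi : Xser k) : hser k natm := fun n =>
  if (1 <= n)%N then qstr ((-1) ^+ n.+1 / n%:R) * psi (x0x1 n) else 0.

Definition GautM (Psi : Xser k) (m : Mhat k gT) : Mhat k gT :=
  lmulM (heval (hinv (Gamma Psi)) (- ve1)) (autM Psi m).

Definition Stab : set (Xser k) := [set Psi | grouplike Psi /\
  forall m, tens_map (GautM Psi) (GautM Psi) (DeltaM m) = DeltaM (GautM Psi m)].

Definition gendM (psi : Xser k) (m : Mhat k gT) : Mhat k gT :=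
  lmulM (- heval (gamma psi) (- ve1)) m + endM psi m.
End OverQ.

Definition stab : set (Xser ratQ) := [set psi | Lib psi /\
  forall m : Mhat ratQ gT,
    tens_map (gendM psi) id (DeltaM m) + tens_map id (gendM psi) (DeltaM m)
      = DeltaM (gendM psi m)].

Definition one_eps (psi : Xser ratQ) : Xser dualQ :=
  1 + hscale eps (hmap qstr psi).

(* ker (S(Q[eps]) -> S(Q)) *)
Definition Lie_ker (S : forall k : comQAlg, set (Xser k)) : set (Xser dualQ) :=
  [set Psi | S dualQ Psi /\ hmap dual_aug Psi = 1].

(* Lie subalgebras of (Lib, <-,->). *)
Definition is_Lie_subalgebra (L : set (Xser ratQ)) :=
  [/\ L `<=` @Lib ratQ, L 0,
      forall (q : rat) psi1 psi2, L psi1 -> L psi2 ->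
        L (hscale (qstr q) psi1 + psi2) &
      forall psi1 psi2, L psi1 -> L psi2 -> L (ihara psi1 psi2)].
End Stabilizers.
Arguments Stab gT k Psi : clear implicits.
Arguments stab gT psi : clear implicits.
Arguments circ gT k Psi Phi : clear implicits.

(* Main.v *)
From HB Require Import structures.
Require Import Defs.
From mathcomp Require Import all_boot all_algebra all_fingroup qpoly.
From mathcomp Require Import boolp classical_sets.
Set Implicit Arguments. Unset Strict Implicit. Unset Printing Implicit Defensive.
Import GRing.Theory.
Local Open Scope ring_scope.

(* The composition rule GautM (circ Psi Phi) = GautM Psi o GautM Phi makes Stab
   a group functor. Both sides of its defining equation are continuous and linear in m
   and natural in the base ring, so Stab is cut out by equations between coefficients;
   it is therefore represented by the polynomial expressions in the coefficients taken
   up to equality at all points, and Yoneda's lemma supplies the Hopf structure.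
   Expanding to first order, 1 + eps psi lies in Stab(Q[eps]) iff psi lies in stab:
   gamma_psi differs from the logarithmic derivative of Gamma by a multiple of x, and
   left multiplication by e_1 is a coderivation. The Lie subalgebra properties of stab
   then follow from the group law of Stab over Q[eps] and Q[e_1,e_2]/(e_1^2,e_2^2). *)

(** * Continuous linear maps between series *)

(** Two facts carry the composition rule. In V^ the automorphism t_g is conjugation by g, so
    aut^V_Psi extends aut_Psi along beta; as it sends e_1 to a conjugate by beta(Psi), it conjugates
    Gamma_Phi^(-1)(-e_1) as well, and the prefactor beta(Psi) of the outer map cancels one side of
    this conjugation. It remains that Gamma is multiplicative for the twisted product, which comes
    from the additivity of Psi |-> (Psi|x_0^(n-1) x_1). Descent along base rings rests on one
    principle: if the morphisms f_i out of A are jointly injective, a series over A whose images all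
    lie in Stab lies in Stab. On the coordinate ring the evaluations at points are jointly injective
    by construction, so the universal series is a point of Stab although no generators of an ideal
    are written down. The same principle, applied to the single injective morphism eps |-> e_1 e_2,
    brings the bracket back from Q[e_1,e_2]/(e_1^2,e_2^2) to Q[eps] and spares a direct computation
    with brackets on M^. *)

Section HserAlgebra.
Variables (k : comPzRingType) (M : gmonoid).
Implicit Types (a : k) (f g : hser k M).

Lemma hserZE a f b : hscale a f b = a * f b. Proof. by []. Qed.
Lemma hserNE f b : (- f) b = - f b. Proof. by []. Qed.
Lemma hserBE f g b : (f - g) b = f b - g b. Proof. by []. Qed.
Lemma hserME f g b : (f * g) b = hmul f g b. Proof. by []. Qed.
Lemma hser1E b : (1 : hser k M) b = (gone == b)%:R. Proof. by []. Qed.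
Lemma hser_sumE I (r : seq I) (P : pred I) (F : I -> hser k M) b :
  (\sum_(i <- r | P i) F i) b = \sum_(i <- r | P i) F i b.
Proof. by elim/big_rec2: _ => // i x y _ <-. Qed.

Fact hscaleA a b f : hscale a (hscale b f) = hscale (a * b) f.
Proof. by apply/funext => x; rewrite !hserZE mulrA. Qed.
Fact hscale1 : left_id 1 (@hscale k M).
Proof. by move=> f; apply/funext => x; rewrite hserZE mul1r. Qed.
Fact hscaleDr : right_distributive (@hscale k M) +%R.
Proof. by move=> a f g; apply/funext => x; rewrite !(hserZE, hserDE) mulrDr. Qed.
Fact hscaleDl f : {morph (@hscale k M)^~ f : a b / a + b}.
Proof. by move=> a b; apply/funext => x; rewrite !(hserZE, hserDE) mulrDl. Qed.

HB.instance Definition _ := GRing.Zmodule_isLmodule.Build k (hser k M)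
  hscaleA hscale1 hscaleDr hscaleDl.

Lemma hscaleAl a f g : a *: (f * g) = a *: f * g.
Proof.
apply/funext => b; rewrite -[LHS]/(a * hmul f g b) -[RHS]/(hmul (hscale a f) g b).
rewrite /hmul mulr_sumr; apply: eq_bigr => x _; rewrite mulr_sumr.
by apply: eq_bigr => y _; rewrite mulrCA hserZE -mulrA.
Qed.

Lemma hscaleAr a f g : a *: (f * g) = f * (a *: g).
Proof.
apply/funext => b; rewrite -[LHS]/(a * hmul f g b) -[RHS]/(hmul f (hscale a g) b).
rewrite /hmul mulr_sumr; apply: eq_bigr => x _; rewrite mulr_sumr.
by apply: eq_bigr => y _; rewrite mulrCA hserZE [f x * (a * _)]mulrCA.
Qed.

Lemma hserE a f b : (a *: f) b = a * f b. Proof. by []. Qed.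

Lemma order_geD n f g : order_ge n f -> order_ge n g -> order_ge n (f + g).
Proof. by move=> fn gn c cn; rewrite hserDE fn ?gn ?addr0. Qed.
Lemma order_geN n f : order_ge n f -> order_ge n (- f).
Proof. by move=> fn c cn; rewrite hserNE fn ?oppr0. Qed.
Lemma order_geB n f g : order_ge n f -> order_ge n g -> order_ge n (f - g).
Proof. by move=> fn gn; apply/order_geD/order_geN. Qed.
Lemma order_geZ n a f : order_ge n f -> order_ge n (a *: f).
Proof. by move=> fn c cn; rewrite hserE fn ?mulr0. Qed.
Lemma order_ge_sum n I (r : seq I) (P : pred I) (F : I -> hser k M) :
  (forall i, P i -> order_ge n (F i)) -> order_ge n (\sum_(i <- r | P i) F i).
Proof. by move=> Fn c cn; rewrite hser_sumE big1 // => i /Fn ->. Qed.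
Lemma order_ge_leq m n f : (m <= n)%N -> order_ge n f -> order_ge m f.
Proof. by move=> mn fn c cm; apply: fn; apply: leq_trans mn. Qed.
Lemma order_geMl n f g : order_ge n g -> order_ge n (f * g).
Proof. by move=> gn; apply: (order_geM (@order_ge0 _ M f) gn). Qed.
Lemma order_geMr n f g : order_ge n f -> order_ge n (f * g).
Proof. by move=> fn; rewrite -[n]addn0; apply: (order_geM fn (@order_ge0 _ M g)). Qed.
Lemma order_geX n f : order_ge 1 f -> order_ge n (f ^+ n).
Proof.
move=> f1; elim: n => [|n IH]; first exact: order_ge0.
by rewrite exprS -add1n; apply: order_geM.
Qed.
Lemma order_ge_mono (b : M) : order_ge (gdeg b) (hmono k b).
Proof. by move=> c; rewrite /hmono; case: eqP => // ->; rewrite ltnn. Qed.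

Lemma order_ge_eq f g : (forall n, order_ge n (f - g)) -> f = g.
Proof.
move=> fg; apply/funext => b; apply/eqP; rewrite -subr_eq0 -hserBE.
by rewrite (fg (gdeg b).+1).
Qed.

Lemma trunc_order n f :
  order_ge n.+1 (f - \sum_(b <- glow M n) f b *: hmono k b).
Proof.
move=> c cn; rewrite hserBE hser_sumE.
under eq_bigr => b _ do rewrite hserE /hmono mulrC eq_sym.
by rewrite big_glow_pick ?subrr // ltnNge -ltnS cn.
Qed.
End HserAlgebra.
Arguments order_ge_mono k {M} b c _.

(* The second condition implies continuity. *)
Definition clin (k : comPzRingType) (M N : gmonoid) (F : hser k M -> hser k N) :=
  linear F /\ forall n f, order_ge n f -> order_ge n (F f).

Definition cmor (k : comPzRingType) (M N : gmonoid) (F : hser k M -> hser k N) :=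
  [/\ clin F, F 1 = 1 & forall f g, F (f * g) = F f * F g].

Section Clin.
Variables (k : comPzRingType) (M N P : gmonoid).
Implicit Types (F G : hser k M -> hser k N) (a : k) (f g : hser k M).

Lemma clinD F : clin F -> forall f g, F (f + g) = F f + F g.
Proof. by case=> Fl _ f g; have := Fl 1 f g; rewrite !scale1r. Qed.
Lemma clin0 F : clin F -> F 0 = 0.
Proof.
move=> FL; have /eqP := clinD FL 0 0.
by rewrite addr0 -subr_eq0 opprD addrA subrr sub0r oppr_eq0 => /eqP.
Qed.
Lemma clinZ F : clin F -> forall a f, F (a *: f) = a *: F f.
Proof. by move=> FL a f; have := FL.1 a f 0; rewrite clin0 ?addr0. Qed.
Lemma clinN F : clin F -> forall f, F (- f) = - F f.
Proof. by move=> FL f; rewrite -scaleN1r clinZ // scaleN1r. Qed.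
Lemma clinB F : clin F -> forall f g, F (f - g) = F f - F g.
Proof. by move=> FL f g; rewrite clinD // clinN. Qed.
Lemma clin_sum F : clin F -> forall I (r : seq I) (Q : pred I) (E : I -> hser k M),
  F (\sum_(i <- r | Q i) E i) = \sum_(i <- r | Q i) F (E i).
Proof. by move=> FL I r Q E; apply: (big_morph F (clinD FL) (clin0 FL)). Qed.

Lemma clin_hext (phi : M -> hser k N) : filtered phi -> clin (hext phi).
Proof.
move=> phiF; split=> [a f g|n f fn c cn]; first apply/funext => c.
  rewrite hserDE hserE /hext mulr_sumr -big_split; apply: eq_bigr => b _.
  by rewrite hserDE hserE mulrDl mulrA.
apply: big1 => b _; case: (ltnP (gdeg b) n) => [/fn ->|nb]; first by rewrite mul0r.
by rewrite phiF ?mulr0 // (leq_trans cn).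
Qed.

(** The part of f beyond degree n has order n + 1, which F preserves, so it is invisible at c. This
    finite formula is how continuity enters everywhere below. *)
Lemma clin_bound F n f c : clin F -> (gdeg c <= n)%N ->
  F f c = \sum_(b <- glow M n) f b * F (hmono k b) c.
Proof.
move=> FL cn; rewrite -{1}[f](subrK (\sum_(b <- glow M n) f b *: hmono k b)).
rewrite clinD // hserDE (FL.2 n.+1 _ (trunc_order f)) ?add0r //.
by rewrite clin_sum // hser_sumE; apply: eq_bigr => b _; rewrite clinZ.
Qed.

Lemma clin_ext F G : clin F -> clin G ->
  (forall b, F (hmono k b) = G (hmono k b)) -> F =1 G.
Proof.
move=> FL GL FG f; apply/funext => c.
rewrite !(@clin_bound _ (gdeg c)) //; apply: eq_bigr => b _; by rewrite FG.
Qed.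

Lemma clin_id : clin (@id (hser k M)).
Proof. by split. Qed.
Lemma clin_comp (H : hser k N -> hser k P) F : clin H -> clin F -> clin (fun f => H (F f)).
Proof.
move=> HL FL; split=> [a f g /=|n f fn]; first by rewrite FL.1 HL.1.
exact/HL.2/FL.2.
Qed.
Lemma clin_add F G : clin F -> clin G -> clin (fun f => F f + G f).
Proof.
move=> FL GL; split=> [a f g|n f fn]; last exact/order_geD/(GL.2 n)/fn/(FL.2 n)/fn.
by rewrite FL.1 GL.1 scalerDr addrACA.
Qed.
Lemma clin_scale c F : clin F -> clin (fun f => c *: F f).
Proof.
move=> FL; split=> [a f g|n f fn]; last exact/order_geZ/(FL.2 n)/fn.
by rewrite FL.1 scalerDr !scalerA mulrC.
Qed.
Lemma clin_mull h F : clin F -> clin (fun f => h * F f).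
Proof.
move=> FL; split=> [a f g|n f fn]; last exact/order_geMl/(FL.2 n)/fn.
by rewrite FL.1 mulrDr hscaleAr.
Qed.
Lemma clin_mulr h F : clin F -> clin (fun f => F f * h).
Proof.
move=> FL; split=> [a f g|n f fn]; last exact/order_geMr/(FL.2 n)/fn.
by rewrite FL.1 mulrDl hscaleAl.
Qed.
End Clin.
Arguments clin_id {k M}.

Section Cmor.
Variable k : comPzRingType.

Lemma cmor_id M : cmor (@id (hser k M)).
Proof. by split=> //; apply: clin_id. Qed.
Lemma cmor_comp M N P (G : hser k N -> hser k P) (F : hser k M -> hser k N) :
  cmor G -> cmor F -> cmor (G \o F).
Proof.
case=> GL G1 GM [FL F1 FM]; split; first exact: clin_comp.
- by rewrite /= F1.
- by move=> f g /=; rewrite FM.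
Qed.

(** Both sides of multiplicativity are continuous and linear in each factor, so density of the
    monomials applies to one factor at a time. *)
Lemma cmor_mono M N (F : hser k M -> hser k N) : clin F -> F 1 = 1 ->
  (forall a b, F (hmono k (gmul a b)) = F (hmono k a) * F (hmono k b)) -> cmor F.
Proof.
move=> FL F1 FM; split=> // f g; move: g f.
suff H g a : F (hmono k a * g) = F (hmono k a) * F g.
  move=> g; apply: clin_ext => [||a]; last exact: H.
  - by apply: clin_comp => //; apply: clin_mulr; apply: clin_id.
  - exact: clin_mulr.
move: g; apply: clin_ext => [||b]; last by rewrite -hmonoM FM.
- by apply: clin_comp => //; apply: clin_mull; apply: clin_id.
- exact: clin_mull.
Qed.

Lemma cmorX M N (F : hser k M -> hser k N) f n : cmor F -> F (f ^+ n) = F f ^+ n.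
Proof. by case=> FL F1 FM; elim: n => // n IH; rewrite !exprS FM IH. Qed.

Lemma cmor_inv M N (F : hser k M -> hser k N) f g : cmor F -> f * g = 1 -> F f * F g = 1.
Proof. by case=> FL F1 FM fg; rewrite -FM fg. Qed.

Lemma alg_ext_cmor (A : alphabet) N (L : A -> hser k N) :
  (forall a, order_ge (weight a) (L a)) -> cmor (alg_ext L).
Proof.
move=> LF; split; last exact: alg_extM.
- exact/clin_hext/alg_ext_filtered.
- exact: alg_ext1.
Qed.

Lemma hmono_cons (A : alphabet) (a : A) w :
  hmono k ((a :: w) : wordm A) = lmono k a * hmono k (w : wordm A).
Proof. by rewrite -hmonoM. Qed.

Lemma cmor_ext (A : alphabet) N (F G : hser k (wordm A) -> hser k N) :
  cmor F -> cmor G -> (forall a, F (lmono k a) = G (lmono k a)) -> F =1 G.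
Proof.
move=> [FL F1 FM] [GL G1 GM] FG; apply: clin_ext => // w.
elim: (w : seq A) => [|a v IH]; first by rewrite F1 G1.
by rewrite hmono_cons FM GM FG IH.
Qed.
End Cmor.

(** * Completed tensor products of series and of maps *)

Section Tens.
Variables (k : comPzRingType).

Lemma tensDl M N (f f' : hser k M) (g : hser k N) : tens (f + f') g = tens f g + tens f' g.
Proof. by apply/funext => p; rewrite hserDE /tens hserDE mulrDl. Qed.
Lemma tensDr M N (f : hser k M) (g g' : hser k N) : tens f (g + g') = tens f g + tens f g'.
Proof. by apply/funext => p; rewrite hserDE /tens hserDE mulrDr. Qed.
Lemma tensZl M N a (f : hser k M) (g : hser k N) : tens (a *: f) g = a *: tens f g.
Proof. by apply/funext => p; rewrite hserE /tens hserE mulrA. Qed.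
Lemma tensZr M N a (f : hser k M) (g : hser k N) : tens f (a *: g) = a *: tens f g.
Proof. by apply/funext => p; rewrite hserE /tens hserE mulrCA. Qed.
Lemma tensNl M N (f : hser k M) (g : hser k N) : tens (- f) g = - tens f g.
Proof. by rewrite -scaleN1r tensZl scaleN1r. Qed.
Lemma tensNr M N (f : hser k M) (g : hser k N) : tens f (- g) = - tens f g.
Proof. by rewrite -scaleN1r tensZr scaleN1r. Qed.

Lemma tens_order M N m n (f : hser k M) (g : hser k N) :
  order_ge m f -> order_ge n g -> order_ge (m + n) (tens f g).
Proof.
move=> fm gn [a b] /= ab; rewrite /tens /=.
case: (ltnP (gdeg a) m) => [/fm ->|ma]; first by rewrite mul0r.
by rewrite [g b]gn ?mulr0 // -(ltn_add2l m) (leq_ltn_trans _ ab) ?leq_add2r.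
Qed.
Lemma tens_orderl M N n (f : hser k M) (g : hser k N) :
  order_ge n f -> order_ge n (tens f g).
Proof. by move=> fn; rewrite -[n]addn0; apply: tens_order. Qed.
Lemma tens_orderr M N n (f : hser k M) (g : hser k N) :
  order_ge n g -> order_ge n (tens f g).
Proof. by move=> gn; rewrite -[n]add0n; apply: tens_order. Qed.

Lemma tens_clinl M N (g : hser k N) : clin (fun f : hser k M => tens f g).
Proof.
split=> [a f f'|n f]; last exact: tens_orderl.
by rewrite tensDl tensZl.
Qed.
Lemma tens_clinr M N (f : hser k M) : clin (fun g : hser k N => tens f g).
Proof.
split=> [a g g'|n g]; last exact: tens_orderr.
by rewrite tensDr tensZr.
Qed.

Lemma tens_mono (M N : gmonoid) (a : M) (b : N) :
  tens (hmono k a) (hmono k b) = hmono k ((a, b) : prodm M N).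
Proof.
by apply/funext => -[c d]; rewrite /tens /hmono /= -natrM mulnb -xpair_eqE.
Qed.

Arguments tens_clinl {M N} g.
Arguments tens_clinr {M N} f.

Lemma tens11 M N : tens (1 : hser k M) (1 : hser k N) = 1.
Proof. exact: tens_mono. Qed.

(** The uniqueness half of the universal property of the completed tensor product: the monomials of
    [prodm] are the pure tensors of monomials. *)
Lemma tens_ext M N P (F : hser k (prodm M N) -> hser k P)
    (B : hser k M -> hser k N -> hser k P) : clin F ->
  (forall g, clin (B^~ g)) -> (forall f, clin (B f)) ->
  (forall a b, F (hmono k ((a, b) : prodm M N)) = B (hmono k a) (hmono k b)) ->
  forall (f : hser k M) (g : hser k N), F (tens f g) = B f g.
Proof.
move=> FL BL BR FB f g; move: f.
apply: (@clin_ext k M P (fun f => F (tens f g))) => [||a].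
- exact: (clin_comp FL (tens_clinl _)).
- exact: BL.
move: g; apply: (@clin_ext k N P (fun g => F (tens (hmono k a) g))) => [||b].
- exact: (clin_comp FL (tens_clinr _)).
- exact: BR.
by rewrite tens_mono FB.
Qed.

Lemma tensM M N (f f' : hser k M) (g g' : hser k N) :
  tens (f * f') (g * g') = tens f g * tens f' g'.
Proof.
move: f; apply: clin_ext => [||a].
- exact: (clin_comp (tens_clinl _) (clin_mulr _ clin_id)).
- exact: (clin_mulr _ (tens_clinl _)).
move: f'; apply: clin_ext => [||c].
- exact: (clin_comp (tens_clinl _) (clin_mull _ clin_id)).
- exact: (clin_mull _ (tens_clinl _)).
move: g; apply: clin_ext => [||b].
- exact: (clin_comp (tens_clinr _) (clin_mulr _ clin_id)).
- exact: (clin_mulr _ (tens_clinr _)).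
move: g'; apply: clin_ext => [||d].
- exact: (clin_comp (tens_clinr _) (clin_mull _ clin_id)).
- exact: (clin_mull _ (tens_clinr _)).
by rewrite -!hmonoM !tens_mono -hmonoM.
Qed.

Lemma tens_map_clin M M' N N' (F : hser k M -> hser k N) (F' : hser k M' -> hser k N') :
  clin F -> clin F' -> clin (tens_map F F').
Proof.
move=> FL FL'; apply: clin_hext => -[a b] c cab; apply: tens_order cab.
- exact/FL.2/order_ge_mono.
- exact/FL'.2/order_ge_mono.
Qed.

Lemma tens_mapE M M' N N' (F : hser k M -> hser k N) (F' : hser k M' -> hser k N') f g :
  clin F -> clin F' -> tens_map F F' (tens f g) = tens (F f) (F' g).
Proof.
move=> FL FL'; apply: (@tens_ext _ _ _ _ (fun f g => tens (F f) (F' g))) => //.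
- exact: tens_map_clin.
- by move=> g'; apply: clin_comp (tens_clinl _) FL.
- by move=> f'; apply: clin_comp (tens_clinr _) FL'.
move=> a b; rewrite /tens_map hext_mono // => -[c d] e edc; apply: tens_order edc.
- exact/FL.2/order_ge_mono.
- exact/FL'.2/order_ge_mono.
Qed.

Lemma tens_map_comp M M' N N' P P' (F : hser k M -> hser k N) (F' : hser k M' -> hser k N')
    (G : hser k N -> hser k P) (G' : hser k N' -> hser k P') x :
  clin F -> clin F' -> clin G -> clin G' ->
  tens_map G G' (tens_map F F' x) = tens_map (G \o F) (G' \o F') x.
Proof.
move=> FL FL' GL GL'; move: x.
apply: (clin_ext (F := tens_map G G' \o tens_map F F')) => [||[a b] /=].
- by apply: clin_comp; apply: tens_map_clin.
- by apply: tens_map_clin; apply: clin_comp.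
by rewrite -tens_mono !tens_mapE //; apply: clin_comp.
Qed.

Lemma tens_map_id M N (x : hser k (prodm M N)) : tens_map id id x = x.
Proof.
move: x; apply: (clin_ext (G := id)) => [||[a b]]; last 1 first.
- by rewrite -tens_mono tens_mapE //; apply: clin_id.
- by apply: tens_map_clin; apply: clin_id.
- exact: clin_id.
Qed.

Lemma tens_map_cmor M M' N N' (F : hser k M -> hser k N) (F' : hser k M' -> hser k N') :
  cmor F -> cmor F' -> cmor (tens_map F F').
Proof.
case=> FL F1 FM [FL' F1' FM']; apply: cmor_mono.
- exact: tens_map_clin.
- by rewrite -tens11 tens_mapE // F1 F1' tens11.
case=> [a a'] [b b']; rewrite -!tens_mono !tens_mapE // -tensM -FM -FM' -!hmonoM.
by rewrite -tens_mapE // tens_mono.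
Qed.

End Tens.

(** The condition under which a constant term 1 makes a series invertible. [Vm] violates it when G
    is nontrivial, all of G having degree 0; inverses in V^ are therefore images under [beta1] or
    [heval] of inverses formed elsewhere. *)
Definition connected (M : gmonoid) := forall b : M, gdeg b = 0%N -> b = gone.

Lemma natm_connected : connected natm. Proof. by []. Qed.

Lemma wordm_connected (A : alphabet) : connected (wordm A).
Proof.
case=> [|a w] //= /eqP; rewrite /wdeg /= addn_eq0.
by have := weight_gt0 a; rewrite lt0n => /negPf ->.
Qed.

Section Inverse.
Variables (k : comPzRingType) (M : gmonoid).
Hypothesis M0 : connected M.
Implicit Types f g : hser k M.

Lemma order_ge1P f : order_ge 1 f <-> f gone = 0.
Proof.
split=> [f1|f0 c]; first by rewrite f1 ?gdeg1.
by rewrite ltnS leqn0 => /eqP/M0 ->.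
Qed.

Lemma hmul_gone f g : (f * g) gone = f gone * g gone.
Proof.
have fE (h : hser k M) : order_ge 1 (h - h gone *: (1 : hser k M)).
  by apply/order_ge1P; rewrite hserBE hserE hser1E eqxx mulr1 subrr.
rewrite -{1}[f](subrK (f gone *: (1 : hser k M))) mulrDl hserDE -hscaleAl mul1r hserE.
by rewrite (order_geMr g (fE f)) ?add0r // gdeg1.
Qed.

(** The number of summands in [hinv] varies with the degree; powers of 1 - f beyond the degree
    contribute nothing, so a uniform truncation may replace it. *)
Lemma hinv_trunc f n : f gone = 1 ->
  order_ge n.+1 (hinv f - \sum_(j < n.+1) (1 - f) ^+ j).
Proof.
move=> f1 c; rewrite ltnS => cn; rewrite hserBE hser_sumE /hinv.
have u1 : order_ge 1 (1 - f).
  by apply/order_ge1P; rewrite hserBE hser1E eqxx f1 subrr.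
rewrite -!(big_mkord xpredT (fun j => ((1 - f) ^+ j) c)) /=.
rewrite [X in _ - X](big_cat_nat _ (n := (gdeg c).+1)) //= [X in _ - (_ + X)]big1_seq.
  by rewrite addr0 subrr.
by move=> j; rewrite mem_index_iota => /andP[_ /andP[cj _]]; rewrite (order_geX u1).
Qed.

Lemma hinvr f : f gone = 1 -> f * hinv f = 1.
Proof.
move=> f1; apply: order_ge_eq => -[|n] //; have tr := @hinv_trunc f n f1.
move: tr; set S := \sum_(_ < _) _ => tr.
(* The geometric sum telescopes. *)
have fS : f * S - 1 = - (1 - f) ^+ n.+1.
  rewrite -[in RHS](subrK 1 (_ ^+ _)) subrX1 -/S opprD -mulNr opprB.
  by rewrite opprB addrCA subrr addr0.
rewrite -[hinv f](subrK S) mulrDr -addrA fS.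
apply: order_geD; first exact: order_geMl.
apply/order_geN/order_geX/order_ge1P.
by rewrite hserBE hser1E eqxx f1 subrr.
Qed.

Lemma hinv_gone f : f gone = 1 -> hinv f gone = 1.
Proof.
by move=> f1; rewrite /hinv gdeg1 big_ord_recl big_ord0 addr0 expr0 hser1E eqxx.
Qed.

Lemma hinvl f : f gone = 1 -> hinv f * f = 1.
Proof.
(* The right inverse has itself a right inverse, so it is two-sided. *)
move=> f1; have hr := hinvr f1; have := hinvr (hinv_gone f1).
by move=> hh; rewrite -{2}[f]mulr1 -hh !mulrA -[_ * f * _]mulrA hr mulr1 hh.
Qed.

Lemma hinv_uniq f g : f gone = 1 -> f * g = 1 -> g = hinv f.
Proof. by move=> f1 fg; rewrite -[g]mul1r -(hinvl f1) -mulrA fg mulr1. Qed.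
End Inverse.

Section Eval.
Variables (k : comPzRingType) (M : gmonoid).

Lemma heval_cmor (v : hser k M) : order_ge 1 v -> cmor (fun c => heval c v).
Proof.
move=> v1; have phiF : filtered (fun n : natm => v ^+ n).
  by move=> n c; apply: order_geX.
split; first exact: clin_hext.
- by rewrite /heval hext_mono.
- by apply: hextM => // m n; rewrite exprD.
Qed.

End Eval.

Section EvalMorph.
Variables (k : comPzRingType) (M : gmonoid).

Lemma heval_morph N (F : hser k M -> hser k N) c v : cmor F -> order_ge 1 v ->
  F (heval c v) = heval c (F v).
Proof.
move=> FM v1; have Fv1 : order_ge 1 (F v) by case: FM => FL _ _; apply: FL.2.
move: c; apply: (@clin_ext k natm N (fun c => F (heval c v))) => [||n].
- by apply: clin_comp; [case: FM | case: (heval_cmor v1)].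
- by case: (heval_cmor Fv1).
rewrite /heval !hext_mono ?cmorX // => m c; exact: order_geX.
Qed.

(** Powers of a conjugate are conjugates of powers. It is needed because [autV] conjugates e_1, at
    which Gamma is evaluated. *)
Lemma heval_conj c v (p q : hser k M) : order_ge 1 v -> q * p = 1 -> p * q = 1 ->
  heval c (p * v * q) = p * heval c v * q.
Proof.
move=> v1 qp pq; have pvq1 : order_ge 1 (p * v * q) by apply/order_geMr/order_geMl.
move: c; apply: (@clin_ext k natm M) => [||n].
- by case: (heval_cmor pvq1).
- by apply: clin_mulr; apply: clin_mull; case: (heval_cmor v1).
rewrite /heval !hext_mono => [|m c|m c]; try exact: order_geX.
elim: n => [|n IH]; first by rewrite !expr0 mulr1 pq.
by rewrite exprS IH !mulrA -[p * v * q * p]mulrA qp mulr1 exprS !mulrA.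
Qed.
End EvalMorph.

(** * The exponential of one-variable series *)

Section Exponential.
Variables (k : comQAlg).
Implicit Types s t : hser k natm.

Lemma natm_mulC s t : s * t = t * s.
Proof.
apply/funext => n; rewrite !hserME /hmul exchange_big; apply: eq_bigr => i _.
by apply: eq_bigr => j _; rewrite [gmul _ _]addnC [t _ * _]mulrC.
Qed.

Lemma hexp_trunc s n : order_ge 1 s ->
  order_ge n.+1 (hexp s - \sum_(j < n.+1) qstr (j`!%:R^-1) *: s ^+ j).
Proof.
move=> s1 c; rewrite ltnS => cn; rewrite hserBE hser_sumE /hexp.
under [X in _ - X]eq_bigr => j _ do rewrite hserE.
rewrite -!(big_mkord xpredT (fun j => qstr (j`!%:R^-1) * (s ^+ j) c)) /=.
rewrite [X in _ - X](big_cat_nat _ (n := c.+1)) //= [X in _ - (_ + X)]big1_seq.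
  by rewrite addr0 subrr.
move=> j; rewrite mem_index_iota => /andP[_ /andP[cj _]].
by rewrite (order_geX s1) ?mulr0.
Qed.

Lemma hexp0 : hexp (0 : hser k natm) = 1.
Proof.
apply/funext => n; rewrite /hexp big_ord_recl /= big1 => [|i _].
  by rewrite addr0 invr1 rmorph1 mul1r.
by rewrite expr0n /= mulr0.
Qed.

Lemma hexp_gone s : hexp s gone = 1.
Proof. by rewrite /hexp big_ord_recl big_ord0 addr0 invr1 rmorph1 mul1r. Qed.

(** Modulo order n + 1 all exponentials may be truncated to the polynomials E, and E s * E t exceeds
    E (s + t) only by terms of total degree above n in s and t. *)
Lemma hexpD s t : order_ge 1 s -> order_ge 1 t -> hexp (s + t) = hexp s * hexp t.
Proof.
move=> s1 t1; apply: order_ge_eq => -[|n] //.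
pose e j : k := qstr (j`!%:R^-1).
pose E (x : hser k natm) := \sum_(j < n.+1) e j *: x ^+ j.
have st1 : order_ge 1 (s + t) by apply: order_geD.
have -> : hexp (s + t) - hexp s * hexp t = (hexp (s + t) - E (s + t)) +
   (E (s + t) - E s * E t) - ((hexp s - E s) * hexp t + E s * (hexp t - E t)).
  by rewrite subrKA mulrBl mulrBr subrKA opprB subrKA.
apply: order_geB; last first.
  apply: order_geD; first exact/order_geMr/hexp_trunc.
  exact/order_geMl/hexp_trunc.
apply: order_geD; first exact: hexp_trunc.
pose a i j := (e i * e j) *: (s ^+ i * t ^+ j).
have EE : E s * E t = \sum_(i < n.+1) \sum_(j < n.+1) a i j.
  rewrite /E mulr_suml; apply: eq_bigr => i _; rewrite mulr_sumr.
  by apply: eq_bigr => j _; rewrite -hscaleAr -hscaleAl scalerA mulrC.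
(* Binomial theorem, with binomial(m, i) / m! = 1 / ((m - i)! i!). *)
have ED : E (s + t) = \sum_(m < n.+1) \sum_(i < m.+1) a (m - i)%N i.
  apply: eq_bigr => m _; rewrite exprDn_comm; last exact: natm_mulC.
  rewrite scaler_sumr; apply: eq_bigr => i _.
  rewrite -[_ *+ _]scaler_nat scalerA; congr (_ *: _).
  rewrite -(rmorph_nat (@qstr k)) /e -!rmorphM; congr (qstr _).
  have im : (i <= m)%N by rewrite -ltnS.
  rewrite -(bin_fact im) !natrM invfM mulrC mulrA mulfV ?mul1r ?invfM 1?mulrC //.
  by rewrite Num.Theory.pnatr_eq0 -lt0n bin_gt0.
have -> : E (s + t) = \sum_(i < n.+1) \sum_(j < n.+1 | (i + j <= n)%N) a i j.
  rewrite ED.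
  have -> : \sum_(m < n.+1) \sum_(i < m.+1) a (m - i)%N i =
     \sum_(m < n.+1) \sum_(j < n.+1) \sum_(i < n.+1 | (i + j == m)%N) a i j.
    apply: eq_bigr => m _; have mn : (m.+1 <= n.+1)%N by [].
    rewrite (big_ord_widen n.+1 (fun i => a (m - i)%N i) mn) /= big_mkcond.
    apply: eq_bigr => j _; rewrite ltnS; case: leqP => jm.
      rewrite (big_pred1 (Ordinal (leq_ltn_trans (leq_subr j m) mn))) // => i.
      by apply/eqP/eqP => [im|->]; [apply: val_inj; rewrite /= -im addnK | exact: subnK].
    rewrite big_pred0 // => i; apply: contraTF jm => /eqP <-.
    by rewrite -leqNgt leq_addl.
  under [RHS]eq_bigr => i _ do rewrite big_mkcond.
  rewrite exchange_big [RHS]exchange_big; apply: eq_bigr => j _ /=.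
  under eq_bigr => m _ do rewrite big_mkcond.
  rewrite exchange_big /=; apply: eq_bigr => i _.
  rewrite -big_mkcond /=; case: leqP => ijn.
    by rewrite (big_pred1 (Ordinal (ijn : (i + j < n.+1)%N))).
  by rewrite big_pred0 // => m; apply: contraTF ijn => /eqP ->; rewrite -leqNgt -ltnS.
(* Only the terms s^i t^j with i + j > n survive; their order is at least n + 1. *)
rewrite EE -sumrB; apply: order_ge_sum => i _.
rewrite [X in _ - X](bigID (fun j : 'I_n.+1 => (i + j <= n)%N)) /= opprD addrA subrr sub0r.
apply/order_geN/order_ge_sum => j; rewrite -ltnNge => ijn.
apply/order_geZ/(order_ge_leq ijn)/order_geM; exact: order_geX.
Qed.
End Exponential.

(** * The group of grouplike series *)

Section Connected.
Variables (k : comPzRingType).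

Lemma hinvM M (f g : hser k M) : connected M -> f gone = 1 -> g gone = 1 ->
  hinv (f * g) = hinv g * hinv f.
Proof.
move=> M0 f1 g1; apply/esym/hinv_uniq => //; first by rewrite hmul_gone // f1 g1 mulr1.
by rewrite mulrA -[f * g * _]mulrA hinvr // mulr1 hinvr.
Qed.

Lemma hinv1 M : connected M -> hinv (1 : hser k M) = 1.
Proof. by move=> M0; apply/esym/hinv_uniq; rewrite ?mulr1 // hser1E eqxx. Qed.

(** Over a connected source f minus its constant term has order 1, which F preserves, and F fixes
    constants. *)
Lemma cmor_gone M N (F : hser k M -> hser k N) f : connected M -> cmor F ->
  F f gone = f gone.
Proof.
move=> M0 [FL F1 FM].
have f1 : order_ge 1 (f - f gone *: (1 : hser k M)).
  by apply/order_ge1P; rewrite // hserBE hserE hser1E eqxx mulr1 subrr.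
rewrite -{1}[f](subrK (f gone *: (1 : hser k M))) (clinD FL) (clinZ FL) F1 hserDE.
by rewrite (FL.2 1%N _ f1) ?gdeg1 // add0r hserE hser1E eqxx mulr1.
Qed.

Lemma cmor_hinv M N (F : hser k M -> hser k N) f : connected M -> connected N ->
  cmor F -> f gone = 1 -> F (hinv f) = hinv (F f).
Proof.
move=> M0 N0 FM f1; apply: hinv_uniq; rewrite ?cmor_gone //.
by rewrite (cmor_inv FM) // hinvr.
Qed.
End Connected.

(* A unipotent map is inverted by a geometric series. *)
Section Unipotent.
Variables (k : comPzRingType) (M : gmonoid) (F : hser k M -> hser k M).
Hypotheses (FL : clin F).
Hypothesis F1 : forall n f, order_ge n f -> order_ge n.+1 (f - F f).

Lemma unipotent_surj h : exists f, F f = h.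
Proof.
pose D f := f - F f.
have DL : clin D.
  apply: (clin_add clin_id); split=> [a f g|n f fn]; last exact/order_geN/(FL.2 n)/fn.
  by rewrite FL.1 opprD scalerN.
have Dn n : order_ge n (iter n D h).
  by elim: n => [|n IH]; [exact: order_ge0 | exact: F1].
pose S n := \sum_(j < n) iter j D h.
(* The partial sums [S n] are stationary in each degree; the coefficient at c is final from index
   [(gdeg c).+1] on. *)
pose f : hser k M := fun c => S (gdeg c).+1 c; exists f.
have fS n : order_ge n (f - S n).
  move=> c cn; rewrite hserBE /f /S !hser_sumE.
  rewrite -!(big_mkord xpredT (fun j => iter j D h c)) /=.
  rewrite [X in _ - X](big_cat_nat _ (n := (gdeg c).+1)) //= [X in _ - (_ + X)]big1_seq.
    by rewrite addr0 subrr.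
  by move=> j; rewrite mem_index_iota => /andP[_ /andP[cj _]]; rewrite Dn.
have FS n : F (S n) = h - iter n D h.
  elim: n => [|n IH]; first by rewrite /S big_ord0 (clin0 FL) subrr.
  rewrite /S big_ord_recr /= -/(S n) (clinD FL) IH.
  have -> : D (iter n D h) = iter n D h - F (iter n D h) by [].
  by rewrite opprB [F _ - _]addrC addrA.
apply: order_ge_eq => n; rewrite -[f](subrK (S n)) (clinD FL) FS -addrA.
rewrite addrAC subrr add0r; apply: order_geD; first exact/FL.2/fS.
exact/order_geN.
Qed.
End Unipotent.

Section XSide.
Variables (k : comPzRingType) (gT : finGroupType).
Local Notation X := (Xser gT k).
Implicit Types (Psi Phi f : X) (g h : gT).

Lemma Xm_connected : connected (Xm gT). Proof. exact: wordm_connected. Qed.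
Local Hint Resolve Xm_connected natm_connected : core.

Lemma xlet_order x : order_ge 1 (xlet k x : X).
Proof. exact: (order_ge_mono k ([:: x] : Xm gT)). Qed.

Lemma taut_cmor g : cmor (taut (k := k) g).
Proof. by apply: alg_ext_cmor => x; apply: xlet_order. Qed.

Lemma taut_let g x : taut g (xlet k x) = xlet k (xact g x).
Proof. by apply: alg_ext_letter => y; apply: xlet_order. Qed.

Lemma tautM g h f : taut g (taut h f) = taut (g * h)%g f.
Proof.
move: f; apply: (cmor_ext (cmor_comp (taut_cmor g) (taut_cmor h)) (taut_cmor _)) => x.
by rewrite /= !taut_let xactM.
Qed.

Lemma taut_gone g f : taut g f gone = f gone.
Proof. by apply: cmor_gone => //; apply: taut_cmor. Qed.

Lemma taut_inv g f : f gone = 1 -> taut g (hinv f) = hinv (taut g f).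
Proof. by apply: cmor_hinv => //; apply: taut_cmor. Qed.

Lemma autX_order Psi (x : option gT) : order_ge 1
  (if x is Some g then taut g (hinv Psi) * xlet k (Some g) * taut g Psi else xlet k None).
Proof.
case: x => [g|]; last exact: xlet_order.
exact/order_geMr/order_geMl/xlet_order.
Qed.

Lemma autX_cmor Psi : cmor (autX Psi).
Proof. by apply: alg_ext_cmor => x; apply: autX_order. Qed.

Lemma autX_let Psi (x : option gT) : autX Psi (xlet k x) =
  if x is Some g then taut g (hinv Psi) * xlet k (Some g) * taut g Psi else xlet k None.
Proof. by apply: alg_ext_letter => y; apply: autX_order. Qed.

Lemma autX_taut Psi g f : autX Psi (taut g f) = taut g (autX Psi f).
Proof.
move: f; apply: (cmor_ext (cmor_comp (autX_cmor Psi) (taut_cmor g))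
  (cmor_comp (taut_cmor g) (autX_cmor Psi))) => -[h|] /=.
  have [_ _ tM] := taut_cmor g.
  by rewrite taut_let !autX_let !tM taut_let !tautM.
by rewrite taut_let !autX_let taut_let.
Qed.

Lemma circ_gone Psi Phi : Psi gone = 1 -> Phi gone = 1 -> circ gT k Psi Phi gone = 1.
Proof.
by move=> P1 Q1; rewrite /circ hmul_gone // P1 mul1r cmor_gone //; apply: autX_cmor.
Qed.

(** On x_g the two successive conjugators are t_g(Psi) and aut_Psi(t_g(Phi)). As aut_Psi commutes
    with t_g, their product is t_g applied to Psi aut_Psi(Phi). *)
Lemma autX_circ Psi Phi f : Psi gone = 1 -> Phi gone = 1 ->
  autX (circ gT k Psi Phi) f = autX Psi (autX Phi f).
Proof.
move=> P1 Q1; have AM := autX_cmor Psi; have A1 := cmor_gone Phi Xm_connected AM.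
move: f; apply: (cmor_ext (autX_cmor _) (cmor_comp AM (autX_cmor Phi))) => -[g|] /=.
  have [_ _ tM] := taut_cmor g; have [_ _ aM] := AM.
  rewrite !autX_let !aM !autX_taut autX_let /circ hinvM ?A1 ?Q1 // !tM.
  by rewrite (cmor_hinv _ _ AM) // !mulrA.
by rewrite !autX_let.
Qed.

Lemma circA Psi Phi Xi : Psi gone = 1 -> Phi gone = 1 ->
  circ gT k Psi (circ gT k Phi Xi) = circ gT k (circ gT k Psi Phi) Xi.
Proof.
move=> P1 Q1; have [_ _ aM] := autX_cmor Psi.
by rewrite {1 2}/circ aM mulrA [in RHS]/circ autX_circ.
Qed.

Lemma autX1 f : autX 1 f = f.
Proof.
move: f; apply: (cmor_ext (autX_cmor 1) (cmor_id k (Xm gT))) => -[g|] /=; rewrite autX_let //.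
by have [_ t1 _] := taut_cmor g; rewrite hinv1 // !t1 mul1r mulr1.
Qed.

Lemma circ1l Psi : circ gT k 1 Psi = Psi.
Proof. by rewrite /circ autX1 mul1r. Qed.

Lemma circ1r Psi : circ gT k Psi 1 = Psi.
Proof. by rewrite /circ; have [_ -> _] := autX_cmor Psi; rewrite mulr1. Qed.

(** Conjugation by a series with constant term 1 moves x_g only in degrees at least 2, so aut_Psi is
    the identity on the associated graded. *)
Lemma autX_unipotent Psi n f : Psi gone = 1 -> order_ge n f ->
  order_ge n.+1 (f - autX Psi f).
Proof.
move=> P1 fn; have AM := autX_cmor Psi; have [AL A1 aM] := AM.
have DL : clin (fun f => f - autX Psi f).
  apply: (clin_add clin_id); split=> [a f' f''|m f' fm]; last exact/order_geN/(AL.2 m)/fm.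
  by rewrite AL.1 opprD scalerN.
suff W (w : Xm gT) : order_ge (gdeg w).+1 (hmono k w - autX Psi (hmono k w)).
  move=> c cn; rewrite (@clin_bound _ _ _ _ (gdeg c) f c DL) //.
  rewrite big1 // => b _; case: (ltnP (gdeg b) n) => [/fn ->|nb]; first by rewrite mul0r.
  by rewrite W ?mulr0 // (leq_trans cn).
have L (x : option gT) : order_ge 2 (xlet k x - autX Psi (xlet k x)).
  rewrite autX_let; case: x => [g|]; last by rewrite subrr.
  have Pg : taut g Psi gone = 1 by rewrite taut_gone.
  rewrite taut_inv // -[X in X - _]mul1r -(hinvl Xm_connected Pg) -!mulrA -mulrBr.
  set P := taut g Psi in Pg *; apply: order_geMl.
  (* The commutator with P equals the commutator with P - 1, whose order is 1. *)
  have -> : P * xlet k (Some g) - xlet k (Some g) * P =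
     (P - 1) * xlet k (Some g) - xlet k (Some g) * (P - 1).
    by rewrite mulrBl mulrBr mul1r mulr1 opprB addrA subrK.
  have P1' : order_ge 1 (P - 1).
    by apply/order_ge1P; rewrite // hserBE Pg hser1E eqxx subrr.
  by apply: order_geB; apply: (@order_geM _ _ 1 1) => //; apply: xlet_order.
elim: w => [|x w IH]; first by rewrite A1 subrr.
have -> : hmono k (x :: w : Xm gT) = xlet k x * hmono k (w : Xm gT) by rewrite -hmonoM.
rewrite aM -[_ * hmono k _](subrK (autX Psi (xlet k x) * hmono k (w : Xm gT))).
rewrite -mulrBl -addrA -mulrBr; apply: order_geD.
  exact: (order_geM (L x) (order_ge_mono k (w : Xm gT))).
by apply: (@order_geM _ _ 1) => //; apply/AL.2/xlet_order.
Qed.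

(** A right inverse is a solution of aut_Psi(Phi) = Psi^(-1), and aut_Psi is unipotent, hence onto.
    The right inverse of the right inverse is then Psi itself. *)
Lemma circ_inv Psi : Psi gone = 1 -> exists Phi,
  [/\ Phi gone = 1, circ gT k Psi Phi = 1 & circ gT k Phi Psi = 1].
Proof.
have R Psi' : Psi' gone = 1 -> exists2 Phi, Phi gone = 1 & circ gT k Psi' Phi = 1.
  move=> P1; have AM := autX_cmor Psi'; have [AL _ _] := AM.
  have [Phi PhiE] := unipotent_surj AL (fun n f => @autX_unipotent Psi' n f P1) (hinv Psi').
  exists Phi; last by rewrite /circ PhiE hinvr.
  by rewrite -(cmor_gone _ Xm_connected AM) PhiE hinv_gone.
move=> P1; have [Phi Q1 PQ] := R _ P1; have [Xi X1 QX] := R _ Q1.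
exists Phi; split=> //; suff -> : Psi = Xi by [].
by rewrite -[Psi]circ1r -QX circA // PQ circ1l.
Qed.

Lemma hatDelta_order (x : option gT) : order_ge 1 (tens (xlet k x) 1 + tens 1 (xlet k x)).
Proof. by apply: order_geD; [apply: tens_orderl | apply: tens_orderr]; apply: xlet_order. Qed.

Lemma hatDelta_cmor : cmor (hatDelta (gT := gT) (k := k)).
Proof. by apply: alg_ext_cmor => x; apply: hatDelta_order. Qed.

Lemma hatDelta_let (x : option gT) :
  hatDelta (xlet k x) = tens (xlet k x) 1 + tens 1 (xlet k x).
Proof. by apply: alg_ext_letter => y; apply: hatDelta_order. Qed.

Lemma hatDelta_taut g f : hatDelta (taut g f) = tens_map (taut g) (taut g) (hatDelta f).
Proof.
have tC := taut_cmor g; have [tL t1 _] := tC; have [TL _ _] := tens_map_cmor tC tC.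
move: f; apply: (cmor_ext (cmor_comp hatDelta_cmor tC)
  (cmor_comp (tens_map_cmor tC tC) hatDelta_cmor)) => x /=.
by rewrite taut_let !hatDelta_let (clinD TL) !tens_mapE // t1 taut_let.
Qed.

(** The coproduct preserves constant terms, so the constant term is idempotent; being invertible
    too, it is 1. The base ring may have other idempotents, which is why invertibility enters. *)
Lemma grouplike_gone Psi : grouplike Psi -> Psi gone = 1.
Proof.
case=> -[Phi [PQ _]] DP; have := cmor_gone Psi Xm_connected hatDelta_cmor.
have := congr1 (fun f : X => f gone) PQ; rewrite /= hmul_gone // hser1E eqxx => cd.
rewrite DP => /(congr1 ( *%R^~ (Phi gone))).
by rewrite /tens /= -mulrA cd mulr1.
Qed.

Lemma hatDelta_inv Psi : grouplike Psi ->
  hatDelta (hinv Psi) = tens (hinv Psi) (hinv Psi).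
Proof.
move=> GP; have P1 := grouplike_gone GP; case: GP => _ DP; have [_ D1 DM] := hatDelta_cmor.
rewrite -[LHS]mulr1 -(tens11 k (Xm gT) (Xm gT)) -(hinvr Xm_connected P1) tensM -DP mulrA -DM.
by rewrite hinvl // D1 mul1r.
Qed.

(** It suffices to look at the letters: conjugation of the primitive x_g by the grouplike t_g(Psi)
    commutes with the coproduct. *)
Lemma hatDelta_autX Psi f : grouplike Psi ->
  hatDelta (autX Psi f) = tens_map (autX Psi) (autX Psi) (hatDelta f).
Proof.
move=> GP; have P1 := grouplike_gone GP; have AM := autX_cmor Psi.
have [AL A1 _] := AM; have [TL _ _] := tens_map_cmor AM AM.
move: f; apply: (cmor_ext (cmor_comp hatDelta_cmor AM)
  (cmor_comp (tens_map_cmor AM AM) hatDelta_cmor)) => x /=.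
rewrite autX_let !hatDelta_let (clinD TL) !tens_mapE // A1 autX_let.
case: x => [g|]; last by rewrite hatDelta_let.
have [_ _ DM] := hatDelta_cmor; have [tL _ _] := taut_cmor g.
rewrite !DM !hatDelta_taut hatDelta_inv // GP.2 !tens_mapE // hatDelta_let.
have Pg : taut g Psi gone = 1 by rewrite taut_gone.
rewrite taut_inv // mulrDr mulrDl -!tensM !mulr1.
by rewrite !hinvl.
Qed.

Lemma grouplike1 : grouplike (1 : X).
Proof.
split; first by exists 1; rewrite !mulr1.
by have [_ -> _] := hatDelta_cmor; rewrite tens11.
Qed.

Lemma grouplike_intro Psi : Psi gone = 1 -> hatDelta Psi = tens Psi Psi -> grouplike Psi.
Proof. by move=> P1 DP; split=> //; exists (hinv Psi); rewrite hinvl // hinvr. Qed.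

Lemma grouplike_circ Psi Phi : grouplike Psi -> grouplike Phi ->
  grouplike (circ gT k Psi Phi).
Proof.
move=> GP GQ; have P1 := grouplike_gone GP; have Q1 := grouplike_gone GQ.
apply: grouplike_intro; first exact: circ_gone.
have [AL _ _] := autX_cmor Psi; have [_ _ DM] := hatDelta_cmor.
by rewrite /circ DM hatDelta_autX // GP.2 GQ.2 tens_mapE // tensM.
Qed.

(** Phi is the preimage of the grouplike Psi^(-1) under aut_Psi, and the inverse aut_Phi of this
    coalgebra automorphism also commutes with the coproduct. *)
Lemma grouplike_circ_inv Psi Phi : grouplike Psi -> Phi gone = 1 ->
  circ gT k Psi Phi = 1 -> circ gT k Phi Psi = 1 -> grouplike Phi.
Proof.
move=> GP Q1 PQ QP; have P1 := grouplike_gone GP; apply: grouplike_intro => //.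
have [AL _ _] := autX_cmor Psi; have [BL _ _] := autX_cmor Phi.
have K : autX Phi \o autX Psi = id.
  by apply/funext => f /=; rewrite -autX_circ // QP autX1.
have E : autX Psi Phi = hinv Psi by apply: hinv_uniq.
rewrite -[LHS]tens_map_id -K -tens_map_comp // -hatDelta_autX // E hatDelta_inv // -E.
by rewrite tens_mapE // -/((autX Phi \o autX Psi) Phi) K.
Qed.

(* xcoef1 is a derivation relative to xcoef0 (xcoef1M); hence it is additive for circ. *)
Definition xcoef0 f : hser k natm := fun n => f (nseq n None : Xm gT).
(** Index 0 is set apart because [x0x1 0] and [x0x1 1] are both the word x_1. *)
Definition xcoef1 f : hser k natm := fun n => if n is 0 then 0 else f (x0x1 gT n).

Let Xdeg (w : seq (option gT)) : gdeg (w : Xm gT) = size w.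
Proof. by rewrite /= /wdeg; elim: w => //= x w ->. Qed.

Lemma xcoef0_clin : clin xcoef0.
Proof.
split=> [a f f'|n f fn c cn]; first by [].
by rewrite /xcoef0 fn // Xdeg size_nseq.
Qed.

Lemma xcoef1_clin : clin xcoef1.
Proof.
split=> [a f f'|n f fn [|c] cn] //.
  by apply/funext => -[|n] //; rewrite hserDE hserE /= mulr0 addr0.
by rewrite /xcoef1 fn // Xdeg size_rcons size_nseq.
Qed.

Lemma xlet_mulE x f y (w : seq (option gT)) :
  (xlet k x * f) (y :: w : Xm gT) = (x == y)%:R * f (w : Xm gT).
Proof.
rewrite [LHS]hmul_monol.
have E v : (gmul ([:: x] : Xm gT) v == y :: w :> Xm gT) = (x == y) && (w == v :> Xm gT).
  by rewrite [w == v]eq_sym.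
under eq_bigr => v _ do rewrite E -mulnb natrM -mulrA.
by rewrite -mulr_sumr big_glow_pick // !Xdeg /= ltnNge leqnSn.
Qed.

Lemma natm_mul1E (s : hser k natm) n :
  (hmono k (1%N : natm) * s) n = if n is n'.+1 then s n' else 0.
Proof.
rewrite [LHS]hmul_monol; case: n => [|n].
  by rewrite big1_seq // => -[|j] //= _; rewrite mul0r.
have E (v : natm) : (gmul (1%N : natm) v == n.+1 :> natm) = (n == v :> natm).
  by rewrite /= add1n eqSS eq_sym.
under eq_bigr => v _ do rewrite E.
by rewrite (big_glow_pick (c := (n : natm))) //= ltnNge leqnSn.
Qed.

Lemma xcoef0_xlet x : xcoef0 (xlet k x) = if x is None then hmono k (1%N : natm) else 0.
Proof.
apply/funext => -[|n]; first by case: x.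
rewrite /xcoef0 -[xlet k x]mulr1 xlet_mulE hser1E /hmono.
by case: x n => [g|] [|n]; rewrite ?mul0r ?mulr1 ?mulr0.
Qed.

Lemma xcoef0_mulx x f : xcoef0 (xlet k x * f) = xcoef0 (xlet k x) * xcoef0 f.
Proof.
rewrite xcoef0_xlet; apply/funext => -[|n].
  rewrite /xcoef0 /= (@hmul_gone k (Xm gT)) // mul0r.
  by case: x => [g|]; rewrite ?natm_mul1E ?mul0r.
by rewrite /xcoef0 /= xlet_mulE; case: x => [g|]; rewrite ?natm_mul1E ?mul1r ?mul0r.
Qed.

Lemma xcoef0_cmor : cmor xcoef0.
Proof.
have e1 : xcoef0 1 = 1 by apply/funext => -[|n].
have eL := xcoef0_clin; apply: cmor_mono => // v w.
rewrite hmonoM; elim: (v : seq _) => [|x u IH]; first by rewrite e1 !mul1r.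
by rewrite hmono_cons -mulrA !xcoef0_mulx IH mulrA.
Qed.

Lemma xcoef1_mulx x f :
  xcoef1 (xlet k x * f) = xcoef0 (xlet k x) * xcoef1 f + f gone *: xcoef1 (xlet k x).
Proof.
have E n : xcoef1 (xlet k x) n.+1 = ((n == 0) && (x == Some 1%g))%:R.
  rewrite /xcoef1 -[xlet k x]mulr1; case: n => [|n].
    by rewrite xlet_mulE hser1E mulr1.
  by rewrite xlet_mulE hser1E; case: n => [|n]; rewrite mulr0.
rewrite xcoef0_xlet; apply/funext => -[|n].
  by rewrite hserDE hserE mulr0 addr0; case: x {E} => [g|]; rewrite ?natm_mul1E ?mul0r.
rewrite hserDE hserE E; case: n => [|n] /=.
  by rewrite xlet_mulE mulrC; case: x {E} => [g|]; rewrite ?natm_mul1E ?mul0r ?add0r.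
by rewrite mulr0 addr0 xlet_mulE; case: x {E} => [g|]; rewrite ?natm_mul1E ?mul0r ?mul1r.
Qed.

(** If x_0^(n-1) x_1 is a product of two words, either the right one is empty or it ends in x_1 and
    the left one is a power of x_0. *)
Lemma xcoef1M f f' : xcoef1 (f * f') = xcoef0 f * xcoef1 f' + f' gone *: xcoef1 f.
Proof.
have [eL e1 eM] := xcoef0_cmor.
move: f; apply: clin_ext => [||w].
- exact: (clin_comp xcoef1_clin (clin_mulr _ clin_id)).
- exact: (clin_add (clin_mulr _ eL) (clin_scale _ xcoef1_clin)).
have l1 : xcoef1 1 = 0 by apply/funext => -[|[|n]].
elim: (w : seq _) => [|x u IH]; first by rewrite mul1r e1 mul1r l1 scaler0 addr0.
rewrite hmono_cons -mulrA [LHS]xcoef1_mulx IH [xcoef1 (_ * _)]xcoef1_mulx eM hmul_gone //.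
by rewrite mulrDr scalerDr scalerA mulrA [f' gone * _]mulrC -hscaleAr addrA.
Qed.

Lemma xcoef0_taut g f : xcoef0 (taut g f) = xcoef0 f.
Proof.
move: f; apply: (cmor_ext (cmor_comp xcoef0_cmor (taut_cmor g)) xcoef0_cmor) => x /=.
by rewrite taut_let !xcoef0_xlet; case: x.
Qed.

Lemma xcoef0_autX Psi f : xcoef0 (autX Psi f) = xcoef0 f.
Proof.
have [_ _ eM] := xcoef0_cmor.
move: f; apply: (cmor_ext (cmor_comp xcoef0_cmor (autX_cmor Psi)) xcoef0_cmor) => x /=.
rewrite autX_let; case: x => // g.
by rewrite !eM !(xcoef0_xlet (Some g)) mulr0 mul0r.
Qed.

(** Only words x_0^j x_1 matter. The factor t_1(Psi^(-1)) placed before x_1 contributes through its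
    powers of x_0, the factor placed after it through its constant term 1. *)
Lemma xcoef1_autX Psi f : Psi gone = 1 ->
  xcoef1 (autX Psi f) = hinv (xcoef0 Psi) * xcoef1 f.
Proof.
move=> P1; have [AL A1 aM] := autX_cmor Psi; have [_ _ eM] := xcoef0_cmor.
move: f; apply: clin_ext => [||w].
- exact: clin_comp xcoef1_clin AL.
- exact: clin_mull xcoef1_clin.
have l1 : xcoef1 1 = 0 by apply/funext => -[|[|n]].
elim: (w : seq _) => [|x u IH]; first by rewrite A1 l1 mulr0.
rewrite hmono_cons aM xcoef1M IH xcoef1_mulx xcoef0_autX mulrDr -hscaleAr.
rewrite (cmor_gone _ Xm_connected (autX_cmor Psi)); congr (_ + _ *: _).
  by rewrite !mulrA; congr (_ * _); apply/funext => n; rewrite !hserME /hmul exchange_big;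
     apply: eq_bigr => i _; apply: eq_bigr => j _; rewrite [gmul _ _]addnC [xcoef0 _ _ * _]mulrC.
rewrite [autX _ _]autX_let; case: x => [g|].
  rewrite !xcoef1M eM [xcoef0 (xlet _ _)]xcoef0_xlet mulr0 mul0r add0r taut_gone P1 scale1r.
  rewrite (_ : xlet k (Some g) gone = 0) //.
  by rewrite scale0r addr0 xcoef0_taut (cmor_hinv _ _ xcoef0_cmor).
have -> : xcoef1 (xlet k (None : option gT)) = 0 by apply/funext => -[|[|[|n]]].
by rewrite mulr0.
Qed.

(** The factor [xcoef0 Psi] from the product rule cancels the inverse factor from [xcoef1_autX];
    this makes the exponent of Gamma additive. *)
Lemma xcoef1_circ Psi Phi : Psi gone = 1 -> Phi gone = 1 ->
  xcoef1 (circ gT k Psi Phi) = xcoef1 Psi + xcoef1 Phi.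
Proof.
move=> P1 Q1; rewrite /circ xcoef1M xcoef1_autX // mulrA hinvr //.
by rewrite mul1r (cmor_gone _ Xm_connected (autX_cmor Psi)) Q1 scale1r addrC.
Qed.
End XSide.
#[global] Hint Resolve Xm_connected natm_connected : core.

Section GammaMorphism.
Variables (k : comQAlg) (gT : finGroupType).
Implicit Types Psi Phi : Xser gT k.

Definition lnGamma Psi : hser k natm := fun n =>
  if (2 <= n)%N then qstr ((-1) ^+ n.-1 / n%:R) * Psi (x0x1 gT n) else 0.

Lemma lnGamma_order Psi : order_ge 1 (lnGamma Psi).
Proof. by case. Qed.

Lemma Gamma_gone Psi : Gamma Psi gone = 1.
Proof. exact: hexp_gone. Qed.

Lemma Gamma1 : Gamma (1 : Xser gT k) = 1.
Proof.
rewrite /Gamma -[RHS]hexp0; congr hexp; apply/funext => -[|[|n]] //=.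
by rewrite mulr0.
Qed.

Lemma Gamma_circ Psi Phi : Psi gone = 1 -> Phi gone = 1 ->
  Gamma (circ gT k Psi Phi) = Gamma Psi * Gamma Phi.
Proof.
move=> P1 Q1; rewrite /Gamma -hexpD; try exact: lnGamma_order.
congr hexp; apply/funext => -[|[|n]] /=; rewrite hserDE ?addr0 //= -mulrDr.
by congr (_ * _); have := congr1 (fun s : hser k natm => s n.+2) (xcoef1_circ P1 Q1).
Qed.
End GammaMorphism.

(** * The action on V and M *)

Section VSide.
Variables (k : comPzRingType) (gT : finGroupType).
Local Notation X := (Xser gT k).
Local Notation V := (Vhat k gT).
Implicit Types (Psi Phi : X) (g h : gT).

Lemma vgrp1 : vgrp k (1%g : gT) = 1. Proof. by []. Qed.
Lemma vgrpM g h : vgrp k (g * h)%g = vgrp k g * vgrp k h.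
Proof. by rewrite /vgrp -hmonoM. Qed.
Lemma vgrpV g : vgrp k g * vgrp k g^-1%g = 1.
Proof. by rewrite -vgrpM mulgV. Qed.
Lemma vgrpVl g : vgrp k g^-1%g * vgrp k g = 1.
Proof. by rewrite -vgrpM mulVg. Qed.
Lemma vgrp_e0 g : vgrp k g * ve0 = ve0 * vgrp k g.
Proof. by rewrite -!hmonoM; congr hmono; rewrite /= mul1g mulg1. Qed.
Lemma ve0_order : order_ge 1 (ve0 : V).
Proof. exact: (order_ge_mono k (([:: None], 1%g) : Vm gT)). Qed.
Lemma ve1_order : order_ge 1 (ve1 : V).
Proof. exact: (order_ge_mono k (([:: Some 1%g], 1%g) : Vm gT)). Qed.
Hint Resolve ve0_order ve1_order : core.

Definition vlet (x : option gT) : V := vletter ve0 ve1 (vgrp k) x.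

Lemma vlet_hmono x : vlet x = hmono k (([:: x], 1%g) : Vm gT).
Proof.
by case: x => [h|] //; rewrite /vlet /= -!hmonoM; congr hmono; rewrite /= !mulg1 mulgV.
Qed.

Lemma vmono_cons x (w : seq (option gT)) g :
  hmono k ((x :: w, g) : Vm gT) = vlet x * hmono k ((w, g) : Vm gT).
Proof. by rewrite vlet_hmono -hmonoM Vm_mul1l. Qed.

Lemma cmor_Vext N (F G : V -> hser k N) : cmor F -> cmor G ->
  F ve0 = G ve0 -> F ve1 = G ve1 -> (forall g, F (vgrp k g) = G (vgrp k g)) -> F =1 G.
Proof.
move=> [FL F1 FM] [GL G1 GM] e0 e1 eg; apply: clin_ext => // -[w g].
elim: w => [|x w IH]; first exact: eg.
rewrite vmono_cons FM GM IH; congr (_ * _).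
by case: x => [h|] //; rewrite /vlet /= !FM !GM !eg e1.
Qed.

Section Valg.
Variables (N : gmonoid) (E0 E1 : hser k N) (Gr : gT -> hser k N).
Hypotheses (E0_order : order_ge 1 E0) (E1_order : order_ge 1 E1).
Hypotheses (Gr1 : Gr 1%g = 1) (GrM : forall g h, Gr (g * h)%g = Gr g * Gr h).
Hypothesis GrE0 : forall g, Gr g * E0 = E0 * Gr g.

Lemma valg_ext_cmor : cmor (valg_ext E0 E1 Gr).
Proof.
split; [exact/clin_hext/vmonomial_filtered | exact: valg_ext1 |].
exact: valg_extM.
Qed.
End Valg.

Lemma beta1_order (x : option gT) : order_ge 1
  (if x is Some g then - (vgrp k g * ve1 * vgrp k g^-1%g) else ve0).
Proof.
by case: x => [g|] //; apply/order_geN/order_geMr/order_geMl.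
Qed.

Lemma beta1_cmor : cmor (beta1 (k := k) (gT := gT)).
Proof. by apply: alg_ext_cmor => x; apply: beta1_order. Qed.

Lemma beta1_let (x : option gT) : beta1 (xlet k x) =
  if x is Some g then - (vgrp k g * ve1 * vgrp k g^-1%g) else ve0.
Proof. by apply: alg_ext_letter => y; apply: beta1_order. Qed.

(** Through beta the outer automorphism t_g of the free algebra becomes inner. *)
Lemma beta1_taut g (f : X) : beta1 (taut g f) = vgrp k g * beta1 f * vgrp k g^-1%g.
Proof.
have [bL b1 bM] := beta1_cmor.
have C : cmor (fun f : X => vgrp k g * beta1 f * vgrp k g^-1%g).
  split; first by apply: clin_mulr; apply: clin_mull.
    by rewrite b1 mulr1 vgrpV.
  by move=> f1 f2; rewrite bM !mulrA -[_ * vgrp k g^-1%g * _]mulrA vgrpVl mulr1.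
move: f; apply: (cmor_ext (cmor_comp beta1_cmor (taut_cmor k g)) C) => x /=.
rewrite taut_let !beta1_let; case: x => [h|] /=; last by rewrite vgrp_e0 -mulrA vgrpV mulr1.
by rewrite mulrN mulNr invMg !vgrpM !mulrA.
Qed.

Lemma beta1_inv Psi : Psi gone = 1 -> beta1 Psi * beta1 (hinv Psi) = 1.
Proof. by move=> P1; apply: (cmor_inv beta1_cmor); apply: hinvr. Qed.
Lemma beta1_invl Psi : Psi gone = 1 -> beta1 (hinv Psi) * beta1 Psi = 1.
Proof. by move=> P1; apply: (cmor_inv beta1_cmor); apply: hinvl. Qed.

Section AutV.
Variable Psi : X.
Let E1 : V := beta1 (hinv Psi) * ve1 * beta1 Psi.
Let E1_order : order_ge 1 E1. Proof. exact/order_geMr/order_geMl. Qed.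

Lemma autV_cmor : cmor (autV Psi).
Proof. exact: (valg_ext_cmor ve0_order E1_order vgrp1 vgrpM vgrp_e0). Qed.
Lemma autV_e0 : autV Psi ve0 = ve0.
Proof. exact: (valg_ext_e0 ve0_order E1_order vgrp1). Qed.
Lemma autV_e1 : autV Psi ve1 = beta1 (hinv Psi) * ve1 * beta1 Psi.
Proof. exact: (valg_ext_e1 ve0_order E1_order vgrp1). Qed.
Lemma autV_grp g : autV Psi (vgrp k g) = vgrp k g.
Proof. exact: (valg_ext_grp (vgrp k) ve0_order E1_order). Qed.
End AutV.

(** Since [autV Psi] fixes G, it commutes with conjugation by g, that is with t_g; comparing the
    images of the x_g is then enough. *)
Lemma autV_beta1 Psi f : autV Psi (beta1 f) = beta1 (autX Psi f).
Proof.
have AM := autV_cmor Psi; have [aL _ aM] := AM; have [_ _ bM] := beta1_cmor.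
move: f; apply: (cmor_ext (cmor_comp AM beta1_cmor)
  (cmor_comp beta1_cmor (autX_cmor Psi))) => -[g|] /=.
  rewrite beta1_let (clinN aL) !aM !autV_grp autV_e1 autX_let !bM !beta1_taut beta1_let.
  rewrite mulrN mulNr; congr (- _).
  by rewrite !mulrA -[_ * vgrp k g^-1%g * vgrp k g]mulrA vgrpVl mulr1
    -[_ * vgrp k g^-1%g * vgrp k g]mulrA vgrpVl mulr1.
by rewrite beta1_let autX_let beta1_let autV_e0.
Qed.

Lemma autV_circ Psi Phi v : Psi gone = 1 -> Phi gone = 1 ->
  autV (circ gT k Psi Phi) v = autV Psi (autV Phi v).
Proof.
move=> P1 Q1; have [_ _ bM] := beta1_cmor; have [_ _ aM] := autV_cmor Psi.
have AM := autX_cmor Psi; have A1 := cmor_gone Phi (@Xm_connected gT) AM.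
move: v; apply: (cmor_Vext (autV_cmor _) (cmor_comp (autV_cmor Psi) (autV_cmor Phi))) => [||g] /=.
- by rewrite !autV_e0.
- rewrite !autV_e1 !aM autV_e1 !autV_beta1 /circ bM hinvM ?A1 ?Q1 // bM.
  by rewrite (cmor_hinv _ _ AM) // !mulrA.
- by rewrite !autV_grp.
Qed.

Lemma beta11 : beta1 (1 : X) = 1. Proof. by case: beta1_cmor. Qed.

Lemma autV1 v : autV (1 : X) v = v.
Proof.
move: v; apply: (cmor_Vext (autV_cmor _) (cmor_id k (Vm gT))) => [||g] /=.
- exact: autV_e0.
- by rewrite autV_e1 hinv1 // beta11 mul1r mulr1.
- exact: autV_grp.
Qed.

Local Notation proj := (@projM k gT).

Lemma xword_deg g (u : seq (nat * gT)) : size (xword g u) = gdeg (u : Zm gT).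
Proof.
elim: u g => [|[m h] u IH] g //=.
by rewrite size_cat size_nseq /= IH addnS.
Qed.

Lemma Vm_deg (w : seq (option gT)) g : gdeg ((w, g) : Vm gT) = size w.
Proof. by rewrite /= /wdeg; elim: w => //= x w ->. Qed.

Lemma projM_clin : clin proj.
Proof.
split=> [a f f'|n f fn u un]; last first.
  rewrite /projM big1 ?mulr0 // => g _; apply: fn.
  by rewrite Vm_deg xword_deg.
apply/funext => u; rewrite hserDE hserE /projM mulrCA -mulrDr [a * _]mulr_sumr -big_split.
by congr (_ * _); apply: eq_bigr.
Qed.

Lemma iotaW_order (z : Zalph gT) :
  order_ge (weight z) (- (ve0 ^+ z.1 * vgrp k z.2 * ve1) : V).
Proof.
apply: order_geN; rewrite -[weight z]/(z.1.+1) -addn1.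
by apply: order_geM => //; apply/order_geMr/order_geX.
Qed.

Lemma iotaW_cmor : cmor (@iotaW k gT).
Proof. exact/alg_ext_cmor/iotaW_order. Qed.

Lemma projM_ideal v f : proj f = 0 -> proj (v * f) = 0.
Proof.
move=> /projM_eq0 [a [b ->]]; apply/projM_eq0; exists (v * a), (fun g => v * b g).
by rewrite mulrDr mulrA mulr_sumr; congr (_ + _); apply: eq_bigr => g _; rewrite mulrA.
Qed.

(** The kernel is the left ideal generated by e_0 and the g - 1, all fixed by [autV Psi]. *)
Lemma projM_autV Psi f : proj f = 0 -> proj (autV Psi f) = 0.
Proof.
move=> /projM_eq0 [a [b ->]]; have [aL a1 aM] := autV_cmor Psi.
apply/projM_eq0; exists (autV Psi a), (fun g => autV Psi (b g)).
rewrite (clinD aL) (clin_sum aL) aM autV_e0; congr (_ + _); apply: eq_bigr => g _.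
by rewrite aM (clinB aL) a1 autV_grp.
Qed.

Lemma projM_iotaK m : proj (iotaW m) = m.
Proof. exact: w1M_id. Qed.

(** Maps of M^ are defined through the section [iotaW]; if F preserves the kernel, any other
    representative gives the same class, which makes such maps computable on V^. *)
Lemma projM_factor (F : V -> V) v : clin F -> (forall f, proj f = 0 -> proj (F f) = 0) ->
  proj (F (iotaW (proj v))) = proj (F v).
Proof.
move=> FL F0; apply/eqP; rewrite -subr_eq0 -(clinB projM_clin) -(clinB FL); apply/eqP/F0.
by rewrite (clinB projM_clin) projM_iotaK subrr.
Qed.

Lemma lmulM_proj v f : lmulM v (proj f) = proj (v * f).
Proof.
apply: (projM_factor (F := fun f => v * f)); first exact: clin_mull clin_id.
by move=> f'; apply: projM_ideal.
Qed.

Lemma autM_proj Psi f : autM Psi (proj f) = proj (beta1 Psi * autV Psi f).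
Proof.
have [aL _ _] := autV_cmor Psi.
apply: (projM_factor (F := fun f => beta1 Psi * autV Psi f)); first exact: clin_mull.
by move=> f' f0; apply/projM_ideal/projM_autV.
Qed.

Lemma zlet_order m g : order_ge m.+1 (zlet k (m, g) : What k gT).
Proof.
have := order_ge_mono k ([:: (m, g)] : Zm gT).
by rewrite -[gdeg _]/((m.+1 + 0)%N) addn0.
Qed.

Lemma DeltaW_order (z : Zalph gT) : order_ge (weight z)
  (tens (zlet k z) 1 + tens 1 (zlet k z) +
    \sum_(i < z.1) \sum_(h : gT)
      tens (zlet k (i : nat, h)) (zlet k ((z.1 - i.+1)%N, (z.2 * h^-1)%g))).
Proof.
case: z => m g; rewrite -[weight _]/m.+1 /=; apply: order_geD.
  by apply: order_geD; [apply: tens_orderl | apply: tens_orderr];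
     apply: zlet_order.
apply: order_ge_sum => i _; apply: order_ge_sum => h _.
(* The letter [(i, h)] is z_{i+1,h}, so the two weights add up to m + 1. *)
have -> : m.+1 = (i.+1 + (m - i.+1).+1)%N by rewrite addnS subnKC.
by apply: tens_order; apply: zlet_order.
Qed.

Lemma DeltaW_cmor : cmor (@DeltaW gT k).
Proof. exact/alg_ext_cmor/DeltaW_order. Qed.

Lemma DeltaW_let (z : Zalph gT) : DeltaW (zlet k z) = tens (zlet k z) 1 + tens 1 (zlet k z) +
    \sum_(i < z.1) \sum_(h : gT)
      tens (zlet k (i : nat, h)) (zlet k ((z.1 - i.+1)%N, (z.2 * h^-1)%g)).
Proof. exact/alg_ext_letter/DeltaW_order. Qed.

Lemma DeltaM_clin : clin (@DeltaM gT k).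
Proof. by case: DeltaW_cmor. Qed.
End VSide.
#[global] Hint Resolve ve0_order ve1_order : core.

(** * The stabilizer is a group *)

Section StabGroup.
Variables (k : comQAlg) (gT : finGroupType).
Local Notation V := (Vhat k gT).
Implicit Types Psi Phi : Xser gT k.

Let ve1N_order : order_ge 1 (- ve1 : V). Proof. exact: order_geN. Qed.

Lemma GautM_proj Psi (f : V) : GautM Psi (projM f) =
  projM (heval (hinv (Gamma Psi)) (- ve1) * (beta1 Psi * autV Psi f)).
Proof. by rewrite /GautM autM_proj lmulM_proj. Qed.

Lemma GautM_clin Psi : clin (GautM Psi).
Proof.
have [iL _ _] := iotaW_cmor k gT; have [aL _ _] := autV_cmor Psi.
have pL := projM_clin k gT.
apply: (clin_comp pL); apply: clin_mull; apply: (clin_comp iL).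
exact: (clin_comp pL (clin_mull _ (clin_comp aL iL))).
Qed.

(** Pushing Gamma_Phi^(-1)(-e_1) through [autV Psi] conjugates it by beta(Psi). The prefactor
    beta(Psi) absorbs the left conjugator, so the two Gamma factors become adjacent, and the right
    conjugator is the prefactor needed for the product. *)
Lemma GautM_circ Psi Phi m : Psi gone = 1 -> Phi gone = 1 ->
  GautM (circ gT k Psi Phi) m = GautM Psi (GautM Phi m).
Proof.
move=> P1 Q1; have AM := autV_cmor Psi; have [aL _ aM] := AM; have [_ _ bM] := beta1_cmor k gT.
rewrite -[m]projM_iotaK !GautM_proj !aM; congr (projM _).
rewrite autV_circ // autV_beta1 [X in beta1 X * _]/circ bM.
rewrite (heval_morph _ AM) // (clinN aL) autV_e1.
have -> : - (beta1 (hinv Psi) * ve1 * beta1 Psi) =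
    beta1 (hinv Psi) * (- ve1) * beta1 Psi by rewrite mulrN mulNr.
rewrite heval_conj ?beta1_inv ?beta1_invl // !mulrA; congr (_ * _).
rewrite -[_ * beta1 Psi * beta1 (hinv Psi)]mulrA beta1_inv // mulr1.
have [_ _ hM] := heval_cmor ve1N_order; rewrite -hM; congr (heval _ _ * _ * _).
by rewrite Gamma_circ // hinvM ?Gamma_gone // natm_mulC.
Qed.

Lemma GautM1 m : GautM (1 : Xser gT k) m = m.
Proof.
have [_ h1 _] := heval_cmor ve1N_order.
rewrite -[m]projM_iotaK GautM_proj Gamma1 hinv1 // h1 mul1r beta11 mul1r.
by rewrite autV1.
Qed.

Lemma Stab_gone Psi : Stab gT k Psi -> Psi gone = 1.
Proof. by case=> /grouplike_gone. Qed.

Lemma Stab1 : Stab gT k 1.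
Proof.
split=> [|m]; first exact: grouplike1.
have -> : GautM (1 : Xser gT k) = id by apply/funext => m'; apply: GautM1.
exact: tens_map_id.
Qed.

Lemma Stab_circ Psi Phi : Stab gT k Psi -> Stab gT k Phi -> Stab gT k (circ gT k Psi Phi).
Proof.
move=> [GP SP] [GQ SQ]; split=> [|m]; first exact: grouplike_circ.
have P1 := grouplike_gone GP; have Q1 := grouplike_gone GQ.
have -> : GautM (circ gT k Psi Phi) = GautM Psi \o GautM Phi.
  by apply/funext => m'; apply: GautM_circ.
by rewrite -tens_map_comp ?SQ ?SP //; exact: GautM_clin.
Qed.

Lemma Stab_inv Psi Phi : Stab gT k Psi -> Phi gone = 1 ->
  circ gT k Psi Phi = 1 -> circ gT k Phi Psi = 1 -> Stab gT k Phi.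
Proof.
move=> [GP SP] Q1 PQ QP; split=> [|m]; first exact: (grouplike_circ_inv GP).
have P1 := grouplike_gone GP.
have K : GautM Phi \o GautM Psi = id.
  by apply/funext => m' /=; rewrite -GautM_circ // QP GautM1.
have K' m' : GautM Psi (GautM Phi m') = m' by rewrite -GautM_circ // PQ GautM1.
(* Write m as [GautM Psi (GautM Phi m)], use the equation for Psi, then undo [GautM Psi] in both
   tensor factors. *)
rewrite -{1}[m]K' -SP tens_map_comp; try exact: GautM_clin.
by rewrite K tens_map_id.
Qed.

Lemma Stab_group : is_group (Stab gT k) (circ gT k) 1.
Proof.
split=> [||P Q R /Stab_gone P1 /Stab_gone Q1 _|P _|P SP].
- exact: Stab1.
- exact: Stab_circ.
- exact: circA.
- by rewrite circ1l circ1r.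
have [Q [Q1 PQ QP]] := circ_inv (Stab_gone SP).
by exists Q; split=> //; apply: (Stab_inv SP).
Qed.
End StabGroup.

(** * Change of the base ring *)

Section Hmap.
Variables (A B : comPzRingType) (M : gmonoid) (f : {rmorphism A -> B}).
Implicit Types x y : hser A M.

Fact hmap_zmod : zmod_morphism (@hmap A B M f).
Proof. by move=> x y; apply/funext => b; rewrite /hmap hserBE rmorphB. Qed.

Fact hmap_monoid : monoid_morphism (@hmap A B M f).
Proof.
split=> [|x y]; apply/funext => b; first by rewrite /hmap !hser1E rmorph_nat.
rewrite /hmap !hserME /hmul rmorph_sum; apply: eq_bigr => c _.
by rewrite rmorph_sum; apply: eq_bigr => d _; rewrite !rmorphM rmorph_nat.
Qed.

HB.instance Definition _ := GRing.isZmodMorphism.Build (hser A M) (hser B M)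
  (@hmap A B M f) hmap_zmod.
HB.instance Definition _ := GRing.isMonoidMorphism.Build (hser A M) (hser B M)
  (@hmap A B M f) hmap_monoid.

Lemma hmapD x y : hmap f (x + y) = hmap f x + hmap f y. Proof. exact: rmorphD. Qed.
Lemma hmapB x y : hmap f (x - y) = hmap f x - hmap f y. Proof. exact: rmorphB. Qed.
Lemma hmapN x : hmap f (- x) = - hmap f x. Proof. exact: rmorphN. Qed.
Lemma hmapM x y : hmap f (x * y) = hmap f x * hmap f y. Proof. exact: rmorphM. Qed.
Lemma hmap1 : hmap f (1 : hser A M) = 1. Proof. exact: rmorph1. Qed.
Lemma hmap0 : hmap f (0 : hser A M) = 0. Proof. exact: rmorph0. Qed.
Lemma hmapX x n : hmap f (x ^+ n) = hmap f x ^+ n. Proof. exact: rmorphXn. Qed.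
Lemma hmap_sum I (r : seq I) (P : pred I) (E : I -> hser A M) :
  hmap f (\sum_(i <- r | P i) E i) = \sum_(i <- r | P i) hmap f (E i).
Proof. exact: rmorph_sum. Qed.
Lemma hmap_prod I (r : seq I) (P : pred I) (E : I -> hser A M) :
  hmap f (\prod_(i <- r | P i) E i) = \prod_(i <- r | P i) hmap f (E i).
Proof. exact: rmorph_prod. Qed.

Lemma hmap_mono b : hmap f (hmono A b) = hmono B b :> hser B M.
Proof. by apply/funext => c; rewrite /hmap /hmono rmorph_nat. Qed.

Lemma hmapZ a x : hmap f (a *: x) = f a *: hmap f x.
Proof. by apply/funext => c; rewrite hserE /hmap hserE rmorphM. Qed.

Lemma hmap_hinv x : hmap f (hinv x) = hinv (hmap f x).
Proof.
apply/funext => b; rewrite /hmap /hinv rmorph_sum; apply: eq_bigr => j _.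
by rewrite -[f _]/(hmap f ((1 - x) ^+ j) b) hmapX hmapB hmap1.
Qed.

Lemma hmap_hext N (phi : M -> hser A N) x :
  hmap f (hext phi x) = hext (fun b => hmap f (phi b)) (hmap f x).
Proof.
apply/funext => c; rewrite /hmap /hext rmorph_sum; apply: eq_bigr => b _.
by rewrite rmorphM.
Qed.

Lemma hmap_tens N x (y : hser A N) : hmap f (tens x y) = tens (hmap f x) (hmap f y).
Proof. by apply/funext => p; rewrite /hmap /tens rmorphM. Qed.
End Hmap.

Section HmapTens.
Variables (A B : comPzRingType) (f : {rmorphism A -> B}).

Lemma hmap_tens_map M M' N N' (F : hser A M -> hser A N) (F' : hser A M' -> hser A N')
    (G : hser B M -> hser B N) (G' : hser B M' -> hser B N') x :
  (forall y, hmap f (F y) = G (hmap f y)) -> (forall y, hmap f (F' y) = G' (hmap f y)) ->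
  hmap f (tens_map F F' x) = tens_map G G' (hmap f x).
Proof.
move=> FG FG'; rewrite /tens_map hmap_hext; congr (hext _ _); apply/funext => p.
by rewrite hmap_tens FG FG' !hmap_mono.
Qed.

Lemma hmap_alg_ext (L : alphabet) N (phi : L -> hser A N) x :
  hmap f (alg_ext phi x) = alg_ext (fun a => hmap f (phi a)) (hmap f x).
Proof.
rewrite /alg_ext hmap_hext; congr (hext _ _); apply/funext => w.
exact: hmap_prod.
Qed.

Lemma hmap_heval M c (v : hser A M) : hmap f (heval c v) = heval (hmap f c) (hmap f v).
Proof.
rewrite /heval hmap_hext; congr (hext _ _); apply/funext => n.
by rewrite hmapX.
Qed.
End HmapTens.

Section Naturality.
Variables (A B : comPzRingType) (f : {rmorphism A -> B}) (gT : finGroupType).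
Implicit Types (Psi : Xser gT A) (g : gT).

Lemma hmap_xlet (x : option gT) : hmap f (xlet A x) = xlet B x.
Proof. exact: hmap_mono. Qed.

Lemma hmap_hatDelta Psi : hmap f (hatDelta Psi) = hatDelta (hmap f Psi).
Proof.
rewrite /hatDelta hmap_alg_ext; congr (alg_ext _ _); apply/funext => x.
by rewrite hmapD !hmap_tens !hmap_xlet hmap1.
Qed.

Lemma hmap_taut g Psi : hmap f (taut g Psi) = taut g (hmap f Psi).
Proof.
rewrite /taut hmap_alg_ext; congr (alg_ext _ _); apply/funext => x.
exact: hmap_xlet.
Qed.

Lemma hmap_autX Psi x : hmap f (autX Psi x) = autX (hmap f Psi) (hmap f x).
Proof.
rewrite /autX hmap_alg_ext; congr (alg_ext _ _); apply/funext => -[g|].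
  by rewrite !hmapM !hmap_taut hmap_hinv hmap_xlet.
exact: hmap_xlet.
Qed.

Lemma hmap_circ Psi Phi :
  hmap f (circ gT A Psi Phi) = circ gT B (hmap f Psi) (hmap f Phi).
Proof. by rewrite /circ hmapM hmap_autX. Qed.

Lemma hmap_vgrp g : hmap f (vgrp A g) = vgrp B g.
Proof. exact: hmap_mono. Qed.
Lemma hmap_ve0 : hmap f ve0 = ve0 :> Vhat B gT.
Proof. exact: hmap_mono. Qed.
Lemma hmap_ve1 : hmap f ve1 = ve1 :> Vhat B gT.
Proof. exact: hmap_mono. Qed.

Lemma hmap_beta1 Psi : hmap f (beta1 Psi) = beta1 (hmap f Psi).
Proof.
rewrite /beta1 hmap_alg_ext; congr (alg_ext _ _); apply/funext => -[g|].
  by rewrite hmapN !hmapM !hmap_vgrp hmap_ve1.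
exact: hmap_ve0.
Qed.

Lemma hmap_autV Psi v : hmap f (autV Psi v) = autV (hmap f Psi) (hmap f v).
Proof.
rewrite /autV /valg_ext hmap_hext; congr (hext _ _); apply/funext => -[w g].
rewrite /vmonomial /= hmapM hmap_vgrp hmap_prod; congr (_ * _).
apply: eq_bigr => -[h|] _ /=; last exact: hmap_ve0.
by rewrite !hmapM !hmap_vgrp !hmap_beta1 hmap_ve1 hmap_hinv.
Qed.

Lemma hmap_projM (v : Vhat A gT) : hmap f (projM v) = projM (hmap f v).
Proof.
by apply/funext => u; rewrite /hmap /projM rmorphM rmorph_sum rmorphXn rmorphN1.
Qed.

Lemma hmap_iotaW (w : What A gT) : hmap f (iotaW w) = iotaW (hmap f w).
Proof.
rewrite /iotaW hmap_alg_ext; congr (alg_ext _ _); apply/funext => z.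
by rewrite hmapN !hmapM hmapX hmap_vgrp hmap_ve0 hmap_ve1.
Qed.

Lemma hmap_lmulM v m : hmap f (lmulM v m) = lmulM (hmap f v) (hmap f m) :> Mhat B gT.
Proof. by rewrite /lmulM hmap_projM hmapM hmap_iotaW. Qed.

Lemma hmap_autM Psi m : hmap f (autM Psi m) = autM (hmap f Psi) (hmap f m).
Proof. by rewrite /autM hmap_projM hmapM hmap_beta1 hmap_autV hmap_iotaW. Qed.

Lemma hmap_DeltaM (m : Mhat A gT) : hmap f (DeltaM m) = DeltaM (hmap f m).
Proof.
have Z z : hmap f (zlet A z) = zlet B z :> What B gT by exact: hmap_mono.
rewrite /DeltaM /DeltaW hmap_alg_ext; congr (alg_ext _ _); apply/funext => z.
rewrite !hmapD !hmap_tens !Z hmap1 hmap_sum; congr (_ + _).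
apply: eq_bigr => i _; rewrite hmap_sum; apply: eq_bigr => h _.
by rewrite hmap_tens !Z.
Qed.

Lemma hmap_derX psi x : hmap f (derX psi x) = derX (hmap f psi) (hmap f x) :> Xser gT B.
Proof.
rewrite /derX /derX_ext hmap_hext; congr (hext _ _); apply/funext => w.
elim: (w : seq _) => [|y u IH] /=; first exact: hmap0.
rewrite hmapD !hmapM IH hmap_xlet hmap_mono; congr (_ * _ + _).
case: y => [g|]; last exact: hmap0.
by rewrite hmapB !hmapM hmap_taut hmap_xlet.
Qed.

Lemma hmap_derV psi v : hmap f (derV psi v) = derV (hmap f psi) (hmap f v) :> Vhat B gT.
Proof.
rewrite /derV /derV_ext hmap_hext; congr (hext _ _); apply/funext => -[w g] /=.
rewrite hmapM hmap_vgrp; congr (_ * _).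
elim: w => [|y u IH] /=; first exact: hmap0.
rewrite hmapD !hmapM IH !hmap_mono; congr (_ * _ + _).
case: y => [h|]; last exact: hmap0.
by rewrite !hmapM hmapB !hmapM !hmap_vgrp hmap_beta1 hmap_ve1.
Qed.

Lemma hmap_endM psi m : hmap f (endM psi m) = endM (hmap f psi) (hmap f m) :> Mhat B gT.
Proof.
by rewrite /endM hmap_projM hmapD hmapM hmap_derV hmap_beta1 hmap_iotaW.
Qed.
End Naturality.

Section StabNaturality.
Variables (A B : comQAlg) (f : {rmorphism A -> B}) (gT : finGroupType).
Implicit Types (Psi : Xser gT A).

Lemma hmap_hexp s : hmap f (hexp s) = hexp (hmap f s).
Proof.
apply/funext => n; rewrite /hmap /hexp rmorph_sum; apply: eq_bigr => j _.
rewrite rmorphM qstr_morph; congr (_ * _).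
exact: (congr1 (fun h : hser B natm => h n) (hmapX f s j)).
Qed.

Lemma hmap_Gamma Psi : hmap f (Gamma Psi) = Gamma (hmap f Psi).
Proof.
rewrite /Gamma hmap_hexp; congr hexp; apply/funext => n; rewrite /hmap.
by case: ifP => _; rewrite ?rmorph0 // rmorphM qstr_morph.
Qed.

Lemma hmap_GautM Psi m : hmap f (GautM Psi m) = GautM (hmap f Psi) (hmap f m).
Proof.
by rewrite /GautM hmap_lmulM hmap_heval hmap_hinv hmap_Gamma hmapN hmap_ve1 hmap_autM.
Qed.

End StabNaturality.

Section StabEquations.
Variable gT : finGroupType.

(* By continuity, Stab is cut out by equations between coefficients. *)
Lemma StabP (A : comQAlg) (Psi : Xser gT A) : Stab gT A Psi <->
  [/\ Psi gone = 1, hatDelta Psi = tens Psi Psi &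
      forall u : Zm gT, tens_map (GautM Psi) (GautM Psi) (DeltaM (hmono A u))
        = DeltaM (GautM Psi (hmono A u))].
Proof.
split=> [[GP SP]|[P1 DP SP]].
  by split=> [||u]; [exact: grouplike_gone | case: GP | exact: SP].
split=> [|m]; first exact: grouplike_intro.
have GL := GautM_clin Psi; have DL := DeltaM_clin A gT.
move: m; apply: (clin_ext (F := tens_map (GautM Psi) (GautM Psi) \o @DeltaM gT A)) => //.
  by apply: clin_comp => //; apply: tens_map_clin.
exact: clin_comp.
Qed.

Lemma Stab_hmap (A B : comQAlg) (f : {rmorphism A -> B}) Psi :
  Stab gT A Psi -> Stab gT B (hmap f Psi).
Proof.
move=> /StabP [P1 DP SP]; apply/StabP; split=> [||u].
- by rewrite /hmap P1 rmorph1.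
- by rewrite -hmap_hatDelta DP hmap_tens.
have := congr1 (hmap f) (SP u); rewrite hmap_DeltaM hmap_GautM hmap_mono => <-.
rewrite (hmap_tens_map (G := GautM (hmap f Psi)) (G' := GautM (hmap f Psi))) ?hmap_DeltaM ?hmap_mono //;
exact: hmap_GautM.
Qed.

(** All equations of [StabP] compare coefficients in A and are natural in A, so they may be checked
    after a jointly injective family of morphisms. *)
Lemma Stab_reflect (I : Type) (A : comQAlg) (B : I -> comQAlg)
    (f : forall i, {rmorphism A -> B i}) (Psi : Xser gT A) :
  (forall a b, (forall i, f i a = f i b) -> a = b) ->
  (forall i, Stab gT (B i) (hmap (f i) Psi)) -> Stab gT A Psi.
Proof.
move=> f_inj fS; have S i := (StabP _).1 (fS i).
have inj M (x y : hser A M) : (forall i, hmap (f i) x = hmap (f i) y) -> x = y.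
  by move=> xy; apply/funext => b; apply: f_inj => i; have := congr1 (fun h => h b) (xy i).
apply/StabP; split=> [||u].
- by apply: f_inj => i; have [P1 _ _] := S i; rewrite rmorph1; exact: P1.
- by apply: inj => i; have [_ DP _] := S i; rewrite hmap_hatDelta hmap_tens.
apply: inj => i; have [_ _ SP] := S i; rewrite hmap_DeltaM hmap_GautM hmap_mono -SP.
rewrite (hmap_tens_map (G := GautM (hmap (f i) Psi)) (G' := GautM (hmap (f i) Psi))) ?hmap_DeltaM ?hmap_mono //;
exact: hmap_GautM.
Qed.

Lemma Stab_group_functor : is_group_functor (U := fun k : comQAlg => Xser gT k)
  (fun (A B : comQAlg) (f : {rmorphism A -> B}) => hmap f)
  (fun k : comQAlg => Stab gT k) (fun k : comQAlg => circ gT k)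
  (fun k : comQAlg => 1).
Proof.
split=> [A|A B f x|A B f x y _ _|A x _|A B C g f x _] //.
- exact: Stab_group.
- exact: Stab_hmap.
- exact: hmap_circ.
Qed.
End StabEquations.

(** * Tensor products of Q-algebras *)

Section QModule.
Variable A : comQAlg.

(** A copy of A on which [qstr] induces a Q-vector space structure, so that A can be the target of
    bilinear maps. *)
Definition qmod : Type := A.
HB.instance Definition _ := GRing.Zmodule.on qmod.

Fact qmod_scaleA (p q : rat) (x : qmod) :
  qstr p * (qstr q * (x : A)) = qstr (p * q) * (x : A).
Proof. by rewrite mulrA rmorphM. Qed.
Fact qmod_scale1 : left_id 1 (fun (p : rat) (x : qmod) => qstr p * (x : A) : qmod).
Proof. by move=> x; rewrite rmorph1 mul1r. Qed.
Fact qmod_scaleDr : right_distributive (fun (p : rat) (x : qmod) => qstr p * (x : A) : qmod) +%R.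
Proof. by move=> p x y; exact: mulrDr. Qed.
Fact qmod_scaleDl (x : qmod) :
  {morph (fun p : rat => qstr p * (x : A) : qmod) : p q / p + q}.
Proof. by move=> p q; rewrite rmorphD; exact: mulrDl. Qed.
HB.instance Definition _ := GRing.Zmodule_isLmodule.Build rat qmod
  qmod_scaleA qmod_scale1 qmod_scaleDr qmod_scaleDl.
End QModule.

Section TensorProduct.
Variables A B : comQAlg.

Definition qbilinear (V : lmodType rat) (b : A -> B -> V) :=
  (forall y, qlinear (b^~ y)) /\ (forall x, qlinear (b x)).

(** With formal sums identified when no bilinear map separates them, the quotient has the universal
    property of the tensor product over Q built in. *)
Definition tens_eq (s t : seq (A * B)) : bool :=
  `[< forall (V : lmodType rat) (b : A -> B -> V), qbilinear b ->
      \sum_(p <- s) b p.1 p.2 = \sum_(p <- t) b p.1 p.2 >].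

Fact tens_eq_refl : reflexive tens_eq.
Proof. by move=> s; apply/asboolP. Qed.
Fact tens_eq_sym : symmetric tens_eq.
Proof. by move=> s t; apply/asboolP/asboolP => st V b bP; rewrite st. Qed.
Fact tens_eq_trans : transitive tens_eq.
Proof. by move=> s t r /asboolP ts /asboolP sr; apply/asboolP => V b bP; rewrite ts ?sr. Qed.

Definition tens_equiv := EquivRel tens_eq tens_eq_refl tens_eq_sym tens_eq_trans.

Definition tprod : Type := {eq_quot tens_equiv}%qT.
HB.instance Definition _ := gen_eqMixin tprod.
HB.instance Definition _ := gen_choiceMixin tprod.

Definition tclass (s : seq (A * B)) : tprod := (\pi_({eq_quot tens_equiv}) s)%qT.
Definition trepr (x : tprod) : seq (A * B) := generic_quotient.repr (x : {eq_quot tens_equiv}%qT).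
Definition teval (V : lmodType rat) (b : A -> B -> V) (x : tprod) : V :=
  \sum_(p <- trepr x) b p.1 p.2.

Lemma teval_class (V : lmodType rat) (b : A -> B -> V) s : qbilinear b ->
  teval b (tclass s) = \sum_(p <- s) b p.1 p.2.
Proof.
move=> bP; rewrite /teval /trepr /tclass.
have : (generic_quotient.repr (\pi_({eq_quot tens_equiv}) s)%qT = s %[mod {eq_quot tens_equiv}])%qT.
  by rewrite reprK.
by move/eqmodP => /asboolP; apply.
Qed.

Lemma tprodP (x y : tprod) :
  (forall (V : lmodType rat) (b : A -> B -> V), qbilinear b -> teval b x = teval b y) ->
  x = y.
Proof.
move=> xy; rewrite -[x]reprK -[y]reprK; apply/eqmodP/asboolP => V b bP.
exact: xy.
Qed.

Definition tpure a b : tprod := tclass [:: (a, b)].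
Definition tadd (x y : tprod) : tprod := tclass (trepr x ++ trepr y).
Definition topp (x : tprod) : tprod := tclass [seq (- p.1, p.2) | p <- trepr x].
Definition tmul (x y : tprod) : tprod :=
  tclass [seq (p.1 * r.1, p.2 * r.2) | p <- trepr x, r <- trepr y].

Section Qbilinear.
Variables (V : lmodType rat) (b : A -> B -> V).
Hypothesis bP : qbilinear b.

Lemma qbilinearDl x x' y : b (x + x') y = b x y + b x' y.
Proof. by have := bP.1 y 1 x x'; rewrite rmorph1 mul1r scale1r. Qed.
Lemma qbilinearDr x y y' : b x (y + y') = b x y + b x y'.
Proof. by have := bP.2 x 1 y y'; rewrite rmorph1 mul1r scale1r. Qed.
Lemma qbilinear0l y : b 0 y = 0.
Proof. by apply: (addrI (b 0 y)); rewrite -qbilinearDl !addr0. Qed.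
Lemma qbilinear0r x : b x 0 = 0.
Proof. by apply: (addrI (b x 0)); rewrite -qbilinearDr !addr0. Qed.
Lemma qbilinearZl q x y : b (qstr q * x) y = q *: b x y.
Proof. by have := bP.1 y q x 0; rewrite !addr0 qbilinear0l addr0. Qed.
Lemma qbilinearZr q x y : b x (qstr q * y) = q *: b x y.
Proof. by have := bP.2 x q y 0; rewrite !addr0 qbilinear0r addr0. Qed.
Lemma qbilinearNl x y : b (- x) y = - b x y.
Proof. by apply/eqP; rewrite -addr_eq0 -qbilinearDl addNr qbilinear0l. Qed.

Lemma qbilinear_mul x0 y0 : qbilinear (fun x y => b (x * x0) (y * y0)).
Proof.
split=> [y|x] q z z'; first by rewrite mulrDl qbilinearDl -mulrA qbilinearZl.
by rewrite mulrDl qbilinearDr -mulrA qbilinearZr.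
Qed.

Lemma qbilinear_mull x0 y0 : qbilinear (fun x y => b (x0 * x) (y0 * y)).
Proof.
split=> [y|x] q z z'; first by rewrite mulrDr qbilinearDl mulrCA qbilinearZl.
by rewrite mulrDr qbilinearDr mulrCA qbilinearZr.
Qed.
End Qbilinear.

Lemma qbilinear_sum (V : lmodType rat) I (r : seq I) (b : I -> A -> B -> V) :
  (forall i, qbilinear (b i)) -> qbilinear (fun x y => \sum_(i <- r) b i x y).
Proof.
move=> bP; split=> [y|x] q z z'; rewrite scaler_sumr -big_split; apply: eq_bigr => i _.
  exact: (bP i).1.
exact: (bP i).2.
Qed.

Section Eval.
Variables (V : lmodType rat) (b : A -> B -> V).
Hypothesis bP : qbilinear b.

Lemma teval_pure x y : teval b (tpure x y) = b x y.
Proof. by rewrite teval_class // big_seq1. Qed.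
Lemma teval_add x y : teval b (tadd x y) = teval b x + teval b y.
Proof. by rewrite teval_class // big_cat. Qed.
Lemma teval_opp x : teval b (topp x) = - teval b x.
Proof.
rewrite teval_class // big_map -sumrN; apply: eq_bigr => p _.
exact: qbilinearNl.
Qed.
Lemma teval_zero : teval b (tclass [::]) = 0.
Proof. by rewrite teval_class // big_nil. Qed.
Lemma teval_mul x y : teval b (tmul x y) =
  \sum_(p <- trepr x) \sum_(r <- trepr y) b (p.1 * r.1) (p.2 * r.2).
Proof. by rewrite teval_class // big_allpairs_dep. Qed.
(** For fixed y the summands are bilinear evaluations of x, so [tmul], although defined on
    representatives, depends on the class of x only; [teval_mulr] does the same for y. *)
Lemma teval_mull x y : teval b (tmul x y) =
  \sum_(r <- trepr y) teval (fun a c => b (a * r.1) (c * r.2)) x.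
Proof. by rewrite teval_mul exchange_big. Qed.
Lemma teval_mulr x y : teval b (tmul x y) =
  \sum_(p <- trepr x) teval (fun a c => b (p.1 * a) (p.2 * c)) y.
Proof. by rewrite teval_mul. Qed.
End Eval.

Fact taddA : associative tadd.
Proof. by move=> x y z; apply: tprodP => V b bP; rewrite !teval_add // addrA. Qed.
Fact taddC : commutative tadd.
Proof. by move=> x y; apply: tprodP => V b bP; rewrite !teval_add // addrC. Qed.
Fact tadd0 : left_id (tclass [::]) tadd.
Proof. by move=> x; apply: tprodP => V b bP; rewrite !teval_add // teval_zero // add0r. Qed.
Fact taddN : left_inverse (tclass [::]) topp tadd.
Proof.
move=> x; apply: tprodP => V b bP.
by rewrite teval_add // teval_opp // teval_zero // addNr.
Qed.
HB.instance Definition _ := GRing.isZmodule.Build tprod taddA taddC tadd0 taddN.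

Fact tmulC : commutative tmul.
Proof.
move=> x y; apply: tprodP => V b bP; rewrite !teval_mul // exchange_big.
by apply: eq_bigr => p _; apply: eq_bigr => r _; rewrite mulrC [p.2 * _]mulrC.
Qed.
Fact tmulA : associative tmul.
Proof.
move=> x y z; apply: tprodP => V b bP; rewrite teval_mulr // teval_mull //.
under eq_bigr => p _ do (rewrite teval_mul; last exact: qbilinear_mull).
under [RHS]eq_bigr => p _ do (rewrite teval_mul; last exact: qbilinear_mul).
rewrite [RHS]exchange_big; apply: eq_bigr => p _; rewrite [RHS]exchange_big.
by apply: eq_bigr => q _; apply: eq_bigr => r _; rewrite !mulrA.
Qed.
Fact tmul1 : left_id (tpure 1 1) tmul.
Proof.
move=> x; apply: tprodP => V b bP; rewrite teval_mull // /teval; apply: eq_bigr => p _.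
have := teval_pure (qbilinear_mul bP p.1 p.2) 1 1; rewrite /teval !mul1r.
exact.
Qed.
Fact tmulD : left_distributive tmul +%R.
Proof.
move=> x y z; apply: tprodP => V b bP; rewrite teval_mull // (teval_add bP).
rewrite !teval_mull // -big_split; apply: eq_bigr => p _.
exact/teval_add/qbilinear_mul.
Qed.
HB.instance Definition _ := GRing.Zmodule_isComPzRing.Build tprod
  tmulA tmulC tmul1 tmulD.

Lemma tevalD (V : lmodType rat) (b : A -> B -> V) x y : qbilinear b ->
  teval b (x + y) = teval b x + teval b y.
Proof. by move=> bP; exact: teval_add. Qed.
Lemma teval_sum (V : lmodType rat) (b : A -> B -> V) I (r : seq I) (F : I -> tprod) :
  qbilinear b -> teval b (\sum_(i <- r) F i) = \sum_(i <- r) teval b (F i).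
Proof.
move=> bP; elim/big_rec2: _ => [|i x y _ <-]; first exact: teval_zero.
exact: teval_add.
Qed.

Lemma tpureM a a' c c' : tpure a c * tpure a' c' = tpure (a * a') (c * c').
Proof.
apply: tprodP => V b bP; rewrite [LHS]teval_mull //.
under eq_bigr => p _ do (rewrite teval_pure; last exact: qbilinear_mul).
rewrite -[LHS]/(teval (fun x y => b (a * x) (c * y)) (tpure a' c')).
by rewrite !teval_pure //; apply: qbilinear_mull.
Qed.

Fact tpurel_zmod : zmod_morphism (fun a => tpure a 1).
Proof.
move=> x y; apply: tprodP => V b bP; rewrite tevalD // (teval_opp bP) !teval_pure //.
by rewrite qbilinearDl // qbilinearNl.
Qed.
Fact tpurer_zmod : zmod_morphism (fun b => tpure 1 b).
Proof.
move=> x y; apply: tprodP => V b bP; rewrite tevalD // (teval_opp bP) !teval_pure //.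
rewrite qbilinearDr //; congr (_ + _); apply/eqP.
by rewrite -addr_eq0 -qbilinearDr // addNr qbilinear0r.
Qed.
Definition tinl (a : A) : tprod := tpure a 1.
Definition tinr (b : B) : tprod := tpure 1 b.
Fact tinl_monoid : monoid_morphism tinl.
Proof. by split=> // x y; rewrite /tinl tpureM mulr1. Qed.
Fact tinr_monoid : monoid_morphism tinr.
Proof. by split=> // x y; rewrite /tinr tpureM mulr1. Qed.
HB.instance Definition _ := GRing.isZmodMorphism.Build A tprod tinl tpurel_zmod.
HB.instance Definition _ := GRing.isMonoidMorphism.Build A tprod tinl tinl_monoid.
HB.instance Definition _ := GRing.isZmodMorphism.Build B tprod tinr tpurer_zmod.
HB.instance Definition _ := GRing.isMonoidMorphism.Build B tprod tinr tinr_monoid.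

Definition tensQ : comQAlg := @ComQAlg tprod (tinl \o @qstr A)%FUN.

Lemma tinlr a b : tinl a * tinr b = tpure a b.
Proof. by rewrite tpureM mulr1 mul1r. Qed.

Section Lift.
Variables (C : comQAlg) (f : {rmorphism A -> C}) (g : {rmorphism B -> C}).

Lemma lift_qbilinear : qbilinear (fun a b => f a * g b : qmod C).
Proof.
split=> [y|x] q z z'; rewrite rmorphD rmorphM qstr_morph.
  by rewrite mulrDl -mulrA.
by rewrite mulrDr mulrCA.
Qed.

Definition tlift (x : tensQ) : C := teval (fun a b => f a * g b : qmod C) x.

Lemma tliftE x : tlift x = \sum_(p <- trepr x) f p.1 * g p.2.
Proof. by []. Qed.

Fact tlift_zmod : zmod_morphism tlift.
Proof.
move=> x y; rewrite /tlift tevalD; last exact: lift_qbilinear.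
by rewrite (teval_opp lift_qbilinear).
Qed.
Fact tlift_monoid : monoid_morphism tlift.
Proof.
split=> [|x y]; first by rewrite /tlift (teval_pure lift_qbilinear) !rmorph1 mulr1.
rewrite /tlift (teval_mul lift_qbilinear) -/(tlift x) -/(tlift y) !tliftE mulr_suml.
apply: eq_bigr => p _; rewrite mulr_sumr; apply: eq_bigr => r _.
by rewrite !rmorphM mulrACA.
Qed.
HB.instance Definition _ := GRing.isZmodMorphism.Build tensQ C tlift tlift_zmod.
HB.instance Definition _ := GRing.isMonoidMorphism.Build tensQ C tlift tlift_monoid.

Lemma tlift_pure a b : tlift (tpure a b) = f a * g b.
Proof. exact: (teval_pure lift_qbilinear). Qed.
Lemma tlift_inl a : tlift (tinl a) = f a.
Proof. by rewrite tlift_pure rmorph1 mulr1. Qed.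
Lemma tlift_inr b : tlift (tinr b) = g b.
Proof. by rewrite tlift_pure rmorph1 mul1r. Qed.
End Lift.
End TensorProduct.

(** * Representability *)

Section Yoneda.
Variables (U : comQAlg -> Type).
Variable Umap : forall A B : comQAlg, {rmorphism A -> B} -> U A -> U B.
Variables (S : forall A, set (U A)) (mul : forall A, U A -> U A -> U A).
Variable one : forall A, U A.
Hypothesis SG : is_group_functor Umap S mul one.
Variables (H : comQAlg) (theta : forall A : comQAlg, {rmorphism H -> A} -> U A).
Hypotheses (theta_in : forall (A : comQAlg) (phi : {rmorphism H -> A}), S (theta phi))
  (theta_inj : forall (A : comQAlg) (phi psi : {rmorphism H -> A}),
     theta phi = theta psi -> phi =1 psi)
  (theta_ext : forall (A : comQAlg) (phi psi : {rmorphism H -> A}),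
     phi =1 psi -> theta phi = theta psi)
  (theta_surj : forall (A : comQAlg) x, S x -> exists phi : {rmorphism H -> A}, theta phi = x)
  (theta_nat : forall (A B : comQAlg) (f : {rmorphism A -> B}) (phi : {rmorphism H -> A}),
     theta (f \o phi : {rmorphism H -> B})%FUN = Umap f (theta phi)).

Let S_group A : is_group (S (A := A)) (@mul A) (one A). Proof. by case: SG. Qed.
Let S_one A : S (one A). Proof. by case: (S_group A). Qed.
Let S_mul A x y : S x -> S y -> S (mul (A := A) x y).
Proof. by case: (S_group A) => _ M _ _ _; apply: M. Qed.

(** The image of the unit is idempotent, and an idempotent of a group is its unit. *)
Let Umap_one (A B : comQAlg) (f : {rmorphism A -> B}) : Umap f (one A) = one B.
Proof.
case: SG => _ mS mM _ _; have Se := mS _ _ f _ (S_one A).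
have [_ _ mA m1 mV] := S_group B; have [_ _ _ m1A _] := S_group A.
have ee : mul (Umap f (one A)) (Umap f (one A)) = Umap f (one A).
  by rewrite -mM ?(m1A _ (S_one A)).1.
have [y [Sy _ yE]] := mV _ Se.
by rewrite -[LHS](m1 _ Se).1 -yE -mA // ee.
Qed.

(** The comultiplication classifies the product of the two universal points over the tensor square
    of H. *)
Let Delta_ex : exists D : {rmorphism H -> tensQ H H}, theta D =
  mul (theta (@tinl H H : {rmorphism H -> tensQ H H})) (theta (@tinr H H : {rmorphism H -> tensQ H H})).
Proof. exact/theta_surj/S_mul. Qed.
Let D := projT1 (cid Delta_ex).
Let DE := projT2 (cid Delta_ex).
Let eps_ex : exists e : {rmorphism H -> ratQ}, theta e = one ratQ.
Proof. exact/theta_surj/S_one. Qed.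
Let e := projT1 (cid eps_ex).
Let eE := projT2 (cid eps_ex).
(** The antipode classifies the inverse of the universal point, which corresponds to the identity of
    H. *)
Let anti_ex : exists s : {rmorphism H -> H},
  mul (theta (idfun : {rmorphism H -> H})) (theta s) = one H /\
  mul (theta s) (theta (idfun : {rmorphism H -> H})) = one H.
Proof.
have [_ _ _ _ mV] := S_group H.
have [y [Sy y1 y2]] := mV _ (theta_in (idfun : {rmorphism H -> H})).
by have [s sE] := theta_surj Sy; exists s; rewrite sE.
Qed.
Let s := projT1 (cid anti_ex).
Let sE := projT2 (cid anti_ex).

Let conv (A : comQAlg) (f g : {rmorphism H -> A}) : {rmorphism H -> A} :=
  (tlift f g \o D)%FUN.

Let convE (A : comQAlg) (f g : {rmorphism H -> A}) x :
  conv f g x = \sum_(p <- trepr (D x)) f p.1 * g p.2.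
Proof. by []. Qed.

(** Naturality along [tlift f g] carries the defining identity of D to f and g. Since theta is
    injective, each Hopf axiom becomes a group axiom at suitable points. *)
Let theta_conv (A : comQAlg) (f g : {rmorphism H -> A}) :
  theta (conv f g) = mul (theta f) (theta g).
Proof.
case: SG => _ _ mM _ _; rewrite /conv theta_nat DE mM //.
by rewrite -!theta_nat; congr mul; apply: theta_ext => x /=;
  [exact: tlift_inl | exact: tlift_inr].
Qed.

Let qe : {rmorphism H -> H} := (@qstr H \o e)%FUN.
Let qeE : theta qe = one H.
Proof.
by rewrite -(Umap_one (@qstr H : {rmorphism ratQ -> H})) -eE -theta_nat; apply: theta_ext.
Qed.

Let comul x : seq (H * H) := trepr (D x).

Let tens2P (t t' : seq (H * H)) : tclass t = tclass t' -> tens2_eq t t'.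
Proof.
move=> tt V b b1 b2; have bP : qbilinear b by split.
by rewrite -!(teval_class _ bP) tt.
Qed.

Let comulE x : tclass (comul x) = D x.
Proof. by apply: tprodP => V b bP; rewrite teval_class. Qed.

Let tclass_cat (t t' : seq (H * H)) : tclass (t ++ t') = tclass t + tclass t'.
Proof. by apply: tprodP => V b bP; rewrite tevalD // !teval_class // big_cat. Qed.

Let tclass_mul (t t' : seq (H * H)) :
  tclass [seq (p.1 * r.1, p.2 * r.2) | p <- t, r <- t'] = tclass t * tclass t'.
Proof.
apply: tprodP => V b bP; rewrite [RHS]teval_mulr // teval_class // big_allpairs_dep.
rewrite -[RHS]/(\sum_(p <- trepr _) (fun a c => teval (fun a' c' => b (a * a') (c * c')) (tclass t'))
   p.1 p.2) -[RHS]/(teval (fun a c => teval (fun a' c' => b (a * a') (c * c')) (tclass t')) (tclass t)).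
rewrite teval_class; last first.
  by apply: (@qbilinear_sum _ _ _ _ _ (fun p x y => b (x * p.1) (y * p.2))) => p; apply: qbilinear_mul.
by apply: eq_bigr => p _; rewrite teval_class //; apply: qbilinear_mull.
Qed.

Fact yoneda_comul_linear (q : rat) x y : tens2_eq (comul (qstr q * x + y))
  ([seq (qstr q * p.1, p.2) | p <- comul x] ++ comul y).
Proof.
apply: tens2P; rewrite tclass_cat !comulE rmorphD rmorphM qstr_morph -(comulE x).
congr (_ + _); rewrite -[qstr q]/(tclass [:: (qstr q, 1)]) -tclass_mul /= cats0.
by congr tclass; apply: eq_map => p; rewrite mul1r.
Qed.

Fact yoneda_comul_one : tens2_eq (comul 1) [:: (1, 1)].
Proof. by apply: tens2P; rewrite comulE rmorph1. Qed.

Fact yoneda_comul_mul x y : tens2_eq (comul (x * y))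
  [seq (p.1 * r.1, p.2 * r.2) | p <- comul x, r <- comul y].
Proof. by apply: tens2P; rewrite tclass_mul !comulE rmorphM. Qed.

Fact yoneda_comul_assoc x : tens3_eq
  [seq (r.1, r.2, p.2) | p <- comul x, r <- comul p.1]
  [seq (p.1, r.1, r.2) | p <- comul x, r <- comul p.2].
Proof.
(* Coassociativity is associativity of the product of the three universal points over the triple
   tensor product. *)
pose HH := tensQ H H; pose H3 := tensQ H HH.
pose j1 : {rmorphism H -> H3} := @tinl H HH.
pose j2 : {rmorphism H -> H3} := (@tinr H HH \o @tinl H H)%FUN.
pose j3 : {rmorphism H -> H3} := (@tinr H HH \o @tinr H H)%FUN.
have E : conv (conv j1 j2) j3 =1 conv j1 (conv j2 j3).
  by apply: theta_inj; rewrite !theta_conv; have [_ _ -> ] := S_group H3.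
move=> V T T1 T2 T3; rewrite !big_allpairs_dep /=.
have T23 a : qbilinear (T a) by split.
(* The trilinear T is read as a bilinear map on H and the tensor square, where scalars act through
   the left factor [tpure (qstr q) 1]. *)
have TP : qbilinear (fun a (z : HH) => teval (T a) z).
  split=> [z|a] q w w'.
    by rewrite /teval scaler_sumr -big_split; apply: eq_bigr => p _; apply: T1.
  rewrite tevalD //; congr (_ + _); rewrite [LHS]teval_mulr //.
  rewrite -[LHS]/(teval (fun b c => teval (fun b' c' => T a (b * b') (c * c')) w)
     (tpure (qstr q) 1)) teval_pure; last first.
    by apply: (@qbilinear_sum _ _ _ _ _ (fun p x y => T a (x * p.1) (y * p.2))) => p; apply: qbilinear_mul.
  rewrite /teval scaler_sumr; apply: eq_bigr => p _.
  by rewrite (qbilinearZl (T23 a)) mul1r.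
have jE a b c : j1 a * j2 b * j3 c = tpure a (tpure b c : HH).
  rewrite -mulrA -tinlr; congr (_ * _).
  by rewrite -[RHS]/(@tinr H HH (tpure b c)) -tinlr rmorphM.
have := congr1 (teval (fun a (z : HH) => teval (T a) z)) (E x).
rewrite !convE !teval_sum // => EE.
transitivity (\sum_(p <- trepr (D x)) teval (fun a (z : HH) => teval (T a) z)
   (conv j1 j2 p.1 * j3 p.2)).
  apply: eq_bigr => p _; rewrite convE mulr_suml teval_sum //; apply: eq_bigr => r _.
  by rewrite jE !teval_pure.
rewrite EE; apply: eq_bigr => p _; rewrite convE mulr_sumr teval_sum //.
by apply: eq_bigr => r _; rewrite mulrA jE !teval_pure.
Qed.

Fact yoneda_counitl x : \sum_(p <- comul x) qstr (e p.1) * p.2 = x.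
Proof.
have := convE qe idfun x => <-; apply: (theta_inj (psi := idfun)).
by rewrite theta_conv qeE; have [_ _ _ m1 _] := S_group H; rewrite (m1 _ (theta_in _)).1.
Qed.
Fact yoneda_counitr x : \sum_(p <- comul x) p.1 * qstr (e p.2) = x.
Proof.
have := convE idfun qe x => <-; apply: (theta_inj (psi := idfun)).
by rewrite theta_conv qeE; have [_ _ _ m1 _] := S_group H; rewrite (m1 _ (theta_in _)).2.
Qed.
Fact yoneda_antipode_linear (q : rat) x y : s (qstr q * x + y) = qstr q * s x + s y.
Proof. by rewrite rmorphD rmorphM qstr_morph. Qed.
Fact yoneda_antipodel x : \sum_(p <- comul x) s p.1 * p.2 = qstr (e x).
Proof.
have := convE s idfun x => <-; apply: (theta_inj (psi := qe)).
by rewrite theta_conv qeE; have [_ ->] := sE.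
Qed.
Fact yoneda_antipoder x : \sum_(p <- comul x) p.1 * s p.2 = qstr (e x).
Proof.
have := convE idfun s x => <-; apply: (theta_inj (psi := qe)).
by rewrite theta_conv qeE; have [->] := sE.
Qed.

Lemma yoneda_affine_group_scheme : is_affine_group_scheme Umap S mul one.
Proof.
split=> //; exists (HopfQ yoneda_comul_linear yoneda_comul_one yoneda_comul_mul
  yoneda_comul_assoc yoneda_counitl yoneda_counitr yoneda_antipode_linear
  yoneda_antipodel yoneda_antipoder), theta; split=> //.
by move=> A phi psi; exists (conv phi psi); rewrite ?theta_conv.
Qed.
End Yoneda.

(* The representing algebra consists of the polynomial expressions in the coordinates,
   two of which are identified if they take the same value at every point of S. *)
Section CoordinateRing.
Variable I : Type.

Inductive qterm := Tvar of I | Tcst of rat | Tadd of qterm & qterm | Tmul of qterm & qterm.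
HB.instance Definition _ := gen_eqMixin qterm.
HB.instance Definition _ := gen_choiceMixin qterm.

Fixpoint qval (A : comQAlg) (a : I -> A) (t : qterm) : A :=
  match t with
  | Tvar i => a i
  | Tcst q => qstr q
  | Tadd t t' => qval a t + qval a t'
  | Tmul t t' => qval a t * qval a t'
  end.

Variable S : forall A : comQAlg, set (I -> A).

Definition qterm_eq (t t' : qterm) : bool :=
  `[< forall (A : comQAlg) (a : I -> A), S a -> qval a t = qval a t' >].

Fact qterm_eq_refl : reflexive qterm_eq.
Proof. by move=> s; apply/asboolP. Qed.
Fact qterm_eq_sym : symmetric qterm_eq.
Proof. by move=> s t; apply/asboolP/asboolP => st A a aS; rewrite st. Qed.
Fact qterm_eq_trans : transitive qterm_eq.
Proof. by move=> s t r /asboolP ts /asboolP sr; apply/asboolP => A a aS; rewrite ts ?sr. Qed.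
Definition qterm_equiv := EquivRel qterm_eq qterm_eq_refl qterm_eq_sym qterm_eq_trans.

Definition coord : Type := {eq_quot qterm_equiv}%qT.
HB.instance Definition _ := gen_eqMixin coord.
HB.instance Definition _ := gen_choiceMixin coord.

Definition cclass (t : qterm) : coord := (\pi_({eq_quot qterm_equiv}) t)%qT.
Definition crepr (x : coord) : qterm := generic_quotient.repr (x : {eq_quot qterm_equiv}%qT).

Section Points.
Variables (A : comQAlg) (a : I -> A).
Hypothesis aS : S a.
Definition cval (x : coord) : A := qval a (crepr x).
Lemma cval_class t : cval (cclass t) = qval a t.
Proof.
rewrite /cval /crepr /cclass.
have : (generic_quotient.repr (\pi_({eq_quot qterm_equiv}) t)%qT = t
   %[mod {eq_quot qterm_equiv}])%qT by rewrite reprK.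
by move/eqmodP => /asboolP; apply.
Qed.
End Points.

Lemma coordP (x y : coord) :
  (forall (A : comQAlg) (a : I -> A), S a -> cval a x = cval a y) -> x = y.
Proof. by move=> xy; rewrite -[x]reprK -[y]reprK; apply/eqmodP/asboolP. Qed.

Definition cadd x y := cclass (Tadd (crepr x) (crepr y)).
Definition cmul x y := cclass (Tmul (crepr x) (crepr y)).
Definition copp x := cclass (Tmul (Tcst (-1)) (crepr x)).

Section Values.
Variables (A : comQAlg) (a : I -> A).
Hypothesis aS : S a.
Lemma cval_add x y : cval a (cadd x y) = cval a x + cval a y.
Proof. by rewrite cval_class. Qed.
Lemma cval_mul x y : cval a (cmul x y) = cval a x * cval a y.
Proof. by rewrite cval_class. Qed.
Lemma cval_opp x : cval a (copp x) = - cval a x.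
Proof. by rewrite cval_class //= rmorphN rmorph1 mulN1r. Qed.
Lemma cval_cst q : cval a (cclass (Tcst q)) = qstr q.
Proof. by rewrite cval_class. Qed.
End Values.

Fact caddA : associative cadd.
Proof. by move=> x y z; apply: coordP => A a aS; rewrite !cval_add // addrA. Qed.
Fact caddC : commutative cadd.
Proof. by move=> x y; apply: coordP => A a aS; rewrite !cval_add // addrC. Qed.
Fact cadd0 : left_id (cclass (Tcst 0)) cadd.
Proof. by move=> x; apply: coordP => A a aS; rewrite cval_add // cval_cst // rmorph0 add0r. Qed.
Fact caddN : left_inverse (cclass (Tcst 0)) copp cadd.
Proof.
move=> x; apply: coordP => A a aS.
by rewrite cval_add // cval_cst // cval_opp // addNr rmorph0.
Qed.
HB.instance Definition _ := GRing.isZmodule.Build coord caddA caddC cadd0 caddN.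
Fact cmulA : associative cmul.
Proof. by move=> x y z; apply: coordP => A a aS; rewrite !cval_mul // mulrA. Qed.
Fact cmulC : commutative cmul.
Proof. by move=> x y; apply: coordP => A a aS; rewrite !cval_mul // mulrC. Qed.
Fact cmul1 : left_id (cclass (Tcst 1)) cmul.
Proof. by move=> x; apply: coordP => A a aS; rewrite cval_mul // cval_cst // rmorph1 mul1r. Qed.
Fact cmulD : left_distributive cmul +%R.
Proof.
move=> x y z; apply: coordP => A a aS.
by rewrite cval_mul // !(cval_add aS) mulrDl !cval_mul.
Qed.
HB.instance Definition _ := GRing.Zmodule_isComPzRing.Build coord cmulA cmulC cmul1 cmulD.

Definition ccst (q : rat) : coord := cclass (Tcst q).
Fact ccst_zmod : zmod_morphism ccst.
Proof.
move=> p q; apply: coordP => A a aS.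
by rewrite (cval_add aS) (cval_opp aS) !cval_cst // rmorphB.
Qed.
Fact ccst_monoid : monoid_morphism ccst.
Proof.
split=> // p q; apply: coordP => A a aS.
by rewrite (cval_mul aS) !cval_cst // rmorphM.
Qed.
HB.instance Definition _ := GRing.isZmodMorphism.Build rat coord ccst ccst_zmod.
HB.instance Definition _ := GRing.isMonoidMorphism.Build rat coord ccst ccst_monoid.

Definition coordQ : comQAlg := @ComQAlg coord ccst.
Definition cvar (i : I) : coordQ := cclass (Tvar i).

(** Every class is its own term evaluated at the universal point, so the coordinates [cvar] generate
    and determine morphisms. *)
Lemma coord_qval t : cclass t = qval cvar t :> coordQ.
Proof.
elim: t => [i|q|t IH t' IH'|t IH t' IH'] //=; rewrite -IH -IH'; apply: coordP => A a aS.
  by rewrite (cval_add aS) !cval_class.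
by rewrite (cval_mul aS) !cval_class.
Qed.

Lemma coord_ind (A : comQAlg) (phi psi : {rmorphism coordQ -> A}) :
  (forall i, phi (cvar i) = psi (cvar i)) -> phi =1 psi.
Proof.
move=> E x; rewrite -[x]reprK -[(\pi _)%qT]/(cclass (crepr x)) coord_qval.
elim: (crepr x) => [i|q|t IH t' IH'|t IH t' IH'] /=; first exact: E.
- exact: etrans (qstr_morph phi q) (esym (qstr_morph psi q)).
- by rewrite !rmorphD IH IH'.
- by rewrite !rmorphM IH IH'.
Qed.

Section Point.
Variables (A : comQAlg) (a : I -> A).
Hypothesis aS : S a.

(** The proof of [S a] is an argument because evaluation respects classes, and so is known to be a
    morphism, at points of S. *)
Definition cpoint of S a : coordQ -> A := cval a.
Fact cpoint_zmod : zmod_morphism (cpoint aS).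
Proof. by move=> x y; rewrite /cpoint (cval_add aS) (cval_opp aS). Qed.
Fact cpoint_monoid : monoid_morphism (cpoint aS).
Proof.
split=> [|x y]; last exact: cval_mul.
by rewrite /cpoint (cval_cst aS) rmorph1.
Qed.
HB.instance Definition _ := GRing.isZmodMorphism.Build coordQ A (cpoint aS) cpoint_zmod.
HB.instance Definition _ := GRing.isMonoidMorphism.Build coordQ A (cpoint aS) cpoint_monoid.

Lemma cpoint_var i : cpoint aS (cvar i) = a i.
Proof. exact: cval_class. Qed.
End Point.
End CoordinateRing.

Lemma Stab_affine_group_scheme (gT : finGroupType) :
  is_affine_group_scheme (U := fun k : comQAlg => Xser gT k)
    (fun (A B : comQAlg) (f : {rmorphism A -> B}) => hmap f)
    (fun k : comQAlg => Stab gT k) (fun k : comQAlg => circ gT k)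
    (fun k : comQAlg => 1).
Proof.
pose S := fun A : comQAlg => Stab gT A.
(* The universal series: its coefficient at a word is the coordinate indexed by that word. *)
pose u : Xser gT (coordQ S) := cvar S.
have uS : Stab gT (coordQ S) u.
  (* The family consists of the evaluations at all points over all algebras; each sends u to the
     point itself. *)
  apply: (@Stab_reflect gT {A : comQAlg & {a : Xser gT A | S A a}} _ (fun i => projT1 i)
    (fun i => cpoint (proj2_sig (projT2 i)))).
    by move=> x y xy; apply: coordP => A a aS; apply: (xy (existT _ A (exist _ a aS))).
  move=> [A [a aS]] /=; suff -> : hmap (cpoint aS) u = a by [].
  by apply/funext => i; apply: cpoint_var.
apply: (@yoneda_affine_group_scheme _ _ _ _ _ (Stab_group_functor gT) (coordQ S)
  (fun A (phi : {rmorphism coordQ S -> A}) => hmap phi u)).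
- by move=> A phi; apply: Stab_hmap.
- by move=> A phi psi E; apply: coord_ind => i; have := congr1 (fun h : Xser gT A => h i) E.
- by move=> A phi psi E; apply/funext => i; apply: E.
- move=> A a aS; exists (cpoint aS); apply/funext => i; exact: cpoint_var.
- by [].
Qed.

(** * The Lie algebra *)

Section DualNumbers.

Definition dual_coef1 (p : dualQ) : rat :=
  ((p : {poly %/ ('X^2 : {poly rat})}) : {poly rat})`_1.

Lemma dual_coef1B p q : dual_coef1 (p - q) = dual_coef1 p - dual_coef1 q.
Proof. by rewrite /dual_coef1 coefB. Qed.

Lemma dual_augE p : dual_aug p = ((p : {poly %/ ('X^2 : {poly rat})}) : {poly rat})`_0.
Proof. exact: horner_coef0. Qed.

Lemma dual_coef1M p q :
  dual_coef1 (p * q) = dual_aug p * dual_coef1 q + dual_coef1 p * dual_aug q.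
Proof.
(* The multiple of X^2 dropped in reducing the product has no linear coefficient. *)
have X0 (r : {poly rat}) : (r * mk_monic ('X^2 : {poly rat}))`_1 = 0.
  by rewrite mk_monic_Xn coefMXn.
have E := Pdiv.RingMonic.rdivp_eq (monic_mk_monic ('X^2 : {poly rat}))
  ((p : {poly rat}) * (q : {poly rat})).
have := congr1 (fun r : {poly rat} => r`_1) E; rewrite /= coefD X0 add0r.
rewrite -poly_of_qpolyM => EM.
transitivity (((p : {poly rat}) * (q : {poly rat}))`_1); first exact: esym EM.
by rewrite coefM big_ord_recl big_ord_recl big_ord0 addr0 !dual_augE.
Qed.

Lemma dual_coef1_qstr q : dual_coef1 (qstr q) = 0.
Proof. by rewrite /dual_coef1 /= coefC. Qed.
Lemma dual_aug_qstr q : dual_aug (qstr q) = q.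
Proof. by rewrite dual_augE /= coefC. Qed.
Lemma dual_coef1_eps : dual_coef1 eps = 1.
Proof. by rewrite /dual_coef1 /eps qpolyXE ?size_polyXn ?monicXn // coefX. Qed.
Lemma dual_aug_eps : dual_aug eps = 0.
Proof. by rewrite dual_augE /eps qpolyXE ?size_polyXn ?monicXn // coefX. Qed.

Lemma dual_eqP p q : dual_aug p = dual_aug q -> dual_coef1 p = dual_coef1 q -> p = q.
Proof.
rewrite !dual_augE => e0 e1; apply/npolyP => -[|[|i]] //.
have sz (r : dualQ) : (r : {poly %/ ('X^2 : {poly rat})})`_i.+2 = 0.
  by apply: big_coef_npoly; rewrite mk_monic_Xn size_polyXn.
by rewrite !sz.
Qed.

Lemma dual_augM p q : dual_aug (p * q) = dual_aug p * dual_aug q.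
Proof. exact: rmorphM. Qed.
Lemma dual_augD p q : dual_aug (p + q) = dual_aug p + dual_aug q.
Proof. exact: rmorphD. Qed.
Lemma dual_coef1D p q : dual_coef1 (p + q) = dual_coef1 p + dual_coef1 q.
Proof. by rewrite /dual_coef1 coefD. Qed.

Lemma eps_sqr : eps * eps = 0.
Proof.
apply: dual_eqP; first by rewrite dual_augM dual_aug_eps mul0r rmorph0.
by rewrite dual_coef1M dual_aug_eps mul0r mulr0 addr0 -(rmorph0 (@qstr dualQ)) dual_coef1_qstr.
Qed.

Lemma dual_coef1_dec a b : dual_coef1 (qstr a + eps * qstr b) = b.
Proof.
by rewrite dual_coef1D dual_coef1M !dual_coef1_qstr dual_coef1_eps dual_aug_qstr mulr0 !add0r mul1r.
Qed.
Lemma dual_aug_dec a b : dual_aug (qstr a + eps * qstr b) = a.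
Proof. by rewrite dual_augD dual_augM !dual_aug_qstr dual_aug_eps mul0r addr0. Qed.

Lemma dual_dec p : p = qstr (dual_aug p) + eps * qstr (dual_coef1 p).
Proof. by apply: dual_eqP; rewrite ?dual_aug_dec ?dual_coef1_dec. Qed.

Section DualMorphism.
Variables (A : comQAlg) (e : A).
Hypothesis e2 : e * e = 0.

(** Q[eps] is universal for square-zero elements; the proof that e squares to zero is kept as an
    argument to make this map a ring morphism. *)
Definition dual_mor of e * e = 0 := fun p : dualQ => qstr (dual_aug p) + qstr (dual_coef1 p) * e : A.

Fact dual_mor_zmod : zmod_morphism (dual_mor e2).
Proof.
move=> p q; rewrite /dual_mor dual_coef1B [dual_aug _]rmorphB !rmorphB mulrBl.
by rewrite opprD addrACA.
Qed.
Fact dual_mor_monoid : monoid_morphism (dual_mor e2).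
Proof.
split=> [|p q].
  rewrite /dual_mor -(rmorph1 (@qstr dualQ)) dual_aug_qstr dual_coef1_qstr.
  by rewrite rmorph1 rmorph0 mul0r addr0.
rewrite /dual_mor dual_coef1M dual_augM rmorphD !rmorphM mulrDl [RHS]mulrDl !mulrDr.
rewrite -addrA; congr (_ + _); rewrite mulrA; congr (_ + _).
rewrite [X in _ = _ + X]mulrACA e2 mulr0 addr0.
by rewrite -!mulrA; congr (_ * _); rewrite mulrC.
Qed.
HB.instance Definition _ := GRing.isZmodMorphism.Build dualQ A (dual_mor e2) dual_mor_zmod.
HB.instance Definition _ := GRing.isMonoidMorphism.Build dualQ A (dual_mor e2) dual_mor_monoid.

Lemma dual_mor_eps : dual_mor e2 eps = e.
Proof. by rewrite /dual_mor dual_aug_eps dual_coef1_eps rmorph0 rmorph1 mul1r add0r. Qed.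
End DualMorphism.
End DualNumbers.

(** * First-order expansions along a square-zero element *)

Section FirstOrder.
Variables (k : comPzRingType) (e : k).
Hypothesis e2 : e * e = 0.

Lemma epsM M (x x' y y' : hser k M) :
  (x + e *: x') * (y + e *: y') = x * y + e *: (x' * y + x * y').
Proof.
rewrite mulrDl !mulrDr -!hscaleAr -!hscaleAl scalerA e2 scale0r addr0.
by rewrite -addrA scalerDr [X in _ + X]addrC.
Qed.

Lemma eps_conj M (x t : hser k M) :
  (1 + e *: (- t)) * x * (1 + e *: t) = x + e *: (x * t - t * x).
Proof.
have := epsM 1 (- t) x 0; rewrite scaler0 addr0 => ->.
by rewrite epsM !mul1r !mulr1 addr0 mulNr [_ - t * x]addrC.
Qed.

Lemma eps_hinv M (x : hser k M) : connected M -> x gone = 0 ->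
  hinv (1 + e *: x) = 1 + e *: (- x).
Proof.
move=> M0 x0; apply/esym/hinv_uniq => //; first by rewrite hserDE hserE x0 mulr0 hser1E eqxx addr0.
by rewrite epsM !mul1r mulr1 subrr scaler0 addr0.
Qed.

Lemma tens_eps M N (x x' : hser k M) (y y' : hser k N) :
  tens (x + e *: x') (y + e *: y') = tens x y + e *: (tens x' y + tens x y').
Proof.
rewrite tensDl !tensDr !tensZl !tensZr scalerA e2 scale0r addr0.
by rewrite -addrA scalerDr [X in _ + X]addrC.
Qed.

Variable gT : finGroupType.
Variable psi : Xser gT k.
Hypothesis psi0 : psi gone = 0.

Let D (x : option gT) : Xser gT k :=
  if x is Some g then xlet k (Some g) * taut g psi - taut g psi * xlet k (Some g) else 0.

Lemma derX_word_filtered : filtered (fun w : Xm gT => derX_word D w).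
Proof.
have D1 x : order_ge 1 (D x).
  case: x => [g|] //; apply: order_geB; [apply: order_geMr | apply: order_geMl];
  exact: xlet_order.
move=> w; rewrite -/(order_ge (gdeg w) (derX_word D w)).
elim: (w : seq _) => [|x u IH] //=; apply: order_geD.
  exact: (order_geM (D1 x) (order_ge_mono k (u : Xm gT))).
exact: (order_geM (xlet_order k x) IH).
Qed.

Lemma derX_clin : clin (derX psi).
Proof. exact/clin_hext/derX_word_filtered. Qed.

Lemma derX_mono (w : Xm gT) : derX psi (hmono k w) = derX_word D w.
Proof. exact: (hext_mono _ derX_word_filtered). Qed.

Lemma taut_eps g : taut g (1 + e *: psi) = 1 + e *: taut g psi.
Proof.
by have [tL t1 _] := taut_cmor k g; rewrite (clinD tL) (clinZ tL) t1.
Qed.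

Lemma eps_gone : (1 + e *: psi) gone = 1.
Proof. by rewrite hserDE hserE psi0 mulr0 hser1E eqxx addr0. Qed.

(** To first order the product rule [epsM] is the Leibniz rule, and conjugation of x_g by 1 + e
    t_g(psi) adds e times the commutator that defines [derX]. *)
Lemma autX_eps f : autX (1 + e *: psi) f = f + e *: derX psi f.
Proof.
have [AL A1 AM] := autX_cmor (1 + e *: psi).
move: f; apply: clin_ext => // [|w].
  exact: (clin_add clin_id (clin_scale e derX_clin)).
rewrite derX_mono; elim: (w : seq _) => [|x u IH]; first by rewrite A1 /= scaler0 addr0.
rewrite hmono_cons AM IH [autX _ (lmono _ _)]autX_let /=.
suff -> : (if x is Some g then taut g (hinv (1 + e *: psi)) * xlet k (Some g) *
    taut g (1 + e *: psi) else xlet k None) = xlet k x + e *: D x by rewrite epsM.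
case: x => [g|] /=; last by rewrite scaler0 addr0.
have Pg : taut g psi gone = 0 by rewrite taut_gone.
rewrite taut_inv ?eps_gone // taut_eps eps_hinv //.
exact: eps_conj.
Qed.

Lemma beta1_eps : beta1 (1 + e *: psi) = 1 + e *: beta1 psi.
Proof. by have [tL t1 _] := beta1_cmor k gT; rewrite (clinD tL) (clinZ tL) t1. Qed.

Let D1 : Vhat k gT := ve1 * beta1 psi - beta1 psi * ve1.
Let Dlet (x : option gT) : Vhat k gT :=
  if x is Some h then vgrp k h * D1 * vgrp k h^-1%g else 0.

Lemma derV_word_order w : order_ge (size w) (derV_word D1 w).
Proof.
have D11 : order_ge 1 D1 by apply: order_geB; [apply: order_geMr | apply: order_geMl].
elim: w => [|x w IH] /=; first exact: order_ge0.
apply: order_geD.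
  apply: (@order_geM _ _ 1).
    by case: x => [h|] //; apply/order_geMr/order_geMl.
  by rewrite -(Vm_deg w 1%g); apply: order_ge_mono.
apply: (@order_geM _ _ 1) => //; exact: (order_ge_mono k (([:: x], 1%g) : Vm gT)).
Qed.

Lemma derV_filtered : filtered (fun p : Vm gT => derV_word D1 p.1 * vgrp k p.2).
Proof. by move=> [w g]; rewrite Vm_deg; apply/order_geMr/derV_word_order. Qed.

Lemma derV_clin : clin (derV psi).
Proof. exact/clin_hext/derV_filtered. Qed.

Lemma derV_mono w g : derV psi (hmono k ((w, g) : Vm gT)) = derV_word D1 w * vgrp k g.
Proof. exact: (hext_mono _ derV_filtered). Qed.

Lemma autV_eps v : autV (1 + e *: psi) v = v + e *: derV psi v.
Proof.
have [AL A1 AM] := autV_cmor (1 + e *: psi).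
move: v; apply: clin_ext => // [|[w g]].
  exact: (clin_add clin_id (clin_scale e derV_clin)).
elim: w => [|x w IH].
  by rewrite derV_mono /= mul0r scaler0 addr0; apply: autV_grp.
have L : autV (1 + e *: psi) (vlet k x) = vlet k x + e *: Dlet x.
  case: x => [h|] /=; last by rewrite autV_e0 scaler0 addr0.
  rewrite /vlet /= !AM !autV_grp autV_e1 eps_hinv // !beta1_eps.
  have [tL t1 _] := beta1_cmor k gT; rewrite (clinD tL) (clinZ tL) t1 (clinN tL).
  by rewrite eps_conj mulrDr mulrDl -hscaleAr -hscaleAl.
rewrite vmono_cons AM L IH epsM; congr (_ + _ *: _).
(* [derV] differentiates the word and multiplies by the group element on the right; the monomial is
   split accordingly. *)
rewrite -vmono_cons !derV_mono /= mulrDl -!mulrA vlet_hmono; congr (_ + _).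
by rewrite /vgrp -hmonoM /= cats0 mul1g.
Qed.
End FirstOrder.

(** * The stabilizer condition to first order *)

Section FirstOrderStab.
Variables (k : comQAlg) (gT : finGroupType).
Implicit Types psi : Xser gT k.

(* gendM without the degree 1 term of gamma, as in the exponent of Gamma. *)
Definition gendM2 psi (m : Mhat k gT) : Mhat k gT :=
  lmulM (- heval (lnGamma psi) (- ve1)) m + endM psi m.

Lemma lmulM_clin (v : Vhat k gT) : clin (lmulM v).
Proof.
apply: (clin_comp (projM_clin k gT)); apply: clin_mull.
by case: (iotaW_cmor k gT).
Qed.

Lemma endM_clin psi : clin (endM psi).
Proof.
have [iL _ _] := iotaW_cmor k gT.
apply: (clin_comp (projM_clin k gT)); apply: clin_add; first exact: clin_mull.
exact: (clin_comp (derV_clin psi) iL).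
Qed.

Lemma gendM2_clin psi : clin (gendM2 psi).
Proof. exact: clin_add (lmulM_clin _) (endM_clin _). Qed.

Lemma hexp_eps (e : k) s : e * e = 0 -> order_ge 1 s -> hexp (e *: s) = 1 + e *: s.
Proof.
move=> e2 s1; have es j : (e *: s) ^+ j.+2 = 0.
  by rewrite !exprS mulrA -hscaleAl -hscaleAr scalerA e2 scale0r mul0r.
apply/funext => n; rewrite /hexp big_ord_recl /= invr1 rmorph1 mul1r expr0.
case: n => [|n]; first by rewrite big_ord0 addr0 hserDE hserE s1 // mulr0 addr0.
rewrite big_ord_recl /= invr1 rmorph1 mul1r expr1 big1 ?addr0 // => i _.
by rewrite es mulr0.
Qed.

Lemma lnGamma_eps (e : k) psi : lnGamma (1 + e *: psi) = e *: lnGamma psi.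
Proof.
apply/funext => n; rewrite hserE /lnGamma; case: ifP => [n2|_]; last by rewrite mulr0.
rewrite hserDE hserE hser1E; case: n n2 => [|[|n]] // _.
by rewrite add0r mulrCA.
Qed.

(** The three factors contribute one term each: the inverse of Gamma gives minus its exponent, beta
    gives left multiplication, and [autV] gives the derivation. *)
Lemma GautM_eps (e : k) psi m : e * e = 0 -> psi gone = 0 ->
  GautM (1 + e *: psi) m = m + e *: gendM2 psi m.
Proof.
move=> e2 psi0; rewrite -{1 2}[m]projM_iotaK GautM_proj.
have l1 := lnGamma_order psi.
have -> : Gamma (1 + e *: psi) = 1 + e *: lnGamma psi.
  by rewrite -hexp_eps // -lnGamma_eps.
rewrite eps_hinv // ?l1 ?gdeg1 //.
have ve1N : order_ge 1 (- ve1 : Vhat k gT) by apply: order_geN.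
have [hL h1 _] := heval_cmor ve1N.
rewrite (clinD hL) (clinZ hL) h1 (clinN hL) beta1_eps autV_eps //.
have pL := projM_clin k gT.
rewrite !epsM // !mul1r (clinD pL) (clinZ pL) /gendM2 /lmulM /endM.
by rewrite [in RHS](clinD pL) [in LHS](clinD pL) (clinD pL).
Qed.

(** The equation defining [stab], stated for an arbitrary map so that linear combinations can be
    formed. *)
Definition coder (F : Mhat k gT -> Mhat k gT) := forall m,
  tens_map F id (DeltaM m) + tens_map id F (DeltaM m) = DeltaM (F m).

Lemma tens_map_lincomb (c : k) (F G : Mhat k gT -> Mhat k gT) x : clin F -> clin G ->
  (tens_map (fun m => F m + c *: G m) id x = tens_map F id x + c *: tens_map G id x) *
  (tens_map id (fun m => F m + c *: G m) x = tens_map id F x + c *: tens_map id G x).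
Proof.
move=> FL GL; have HL := clin_add FL (clin_scale c GL); have I := @clin_id k (Zm gT).
split; move: x; apply: clin_ext => [||[a b]].
- exact: tens_map_clin.
- by apply: clin_add; [|apply: clin_scale]; apply: tens_map_clin.
- by rewrite -tens_mono !tens_mapE // tensDl tensZl.
- exact: tens_map_clin.
- by apply: clin_add; [|apply: clin_scale]; apply: tens_map_clin.
- by rewrite -tens_mono !tens_mapE // tensDr tensZr.
Qed.

Lemma coder_lincomb (c : k) F G : clin F -> clin G -> coder F -> coder G ->
  coder (fun m => F m + c *: G m).
Proof.
move=> FL GL Fc Gc m; have DL := DeltaM_clin k gT.
rewrite !(tens_map_lincomb c (DeltaM m) FL GL).
by rewrite (clinD DL) (clinZ DL) -Fc -Gc addrACA scalerDr.
Qed.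

Lemma lmulM_e1 m : lmulM (ve1 : Vhat k gT) m = - (zlet k (0%N, 1%g : gT) * m).
Proof.
have [iL _ iM] := iotaW_cmor k gT.
have iz : iotaW (zlet k (0%N, 1%g : gT)) = - ve1.
  rewrite [LHS](alg_ext_letter _ (@iotaW_order k gT)) expr0 mul1r /=.
  by rewrite vgrp1 mul1r.
by rewrite /lmulM -[ve1]opprK -iz mulNr -iM -(clinN iL) projM_iotaK.
Qed.

(* e_1 is primitive up to sign, being -z_{1,1}. *)
Lemma coder_e1 : coder (lmulM (ve1 : Vhat k gT)).
Proof.
move=> m; have [DL _ DM] := DeltaW_cmor k gT; set z := zlet k (0%N, 1%g : gT).
have [iL _ _] := iotaW_cmor k gT; have eL := lmulM_clin (ve1 : Vhat k gT).
have I := @clin_id k (Zm gT).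
have zl x : tens_map (lmulM ve1) id x = - (tens z 1 * x) :> hser k (prodm (Zm gT) (Zm gT)).
  move: x; apply: clin_ext => [||[a b]]; first exact: tens_map_clin.
    by split=> [a f g|n f fn]; [rewrite mulrDr -hscaleAr opprD scalerN | exact/order_geN/order_geMl].
  by rewrite -tens_mono tens_mapE // lmulM_e1 tensNl -tensM mul1r.
have zr x : tens_map id (lmulM ve1) x = - (tens 1 z * x) :> hser k (prodm (Zm gT) (Zm gT)).
  move: x; apply: clin_ext => [||[a b]]; first exact: tens_map_clin.
    by split=> [a f g|n f fn]; [rewrite mulrDr -hscaleAr opprD scalerN | exact/order_geN/order_geMl].
  by rewrite -tens_mono tens_mapE // lmulM_e1 tensNr -tensM mul1r.
rewrite zl zr lmulM_e1 /DeltaM (clinN DL) DM DeltaW_let big_ord0 addr0.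
by rewrite -opprD -mulrDl.
Qed.

(** The series gamma exceeds the exponent of Gamma by the linear term (psi|x_1) x. At x = -e_1, and
    with the minus sign in front of gamma, it adds (psi|x_1) e_1. *)
Lemma gendM_split psi : gendM psi =
  fun m => gendM2 psi m + psi (x0x1 gT 1) *: lmulM (ve1 : Vhat k gT) m.
Proof.
have ve1N : order_ge 1 (- ve1 : Vhat k gT) by apply: order_geN.
have [hL h1 _] := heval_cmor ve1N; have pL := projM_clin k gT.
have gE : gamma psi = lnGamma psi + psi (x0x1 gT 1) *: hmono k (1%N : natm).
  apply/funext => -[|[|n]]; rewrite hserDE hserE /gamma /lnGamma /=.
  - by rewrite mulr0 addr0.
  - by rewrite sqrrN expr1n divr1 rmorph1 mul1r add0r mulr1.
  - by rewrite mulr0 addr0 !exprS !mulN1r opprK.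
apply/funext => m; rewrite /gendM /gendM2 gE (clinD hL) (clinZ hL).
have -> : heval (hmono k (1%N : natm)) (- ve1) = - ve1 :> Vhat k gT.
  by rewrite /heval hext_mono ?expr1 // => n c; apply: order_geX.
rewrite addrAC; congr (_ + _); rewrite /lmulM scalerN opprB mulrDl (clinD pL) addrC.
by rewrite -hscaleAl (clinZ pL).
Qed.

Lemma coder_gendM psi : coder (gendM psi) <-> coder (gendM2 psi).
Proof.
have eL := lmulM_clin (ve1 : Vhat k gT); have gL := gendM2_clin psi.
split=> gc; last by rewrite gendM_split; apply: coder_lincomb => //; apply: coder_e1.
have -> : gendM2 psi = fun m => gendM psi m + (- psi (x0x1 gT 1)) *: lmulM ve1 m.
  by apply/funext => m; rewrite gendM_split scaleNr addrK.
apply: coder_lincomb => //; last exact: coder_e1.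
by rewrite gendM_split; apply: clin_add => //; apply: clin_scale.
Qed.

(** Comparing constant terms, c = c + c. *)
Lemma Lib_gone psi : Lib psi -> psi gone = 0.
Proof.
move=> L; have := cmor_gone psi (@Xm_connected gT) (hatDelta_cmor k gT).
rewrite L hserDE /tens /= !hser1E eqxx mulr1 mul1r => /eqP.
by rewrite -subr_eq0 addrK => /eqP.
Qed.

Lemma tens_map_eps (e : k) (F : Mhat k gT -> Mhat k gT) x : e * e = 0 -> clin F ->
  tens_map (fun m => m + e *: F m) (fun m => m + e *: F m) x =
  x + e *: (tens_map F id x + tens_map id F x).
Proof.
move=> e2 FL; have HL := clin_add clin_id (clin_scale e FL); have I := @clin_id k (Zm gT).
move: x; apply: clin_ext => [||[a b]].
- exact: tens_map_clin.
- by apply: (clin_add clin_id); apply/clin_scale/clin_add; apply: tens_map_clin.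
- by rewrite -tens_mono !tens_mapE // tens_eps.
Qed.
End FirstOrderStab.

(** * The Lie algebra of the stabilizer *)

Section LieAlgebra.
Variable gT : finGroupType.
Implicit Types psi : Xser gT ratQ.

Definition qmap (A : comQAlg) M (x : hser ratQ M) : hser A M :=
  hmap (@qstr A : {rmorphism ratQ -> A}) x.

Definition one_plus (A : comQAlg) (e : A) psi : Xser gT A := 1 + e *: qmap A psi.

Lemma one_epsE psi : one_eps psi = one_plus eps psi. Proof. by []. Qed.

Lemma hmap_gendM2 (A B : comQAlg) (f : {rmorphism A -> B}) (phi : Xser gT A) m :
  hmap f (gendM2 phi m) = gendM2 (hmap f phi) (hmap f m) :> Mhat B gT.
Proof.
rewrite /gendM2 hmapD hmap_lmulM hmap_endM; congr (lmulM _ _ + _).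
rewrite !hmapN hmap_heval hmapN hmap_ve1; congr (- heval _ _).
apply/funext => n; rewrite /lnGamma /hmap.
by case: ifP => _; rewrite ?rmorph0 // rmorphM qstr_morph.
Qed.

Lemma eps_qmap_inj M (x y : hser ratQ M) :
  eps *: qmap dualQ x = eps *: qmap dualQ y -> x = y.
Proof.
move=> xy; apply/funext => b; have := congr1 (fun h : hser dualQ M => dual_coef1 (h b)) xy.
have E (z : hser ratQ M) : dual_coef1 ((eps *: qmap dualQ z) b) = z b.
  by rewrite -[RHS](dual_coef1_dec 0 (z b)) rmorph0 add0r.
by rewrite /= !E.
Qed.

Lemma one_plus_gone (A : comQAlg) (e : A) psi : psi gone = 0 -> one_plus e psi gone = 1.
Proof. by move=> psi0; apply: eps_gone; rewrite /qmap /hmap psi0 rmorph0. Qed.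

(** Each equation of [StabP] reads a + eps b = a + eps b' with b and b' coming from Q, and eps times
    a rational series determines that series. *)
Lemma Stab_one_eps psi : Stab gT dualQ (one_eps psi) <-> stab gT psi.
Proof.
rewrite one_epsE; set Psi := one_plus eps psi.
pose psi' := qmap dualQ psi; have e2 := eps_sqr.
have DPsi : hatDelta Psi = 1 + eps *: qmap dualQ (hatDelta psi).
  have [DL D1 _] := hatDelta_cmor dualQ gT.
  by rewrite /Psi /one_plus (clinD DL) (clinZ DL) D1 /qmap hmap_hatDelta.
have TPsi : tens Psi Psi = 1 + eps *: qmap dualQ (tens psi 1 + tens 1 psi).
  by rewrite /Psi /one_plus tens_eps // tens11 /qmap hmapD !hmap_tens hmap1.
have LibP : hatDelta Psi = tens Psi Psi <-> Lib psi.
  rewrite DPsi TPsi; split=> [/addrI/eps_qmap_inj //|->//].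
have goneP : Psi gone = 1 <-> psi gone = 0.
  rewrite /Psi /one_plus hserDE hser1E eqxx; split=> [/eqP|psi0].
    rewrite -subr_eq0 addrAC subrr add0r => /eqP p0.
    have := dual_coef1_dec 0 (psi gone); rewrite rmorph0 add0r => <-.
    have -> : eps * qstr (psi gone) = 0 by exact: p0.
    by rewrite -(rmorph0 (@qstr dualQ)) dual_coef1_qstr.
  by rewrite hserE /qmap /hmap psi0 rmorph0 mulr0 addr0.
have coderP : psi gone = 0 ->
    (forall u : Zm gT, tens_map (GautM Psi) (GautM Psi) (DeltaM (hmono dualQ u))
      = DeltaM (GautM Psi (hmono dualQ u))) <-> coder (gendM2 psi).
  move=> psi0; have psi0' : psi' gone = 0 by rewrite /psi' /qmap /hmap psi0 rmorph0.
  have GE : GautM Psi = fun m => m + eps *: gendM2 psi' m.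
    by apply/funext => m; apply: GautM_eps.
  have gL := gendM2_clin psi; have gL' := gendM2_clin psi'; have DL := DeltaM_clin ratQ gT.
  have I := @clin_id ratQ (Zm gT).
  have gn y : qmap dualQ (gendM2 psi y) = gendM2 psi' (qmap dualQ y) by exact: hmap_gendM2.
  (* Monomials are defined over Q, so on them the zeroth-order terms agree and the rest is eps times
     the rational equation. *)
  have E (u : Zm gT) : tens_map (GautM Psi) (GautM Psi) (DeltaM (hmono dualQ u))
      = DeltaM (GautM Psi (hmono dualQ u)) <->
    tens_map (gendM2 psi) id (DeltaM (hmono ratQ u)) +
      tens_map id (gendM2 psi) (DeltaM (hmono ratQ u)) = DeltaM (gendM2 psi (hmono ratQ u)).
    have uE : hmono dualQ u = qmap dualQ (hmono ratQ u) by rewrite /qmap hmap_mono.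
    have [DL' _] := conj (DeltaM_clin dualQ gT) I.
    rewrite GE tens_map_eps // (clinD DL') (clinZ DL') uE -gn /qmap -!hmap_DeltaM.
    rewrite -(hmap_tens_map (F := gendM2 psi) (F' := id)) //.
    rewrite -(hmap_tens_map (F := id) (F' := gendM2 psi)) // -hmapD.
    by split=> [/addrI/eps_qmap_inj //|->].
  split=> [H|H u]; last exact/E/H.
  move=> m; move: m; apply: clin_ext => [||u]; last exact/E/H.
    apply: (clin_add (F := fun m => tens_map (gendM2 psi) id (DeltaM m))
      (G := fun m => tens_map id (gendM2 psi) (DeltaM m))).
      by apply: clin_comp => //; apply: tens_map_clin.
    by apply: clin_comp => //; apply: tens_map_clin.
  exact: clin_comp.
split=> [/StabP[P1 /LibP L S]|[L S]].
  by split=> //; apply/coder_gendM/coderP => //; apply/goneP.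
have psi0 := Lib_gone L; have /coder_gendM S2 : coder (gendM psi) := S.
by apply/StabP; split; [exact/goneP | exact/LibP | exact: (coderP psi0).2 S2].
Qed.

(** A dual number is its augmentation plus eps times a rational, so a series reducing to 1 has the
    form 1 + eps psi. *)
Lemma Lie_ker_Stab : Lie_ker (fun k : comQAlg => Stab gT k)
  = [set one_eps psi | psi in stab gT]%classic.
Proof.
apply/seteqP; split=> [Psi [SP P1]|_ [psi /Stab_one_eps S <-]]; last first.
  split=> //; apply/funext => b; rewrite /hmap.
  rewrite -[one_eps psi b]/((gone == b)%:R + eps * qstr (psi b)) -(rmorph_nat (@qstr dualQ)).
  exact: dual_aug_dec.
pose psi : Xser gT ratQ := fun b => dual_coef1 (Psi b).
have PE : one_eps psi = Psi.
  apply/funext => b; rewrite [RHS]dual_dec.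
  have -> : dual_aug (Psi b) = (gone == b)%:R by exact: (congr1 (fun h : Xser gT ratQ => h b) P1).
  by rewrite rmorph_nat.
by exists psi => //; apply/Stab_one_eps; rewrite PE.
Qed.

Lemma hmap_one_eps (A : comQAlg) (e : A) (ee : e * e = 0) psi :
  hmap (dual_mor ee) (one_eps psi) = one_plus e psi.
Proof.
rewrite one_epsE /one_plus hmapD hmap1 hmapZ; congr (_ + _ *: _).
  exact: dual_mor_eps.
by apply/funext => b; exact: qstr_morph.
Qed.

Lemma Stab_one_plus (A : comQAlg) (e : A) psi : e * e = 0 -> stab gT psi ->
  Stab gT A (one_plus e psi).
Proof. by move=> ee /Stab_one_eps/(Stab_hmap (dual_mor ee)); rewrite hmap_one_eps. Qed.

Lemma stab_gone psi : stab gT psi -> psi gone = 0.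
Proof. by case=> /Lib_gone. Qed.

Lemma derX1 (k : comPzRingType) (phi : Xser gT k) : derX phi 1 = 0.
Proof. by rewrite [LHS](@derX_mono k gT phi [::]). Qed.

Lemma qmap_gone (A : comQAlg) psi : psi gone = 0 -> qmap A psi gone = 0.
Proof. by move=> psi0; rewrite /qmap /hmap psi0 rmorph0. Qed.

Lemma qmapD (A : comQAlg) M (x y : hser ratQ M) : qmap A (x + y) = qmap A x + qmap A y.
Proof. exact: hmapD. Qed.
Lemma qmapZ (A : comQAlg) M (q : rat) (x : hser ratQ M) :
  qmap A (q *: x) = qstr q *: qmap A x.
Proof. exact: hmapZ. Qed.

(** Both eps and q eps square to zero, and in the twisted product of 1 + q eps psi1 and 1 + eps psi2
    the cross term carries eps^2. *)
Lemma stab_lincomb (q : rat) psi1 psi2 : stab gT psi1 -> stab gT psi2 ->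
  stab gT (hscale (qstr q) psi1 + psi2).
Proof.
move=> s1 s2; apply/Stab_one_eps; rewrite one_epsE; have e2 := eps_sqr.
have qe2 : (qstr q * eps) * (qstr q * eps) = 0 :> dualQ by rewrite mulrACA e2 mulr0.
have [p1 p2] := (qmap_gone dualQ (stab_gone s1), qmap_gone dualQ (stab_gone s2)).
suff -> : one_plus eps (hscale (qstr q) psi1 + psi2 : Xser gT ratQ)
    = circ gT dualQ (one_plus (qstr q * eps) psi1) (one_plus eps psi2).
  by apply: Stab_circ; apply: Stab_one_plus.
have dL := derX_clin (qmap dualQ psi1).
rewrite /circ /one_plus autX_eps // (clinD dL) derX1 add0r (clinZ dL) scalerA.
rewrite -mulrA e2 mulr0 scale0r addr0 mulrDl mul1r mulrDr mulr1.
rewrite -hscaleAl -hscaleAr scalerA -mulrA e2 mulr0 scale0r addr0.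
rewrite -addrA; congr (_ + _); rewrite -[hscale _ _]/(q *: psi1) qmapD qmapZ scalerDr.
by rewrite scalerA addrC [eps * _]mulrC.
Qed.

Lemma ihara_gone psi1 psi2 : psi1 gone = 0 -> psi2 gone = 0 -> ihara psi1 psi2 gone = 0.
Proof.
have sX0 (phi phi' : Xser gT ratQ) : phi gone = 0 -> sX phi phi' gone = 0.
  move=> phi0; rewrite /sX hserDE hmul_gone // phi0 mul0r add0r.
  have dL := derX_clin phi.
  rewrite -[phi'](subrK (phi' gone *: (1 : Xser gT ratQ))) (clinD dL) (clinZ dL) derX1.
  rewrite scaler0 addr0 (dL.2 1%N) ?gdeg1 //.
  by apply/order_ge1P; rewrite // hserBE hserE hser1E eqxx mulr1 subrr.
by move=> p1 p2; rewrite /ihara hserBE !sX0 // subrr.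
Qed.

(** The cross term s_psi(psi') is what fails to be symmetric; its antisymmetrization is the
    bracket. *)
Lemma circ_one_plus (A : comQAlg) (a b : A) psi psi' : a * a = 0 -> psi gone = 0 ->
  circ gT A (one_plus a psi) (one_plus b psi') = 1 + a *: qmap A psi + b *: qmap A psi'
    + (a * b) *: sX (qmap A psi) (qmap A psi').
Proof.
move=> aa psi0; have dL := derX_clin (qmap A psi).
rewrite /circ /one_plus autX_eps ?qmap_gone // (clinD dL) derX1 add0r (clinZ dL).
rewrite scalerA mulrDl mul1r -hscaleAl !mulrDr mulr1 -!hscaleAr !scalerDr !scalerA.
rewrite [a * (a * b)]mulrA aa mul0r scale0r addr0 -!addrA; congr (_ + _).
by rewrite [RHS]addrCA; congr (_ + _); rewrite [LHS]addrCA; congr (_ + _); exact: addrC.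
Qed.

(* In Q[e_1,e_2]/(e_1^2,e_2^2), the commutator of 1 + e_1 psi_1 and 1 + e_2 psi_2 is
   1 + e_1 e_2 <psi_1,psi_2>. *)
Lemma circ_ihara (A : comQAlg) (e1 e2 : A) psi1 psi2 : e1 * e1 = 0 -> e2 * e2 = 0 ->
  psi1 gone = 0 -> psi2 gone = 0 ->
  circ gT A (one_plus (e1 * e2) (ihara psi1 psi2))
    (circ gT A (one_plus e2 psi2) (one_plus e1 psi1))
  = circ gT A (one_plus e1 psi1) (one_plus e2 psi2).
Proof.
move=> e11 e22 g1 g2; have x0 := qmap_gone A (ihara_gone g1 g2).
have a12 := circ_one_plus e2 psi2 e11 g1; have a21 := circ_one_plus e1 psi1 e22 g2.
have dL := derX_clin (qmap A (ihara psi1 psi2)).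
have xE : qmap A (ihara psi1 psi2) =
    sX (qmap A psi1) (qmap A psi2) - sX (qmap A psi2) (qmap A psi1).
  by rewrite /ihara /qmap hmapB /sX !hmapD !hmapM !hmap_derX.
have ee : (e1 * e2) * (e1 * e2) = 0 by rewrite mulrACA e11 mul0r.
have ee1 : (e1 * e2) * e1 = 0 by rewrite mulrAC e11 mul0r.
have ee2 : (e1 * e2) * e2 = 0 by rewrite -mulrA e22 mulr0.
rewrite a12 a21 [e2 * e1]mulrC.
move: xE; set u := sX _ _; set v := sX _ _; set x := qmap A (ihara _ _) => xE.
set f : Xser gT A := 1 + _ + _ + _ *: v.
(* Every term of f except 1 carries e1 or e2, so e1 e2 annihilates it. *)
have ef : (e1 * e2) *: f = (e1 * e2) *: (1 : Xser gT A).
  by rewrite /f !scalerDr !scalerA ee ee1 ee2 !scale0r !addr0.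
rewrite /circ {1}/one_plus autX_eps // -/x -(clinZ dL) ef (clinZ dL) derX1 scaler0 addr0.
rewrite /one_plus -/x mulrDl mul1r -hscaleAl hscaleAr ef -hscaleAr mulr1 /f xE.
rewrite scalerBr -!addrA; congr (_ + _).
by rewrite [LHS]addrCA; congr (_ + (_ + _)); rewrite addrC subrK.
Qed.

Lemma Stab_ihara (A : comQAlg) (e1 e2 : A) psi1 psi2 : e1 * e1 = 0 -> e2 * e2 = 0 ->
  stab gT psi1 -> stab gT psi2 -> Stab gT A (one_plus (e1 * e2) (ihara psi1 psi2)).
Proof.
move=> e11 e22 s1 s2; have [g1 g2] := conj (stab_gone s1) (stab_gone s2).
have S1 := Stab_one_plus e11 s1; have S2 := Stab_one_plus e22 s2.
have cx := circ_ihara e11 e22 g1 g2; have Sf := Stab_circ S2 S1.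
have [_ _ _ _ /(_ _ Sf) [y [Sy fy _]]] := Stab_group A gT.
set Xi := one_plus _ _ in cx *; set f := circ _ _ _ (one_plus e1 _) in Sf fy cx.
have Xi1 : Xi gone = 1 by exact: (one_plus_gone _ (ihara_gone g1 g2)).
(* The inverse y of f in the group Stab solves the commutator identity for Xi. *)
have -> : Xi = circ gT A (circ gT A Xi f) y.
  by rewrite -circA // ?fy ?circ1r //; exact: (Stab_gone Sf).
by rewrite cx; exact: Stab_circ (Stab_circ S1 S2) Sy.
Qed.

(** The two parameters e1 and e2 live in Q[eps] tensor Q[eps], and membership in Stab is pulled back
    along the injection eps |-> e1 e2. *)
Lemma stab_ihara psi1 psi2 : stab gT psi1 -> stab gT psi2 -> stab gT (ihara psi1 psi2).
Proof.
move=> s1 s2; pose A := tensQ dualQ dualQ; set xi := ihara psi1 psi2.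
pose e1 : A := tinl dualQ eps; pose e2 : A := @tinr dualQ dualQ eps; pose e := e1 * e2.
have e11 : e1 * e1 = 0 by rewrite -[LHS](rmorphM (@tinl dualQ dualQ)) eps_sqr rmorph0.
have e22 : e2 * e2 = 0 by rewrite -[LHS](rmorphM (@tinr dualQ dualQ)) eps_sqr rmorph0.
have ee : e * e = 0 by rewrite /e mulrACA e11 mul0r.
have Sx : Stab gT A (one_plus e xi) by exact: Stab_ihara.
apply/Stab_one_eps.
apply: (@Stab_reflect gT unit dualQ (fun=> A) (fun=> dual_mor ee)) => [a b /(_ tt) ab|_].
  (* For injectivity, two bilinear forms recover the constant and the first-order coefficient from
     the image. *)
  have bil0 : qbilinear (fun p q => dual_aug p * dual_aug q : rat^o).
    split=> [y'|x'] q z z'; rewrite dual_augD dual_augM dual_aug_qstr.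
      by rewrite mulrDl -mulrA.
    by rewrite mulrDr mulrCA.
  have bil : qbilinear (fun p q => dual_coef1 p * dual_coef1 q : rat^o).
    split=> [y'|x'] q z z'; rewrite dual_coef1D dual_coef1M dual_coef1_qstr mul0r addr0 dual_aug_qstr.
      by rewrite mulrDl -mulrA.
    by rewrite mulrDr mulrCA.
  have EE (c : dualQ) : dual_mor ee c =
      tpure (qstr (dual_aug c) : dualQ) 1 + tpure (qstr (dual_coef1 c) * eps : dualQ) eps.
    rewrite /dual_mor; congr (_ + _).
    have -> : e = tpure eps eps by exact: tinlr.
    by rewrite [LHS]tpureM mul1r.
  have A1 c : teval (fun p q => dual_aug p * dual_aug q : rat^o) (dual_mor ee c) = dual_aug c.
    rewrite EE tevalD // !teval_pure // dual_aug_eps mulr0 addr0 dual_aug_qstr.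
    by rewrite -[RHS]mulr1; congr (_ * _); exact: (dual_aug_qstr 1).
  have C1 c : teval (fun p q => dual_coef1 p * dual_coef1 q : rat^o) (dual_mor ee c) = dual_coef1 c.
    rewrite EE tevalD // !teval_pure // dual_coef1_qstr mul0r add0r dual_coef1_eps mulr1.
    by rewrite dual_coef1M dual_coef1_eps dual_coef1_qstr mul0r addr0 dual_aug_qstr mulr1.
  by apply: dual_eqP; [rewrite -A1 ab A1 | rewrite -C1 ab C1].
by rewrite hmap_one_eps.
Qed.

Lemma stab_Lie_subalgebra : is_Lie_subalgebra (stab gT).
Proof.
have s0 : stab gT 0.
  apply/Stab_one_eps; rewrite one_epsE /one_plus /qmap hmap0 scaler0 addr0.
  exact: Stab1.
by split; [move=> psi [] | exact: s0 | exact: stab_lincomb | exact: stab_ihara].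
Qed.
End LieAlgebra.

Local Open Scope classical_set_scope.

Theorem proposition4p2p3 (gT : finGroupType) (abG : abelian [set: gT]%SET) :
  is_affine_group_scheme (U := fun k : comQAlg => Xser gT k)
    (fun (A B : comQAlg) (f : {rmorphism A -> B}) => hmap f)
    (fun k : comQAlg => Stab gT k) (fun k : comQAlg => circ gT k)
    (fun k : comQAlg => 1%R)
  /\ is_Lie_subalgebra (stab gT)
  /\ Lie_ker (fun k : comQAlg => Stab gT k)
       = [set one_eps psi | psi in stab gT].
Proof.
split; first exact: Stab_affine_group_scheme.
by split; [exact: stab_Lie_subalgebra | exact: Lie_ker_Stab].
Qed.
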